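(* Let $R$ be a commutative artinian ring, and denote by $n$ the number of maximal ideals of $R$. Then $\ell(\operatorname{Perf} R)=n$, and $\operatorname{Perf} R$ satisfies the JD property.
   Context: $\operatorname{Perf}R$ is the triangulated category of perfect complexes over $R$. A thick subcategory of a triangulated category $\mathcal{T}$ is a full triangulated subcategory closed under isomorphisms and direct summands. $\mathcal{T}$ is simple if $\mathcal{T}\neq 0$ and its only thick subcategories are $0$ and $\mathcal{T}$. A composition series of $\mathcal{T}$ is a finite chain $0=\mathcal{S}_0\subsetneq\cdots\subsetneq\mathcal{S}_m=\mathcal{T}$ of thick subcategories with each Verdier quotient $\mathcal{S}_i/\mathcal{S}_{i-1}$ simple; its length is $m$. $\ell(\mathcal{T})$ is the minimum of the lengths of composition series of $\mathcal{T}$ ($0$ if $\mathcal{T}=0$, $\infty$ if there is none). $\mathcal{T}$ with $\ell(\mathcal{T})<\infty$ satisfies the JD property if all its composition series have the same length. *)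

(* Defs.v *)
From HB Require Import structures.
From mathcomp Require Import all_boot all_order all_algebra.
From mathcomp Require Import boolp classical_sets functions cardinality.

Set Implicit Arguments.
Unset Strict Implicit.
Unset Printing Implicit Defensive.

Import Order.TTheory GRing.Theory Num.Theory.
Local Open Scope ring_scope.
Local Open Scope classical_set_scope.

(* Hom-sets are setoids: [heq] is the equality of morphisms.  [shiftCat] and   *)
(* [triCat] record only the data of a triangulated category: every notion      *)
(* below (thick subcategory, Verdier quotient, length...) depends only on them. *)
Record shiftCat := ShiftCat {
  obj :> Type;
  hom : obj -> obj -> Type;
  heq : forall X Y, hom X Y -> hom X Y -> Prop;
  idm : forall X, hom X X;
  comp : forall X Y Z, hom Y Z -> hom X Y -> hom X Z;
  zerom : forall X Y, hom X Y;
  addm : forall X Y, hom X Y -> hom X Y -> hom X Y;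
  oppm : forall X Y, hom X Y -> hom X Y;
  shift : obj -> obj;
  shiftm : forall X Y, hom X Y -> hom (shift X) (shift Y)
}.

Arguments idm {s} X.
Arguments zerom {s} X Y.
Arguments shift {s} X.

Declare Scope tricat_scope.
Local Open Scope tricat_scope.
Notation "f ≈ g" := (heq f g) (at level 70, no associativity) : tricat_scope.
Notation "g ∘ f" := (comp g f) (at level 40, left associativity) : tricat_scope.

Section ShiftCatTheory.
Variable C : shiftCat.
Implicit Types X Y Z : C.

Definition is_iso X Y (f : hom X Y) : Prop :=
  exists g : hom Y X, g ∘ f ≈ idm X /\ f ∘ g ≈ idm Y.

Definition isomorphic X Y : Prop := exists f : hom X Y, is_iso f.

Definition is_zero X : Prop :=
  forall Y, (forall f : hom X Y, f ≈ zerom X Y) /\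
            (forall f : hom Y X, f ≈ zerom Y X).

Definition is_direct_sum X Y Z : Prop :=
  exists (i : hom X Z) (j : hom Y Z) (p : hom Z X) (q : hom Z Y),
    [/\ p ∘ i ≈ idm X, q ∘ j ≈ idm Y, p ∘ j ≈ zerom Y X, q ∘ i ≈ zerom X Y
      & addm (i ∘ p) (j ∘ q) ≈ idm Z].

Definition triangle_iso X Y Z (f : hom X Y) (g : hom Y Z) (h : hom Z (shift X))
    X' Y' Z' (f' : hom X' Y') (g' : hom Y' Z') (h' : hom Z' (shift X')) : Prop :=
  exists (a : hom X X') (b : hom Y Y') (c : hom Z Z'),
    [/\ is_iso a, is_iso b & is_iso c] /\
    [/\ b ∘ f ≈ f' ∘ a, c ∘ g ≈ g' ∘ b & shiftm a ∘ h ≈ h' ∘ c].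

End ShiftCatTheory.

Record triCat := TriCat {
  tcat :> shiftCat;
  dist : forall X Y Z : tcat,
    hom X Y -> hom Y Z -> hom Z (shift X) -> Prop
}.

(* Closure under the inverse shift is the right-to-left part of [thick_shift]; *)
(* by rotation, closure under cones then gives two-out-of-three on triangles.  *)
Record thick (T : triCat) (S : T -> Prop) : Prop := Thick {
  thick_zero : forall X, is_zero X -> S X;
  thick_iso : forall X Y, isomorphic X Y -> S X -> S Y;
  thick_shift : forall X, S (shift X) <-> S X;
  thick_cone : forall X Y Z (f : hom X Y) (g : hom Y Z) (h : hom Z (shift X)),
    dist f g h -> S X -> S Y -> S Z;
  thick_summand : forall X Y Z, is_direct_sum X Y Z -> S Z -> S X
}.

Record thickSub (T : triCat) := ThickSub {
  tset :> T -> Prop;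
  tsetP : thick tset
}.

Section FullSubcategory.
Variables (T : triCat) (P : T -> Prop).
Hypothesis shiftP : forall X, P X -> P (shift X).

Definition fullShiftCat : shiftCat := {|
  obj := {X : T | P X};
  hom := fun X Y => hom (sval X) (sval Y);
  heq := fun X Y f g => f ≈ g;
  idm := fun X => idm (sval X);
  comp := fun X Y Z g f => g ∘ f;
  zerom := fun X Y => zerom (sval X) (sval Y);
  addm := fun X Y f g => addm f g;
  oppm := fun X Y f => oppm f;
  shift := fun X => exist _ (shift (sval X)) (shiftP (svalP X));
  shiftm := fun X Y f => shiftm f
|}.

Definition fullCat : triCat := {|
  tcat := fullShiftCat;
  dist := fun X Y Z (f : @hom fullShiftCat X Y) (g : @hom fullShiftCat Y Z)
              (h : @hom fullShiftCat Z (shift X)) =>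
            @dist T (sval X) (sval Y) (sval Z) f g h
|}.
End FullSubcategory.

Definition thickCat (T : triCat) (S : thickSub T) : triCat :=
  @fullCat T S (fun X => (thick_shift (tsetP S) X).2).

(* Localization of [C] at [W], presented by generators and relations: the       *)
(* universal additive category with shift in which the morphisms of [W] become  *)
(* invertible.  When [W] is the class of morphisms with cone in a thick         *)
(* subcategory, [W] has a calculus of fractions compatible with sums and shift, *)
(* so that this is the usual category of fractions.                             *)
Section Localization.
Variables (C : shiftCat) (W : forall X Y : C, hom X Y -> Prop).

Inductive lhom : C -> C -> Type :=
| lemb X Y : hom X Y -> lhom X Y
| linv X Y (s : hom X Y) : W s -> lhom Y X
| lcomp X Y Z : lhom Y Z -> lhom X Y -> lhom X Z
| ladd X Y : lhom X Y -> lhom X Y -> lhom X Y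
| lopp X Y : lhom X Y -> lhom X Y
| lshift X Y : lhom X Y -> lhom (shift X) (shift Y).

Let lid X := lemb (idm X).
Let lzero X Y := lemb (zerom X Y).

Inductive lheq : forall X Y, lhom X Y -> lhom X Y -> Prop :=
| lheq_refl X Y (f : lhom X Y) : lheq f f
| lheq_sym X Y (f g : lhom X Y) : lheq f g -> lheq g f
| lheq_trans X Y (f g h : lhom X Y) : lheq f g -> lheq g h -> lheq f h
| lheq_comp X Y Z (g g' : lhom Y Z) (f f' : lhom X Y) :
    lheq g g' -> lheq f f' -> lheq (lcomp g f) (lcomp g' f')
| lheq_add X Y (f f' g g' : lhom X Y) :
    lheq f f' -> lheq g g' -> lheq (ladd f g) (ladd f' g')
| lheq_opp X Y (f f' : lhom X Y) : lheq f f' -> lheq (lopp f) (lopp f')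
| lheq_shift X Y (f f' : lhom X Y) : lheq f f' -> lheq (lshift f) (lshift f')
| lcompA X Y Z V (h : lhom Z V) (g : lhom Y Z) (f : lhom X Y) :
    lheq (lcomp h (lcomp g f)) (lcomp (lcomp h g) f)
| lcomp1l X Y (f : lhom X Y) : lheq (lcomp (lid Y) f) f
| lcomp1r X Y (f : lhom X Y) : lheq (lcomp f (lid X)) f
| laddA X Y (f g h : lhom X Y) : lheq (ladd f (ladd g h)) (ladd (ladd f g) h)
| laddC X Y (f g : lhom X Y) : lheq (ladd f g) (ladd g f)
| ladd0 X Y (f : lhom X Y) : lheq (ladd (lzero X Y) f) f
| laddN X Y (f : lhom X Y) : lheq (ladd (lopp f) f) (lzero X Y)
| lcompDl X Y Z (g g' : lhom Y Z) (f : lhom X Y) :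
    lheq (lcomp (ladd g g') f) (ladd (lcomp g f) (lcomp g' f))
| lcompDr X Y Z (g : lhom Y Z) (f f' : lhom X Y) :
    lheq (lcomp g (ladd f f')) (ladd (lcomp g f) (lcomp g f'))
| lshift1 X : lheq (lshift (lid X)) (lid (shift X))
| lshift_comp X Y Z (g : lhom Y Z) (f : lhom X Y) :
    lheq (lshift (lcomp g f)) (lcomp (lshift g) (lshift f))
| lshiftD X Y (f g : lhom X Y) :
    lheq (lshift (ladd f g)) (ladd (lshift f) (lshift g))
| lheq_emb X Y (f f' : hom X Y) : f ≈ f' -> lheq (lemb f) (lemb f')
| lemb_comp X Y Z (g : hom Y Z) (f : hom X Y) :
    lheq (lemb (g ∘ f)) (lcomp (lemb g) (lemb f))
| lembD X Y (f g : hom X Y) : lheq (lemb (addm f g)) (ladd (lemb f) (lemb g))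
| lemb_shift X Y (f : hom X Y) : lheq (lemb (shiftm f)) (lshift (lemb f))
| lcompVl X Y (s : hom X Y) (Ws : W s) : lheq (lcomp (linv Ws) (lemb s)) (lid X)
| lcompVr X Y (s : hom X Y) (Ws : W s) : lheq (lcomp (lemb s) (linv Ws)) (lid Y).

Definition localization : shiftCat := {|
  obj := C;
  hom := lhom;
  heq := lheq;
  idm := lid;
  comp := lcomp;
  zerom := lzero;
  addm := ladd;
  oppm := lopp;
  shift := @shift C;
  shiftm := lshift
|}.
End Localization.

Section Verdier.
Variables (T : triCat) (N : T -> Prop).

Definition cone_in (X Y : T) (s : hom X Y) : Prop :=
  exists (Z : T) (g : hom Y Z) (h : hom Z (shift X)), dist s g h /\ N Z.

Let Q := localization (@cone_in).

Definition verdier : triCat := {|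
  tcat := Q;
  dist := fun X Y Z (f : @hom Q X Y) (g : @hom Q Y Z) (h : @hom Q Z (shift X)) =>
    exists (X' Y' Z' : T) (f' : hom X' Y') (g' : hom Y' Z')
           (h' : hom Z' (shift X')),
      dist f' g' h' /\
      @triangle_iso Q X Y Z f g h X' Y' Z'
        (lemb (@cone_in) f') (lemb (@cone_in) g') (lemb (@cone_in) h')
|}.
End Verdier.
Arguments verdier : clear implicits.

Definition simple (T : triCat) : Prop :=
  (exists X : T, ~ is_zero X) /\
  forall S : T -> Prop, thick S ->
    (forall X, S X <-> is_zero X) \/ (forall X, S X).

(* Only the values of [S] at indices at most [m] matter. *)
Definition composition_series (T : triCat) (m : nat) (S : nat -> thickSub T) :
    Prop :=
  [/\ forall X, S 0 X <-> is_zero X,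
      forall X, S m X,
      forall i, (i < m)%N ->
        (forall X, S i X -> S i.+1 X) /\ (exists X, S i.+1 X /\ ~ S i X)
    & forall i, (i < m)%N ->
        simple (verdier (thickCat (S i.+1)) (fun X => S i (sval X)))].

Definition has_series (T : triCat) (m : nat) : Prop :=
  exists S : nat -> thickSub T, composition_series m S.

(* [None] stands for infinity. *)
Definition ell (T : triCat) : option nat :=
  match pselect (exists m, `[< has_series T m >]) with
  | left ex_series => Some (ex_minn ex_series)
  | right _ => None
  end.

Definition JD (T : triCat) : Prop :=
  ell T <> None /\
  forall m m' (S S' : nat -> thickSub T),
    composition_series m S -> composition_series m' S' -> m = m'.

Section Complexes.
#[local] Obligation Tactic := idtac.
Variable R : pzRingType.

Record complex := Complex {
  cmod :> int -> lmodType R;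
  cdiff : forall i, {linear cmod i -> cmod (i + 1)};
  cdiffK : forall i x, cdiff (i + 1) (cdiff i x) = 0
}.
Arguments cdiff : clear implicits.

Record chainMap (X Y : complex) := ChainMap {
  cmap :> forall i, {linear X i -> Y i};
  cmapP : forall i x, cmap (i + 1) (cdiff X i x) = cdiff Y i (cmap i x)
}.

(* Homotopies are indexed by their target degree, and the condition is stated  *)
(* in degree [i + 1], to keep the types of composites convertible.             *)
Definition homotopic (X Y : complex) (f g : chainMap X Y) : Prop :=
  exists h : forall i, {linear X (i + 1) -> Y i},
    forall i x, f (i + 1) x - g (i + 1) x =
      cdiff Y i (h i x) + h (i + 1) (cdiff X (i + 1) x).

Program Definition chain_id (X : complex) : chainMap X X :=
  @ChainMap X X (fun i => idfun) _.
Next Obligation. by []. Qed.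

Program Definition chain_comp (X Y Z : complex) (g : chainMap Y Z)
    (f : chainMap X Y) : chainMap X Z :=
  @ChainMap X Z (fun i => (g i \o f i : X i -> Z i)) _.
Next Obligation. by move=> X Y Z g f i x; rewrite /= !cmapP. Qed.

Program Definition chain_zero (X Y : complex) : chainMap X Y :=
  @ChainMap X Y (fun i => (\0 : X i -> Y i)) _.
Next Obligation. by move=> X Y i x; rewrite /= raddf0. Qed.

Program Definition chain_add (X Y : complex) (f g : chainMap X Y) :
    chainMap X Y :=
  @ChainMap X Y (fun i => (f i \+ g i : X i -> Y i)) _.
Next Obligation. by move=> X Y f g i x; rewrite /= raddfD /= !cmapP. Qed.

Program Definition chain_opp (X Y : complex) (f : chainMap X Y) :
    chainMap X Y :=
  @ChainMap X Y (fun i => (\- f i : X i -> Y i)) _.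
Next Obligation. by move=> X Y f i x; rewrite /= raddfN /= !cmapP. Qed.

Program Definition shift_complex (X : complex) : complex :=
  @Complex (fun i => X (i + 1)) (fun i => \- cdiff X (i + 1)) _.
Next Obligation. by move=> X i x; rewrite /= raddfN /= cdiffK !oppr0. Qed.

Program Definition shift_chain (X Y : complex) (f : chainMap X Y) :
    chainMap (shift_complex X) (shift_complex Y) :=
  @ChainMap (shift_complex X) (shift_complex Y) (fun i => f (i + 1)) _.
Next Obligation. by move=> X Y f i x; rewrite /= raddfN /= cmapP. Qed.

Definition homotopyShiftCat : shiftCat := {|
  obj := complex;
  hom := chainMap;
  heq := homotopic;
  idm := chain_id;
  comp := chain_comp;
  zerom := chain_zero;
  addm := chain_add;
  oppm := chain_opp;
  shift := shift_complex;
  shiftm := shift_chain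
|}.

Section Cone.
Variables (X Y : complex) (f : chainMap X Y).

Definition cone_diff i (u : X (i + 1) * Y i) : X (i + 1 + 1) * Y (i + 1) :=
  (- cdiff X (i + 1) u.1, f (i + 1) u.1 + cdiff Y i u.2).

Fact cone_diff_linear i : linear (@cone_diff i).
Proof.
move=> a u v; rewrite /cone_diff; congr pair => /=.
  by rewrite linearP opprD scalerN.
by rewrite !linearP scalerDr addrACA.
Qed.

HB.instance Definition _ i :=
  GRing.isLinear.Build R _ _ _ (@cone_diff i) (@cone_diff_linear i).

Program Definition cone : complex :=
  @Complex (fun i => (X (i + 1)%R * Y i)%type) (fun i => @cone_diff i) _.
Next Obligation.
move=> i [x y]; rewrite /= /cone_diff /= !raddfN raddfD /= !cdiffK !oppr0.
by rewrite cmapP addr0 addNr.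
Qed.

Definition cone_inj (i : int) (y : Y i) : cone i := (0, y).

Fact cone_inj_linear i : linear (@cone_inj i).
Proof.
by move=> a u v; congr pair => /=; rewrite scaler0 addr0.
Qed.

HB.instance Definition _ i :=
  GRing.isLinear.Build R _ _ _ (@cone_inj i) (@cone_inj_linear i).

Program Definition cone_in_chain : chainMap Y cone :=
  @ChainMap Y cone (fun i => @cone_inj i) _.
Next Obligation.
move=> i y; rewrite /= /cone_inj /cone_diff.
by congr pair => /=; rewrite raddf0 ?oppr0 ?add0r.
Qed.

Program Definition cone_out_chain : chainMap cone (shift_complex X) :=
  @ChainMap cone (shift_complex X) (fun i => fst) _.
Next Obligation. by []. Qed.

End Cone.

Definition homotopyCat : triCat := {|
  tcat := homotopyShiftCat;
  dist := fun X Y Z (f : @hom homotopyShiftCat X Y)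
              (g : @hom homotopyShiftCat Y Z)
              (h : @hom homotopyShiftCat Z (shift X)) =>
    exists (X' Y' : complex) (f' : chainMap X' Y'),
      @triangle_iso homotopyShiftCat X Y Z f g h
        X' Y' (cone f') f' (cone_in_chain f') (cone_out_chain f')
|}.

Definition acyclic (X : complex) : Prop :=
  forall i (x : X (i + 1)), cdiff X (i + 1) x = 0 ->
    exists y : X i, cdiff X i y = x.

Definition derivedCat : triCat := verdier homotopyCat acyclic.

Definition finitely_generated (M : lmodType R) : Prop :=
  exists (k : nat) (e : 'I_k -> M), forall x : M,
    exists c : 'I_k -> R, x = \sum_(j < k) c j *: e j.

Definition projective (P : lmodType R) : Prop :=
  forall (M N : lmodType R) (p : {linear M -> N}) (f : {linear P -> N}),
    (forall y, exists x, p x = y) ->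
    exists g : {linear P -> M}, forall x, p (g x) = f x.

Definition strictly_perfect (P : complex) : Prop :=
  (exists a b : int, forall i, i < a \/ b < i -> forall x : P i, x = 0) /\
  (forall i, finitely_generated (P i) /\ projective (P i)).

Definition perfect (X : derivedCat) : Prop :=
  exists P : complex, strictly_perfect P /\ @isomorphic derivedCat X P.

Fact perfect_shift X : perfect X -> perfect (shift X).
Proof.
move=> [P [[[a [b P0]] fgP] [f [g [gf fg]]]]].
exists (shift_complex P); split.
  split=> [|i]; last exact: fgP.
  exists (a - 1), (b - 1) => i ltab; apply: P0.
  by case: ltab => [ltia|ltbi]; [left; rewrite -ltrBrDr | right; rewrite -ltrBlDr].
exists (lshift f), (lshift g); split.
- apply: lheq_trans (lheq_sym (lshift_comp _ _)) _.
  exact: lheq_trans (lheq_shift gf) (lshift1 _ _).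
- apply: lheq_trans (lheq_sym (lshift_comp _ _)) _.
  exact: lheq_trans (lheq_shift fg) (lshift1 _ _).
Qed.

Definition Perf : triCat := fullCat perfect_shift.

End Complexes.

Section Ideals.
Variable R : comPzRingType.

Definition ideal (I : set R) : Prop :=
  [/\ I 0, forall a b, I a -> I b -> I (a + b) & forall r a, I a -> I (r * a)].

Definition artinian : Prop :=
  forall I : nat -> set R, (forall k, ideal (I k)) ->
    (forall k, I k.+1 `<=` I k) ->
    exists N, forall k, (N <= k)%N -> I k = I N.

Definition maximal_ideal (m : set R) : Prop :=
  [/\ ideal m, m <> setT
    & forall J : set R, ideal J -> m `<=` J -> J = m \/ J = setT].
End Ideals.

(* Main.v *)
(* Since R is artinian, 1 is a sum of n orthogonal idempotents e_i such that
   every element of e_i R is nilpotent or invertible in e_i R, and the maximal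
   ideals are the n sets {x | e_i x is nilpotent}.  A strictly perfect complex
   P is the direct sum of the e_i P, and each e_i P is a bounded complex of
   free e_i R-modules of finite rank.

   Key point: if e P is not contractible, the thick subcategory it generates
   contains e R.  After Gaussian elimination e P has a basis vector x0 of
   lowest degree with d x0 in the maximal ideal; let f be the coordinate of x0,
   a chain map X -> e R for X := e P (suitably shifted).  Starting from
   A = X, phi = f, w = x0, one replaces A by the homotopy pushout of
   X <- X ⊗ A -> A, which stays in the thick subcategory, carries a map to e R,
   and contains a vector w' mapping to e whose differential is a multiple of
   (d x0) ⊗ (d w).  As d x0 has nilpotent coefficients, d w eventually vanishes,
   and then w splits A -> e R.  This is an explicit form of the tensor nilpotence
   argument of Hopkins and Neeman.

   Hence a thick subcategory is determined by the set of i for which it contains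
   e_i R, and every subset occurs because the functors e_i H^* separate the
   e_j R.  These functors factor through a Verdier quotient by a subcategory
   they kill, so a quotient S/S' is simple if and only if the corresponding
   subsets differ by one element: composition series are the complete flags of
   subsets. *)
Require Import Defs.
From HB Require Import structures.
From mathcomp Require Import all_boot all_order all_algebra.
From mathcomp Require Import boolp classical_sets functions cardinality.
From mathcomp Require Import ring zify.
(* MathComp's [vector] also defines [hom]; this makes [hom] that of [Defs] again. *)
Import Defs.

Set Implicit Arguments.
Unset Strict Implicit.
Unset Printing Implicit Defensive.

Import Order.TTheory GRing.Theory Num.Theory.
Local Open Scope ring_scope.
Local Open Scope classical_set_scope.
Local Open Scope tricat_scope.
Local Open Scope card_scope.

(** * Idempotents and maximal ideals of an artinian ring *)

(** Morphisms of a Verdier quotient are words in generators modulo relations, and no normal form of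
    fractions is ever used. This dictates the division of labour. What must hold in [Perf R]
    (isomorphisms, direct sums, triangles) is exhibited by chain maps and homotopies and pushed
    through the localization. What must fail (an object being zero, a generator lying in a thick
    subcategory) is refuted by a functor evaluated by recursion on words; such a functor has to
    provide true bijections, since formal inverses must act. The tensor product X ⊗ A occurs only
    when X is a finite complex of free modules with a chosen basis. It is then an iterated extension
    of shifts of A, so that its membership in a thick subcategory is an induction on the basis of X.
    Nilpotence is likewise handled through finite lists of ring elements, without forming ideals or
    their powers. *)

Section LocalIdempotents.
Variable R : comPzRingType.

Definition nilp (x : R) := exists k, x ^+ k = 0.

Definition local_idem (e : R) : Prop :=
  [/\ e * e = e, e <> 0 & forall x, nilp (e * x) \/ exists y, e * x * y = e].

(** A long word either repeats the head of [A] often enough to vanish, or contains a long subword in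
    the remaining letters. This replaces nilpotence of the ideal generated by finitely many
    nilpotents. *)
Lemma nilp_killed (A : seq R) : (forall a, a \in A -> nilp a) ->
  exists L, forall s : seq R, size s = L -> {subset s <= A} ->
    \prod_(a <- s) a = 0.
Proof.
elim: A => [|a A IH] nA.
  exists 1 => -[|b s] // _ sub; have := sub b (mem_head _ _); by rewrite in_nil.
have [k ak] := nA a (mem_head _ _).
have [L HL] := IH (fun b bA => nA b (mem_behead (s := a :: A) bA)).
exists (k + L)%N => s sz sub.
rewrite (bigID (pred1 a)) /=.
have -> : \prod_(i <- s | i == a) i = a ^+ count_mem a s.
  rewrite -big_filter (eq_big_seq (fun=> a)); last first.
    by move=> b; rewrite mem_filter => /andP[/eqP].
  by rewrite big_const_seq count_predT -Monoid.iteropE size_filter.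
have [kc|ck] := leqP k (count_mem a s).
  by rewrite -(subnKC kc) exprD ak !mul0r.
rewrite -big_filter; set s' := filter _ s.
have szs' : (L <= size s')%N.
  have := count_predC (pred1 a) s; rewrite sz size_filter.
  by move=> E; rewrite -(leq_add2l k) -E leq_add2r ltnW.
have sub' : {subset s' <= A}.
  move=> b; rewrite mem_filter => /andP[/= ba bs].
  by have := sub b bs; rewrite in_cons (negPf ba).
rewrite -(cat_take_drop L s') big_cat /= (HL (take L s')) ?mul0r ?mulr0 //.
  by rewrite size_takel.
by move=> b /mem_take/sub'.
Qed.

(** [t] annihilates the [k]-th power of the ideal generated by [A], tested on words of length
    [k]. *)
Definition kills (A : seq R) (k : nat) (t : R) :=
  forall s : seq R, size s = k -> {subset s <= A} -> t * \prod_(a <- s) a = 0.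

Lemma killsS A k t a : a \in A -> kills A k.+1 t -> kills A k (t * a).
Proof.
move=> aA kt s sz sub; rewrite -mulrA.
have := kt (a :: s); rewrite big_cons; apply=> [|b]; first by rewrite /= sz.
by rewrite in_cons => /orP[/eqP->|/sub].
Qed.

Lemma nilpD x y : nilp x -> nilp y -> nilp (x + y).
Proof.
move=> [k xk] [l yl]; exists (k + l)%N; rewrite exprDn big1 // => i _.
have [li|il] := leqP l i.
  by rewrite -(subnK li) exprD yl !mulr0 mul0rn.
rewrite (_ : k + l - i = k + (l - i))%N; last by rewrite addnBA // ltnW.
by rewrite exprD xk !mul0r mul0rn.
Qed.

Lemma nilpM r x : nilp x -> nilp (r * x).
Proof. by move=> [k xk]; exists k; rewrite exprMn xk mulr0. Qed.

Lemma nilp_idem e : e * e = e -> nilp e -> e = 0.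
Proof.
move=> ee [k]; have ek j : e ^+ j.+1 = e.
  by elim: j => // j IH; rewrite exprS IH.
by case: k => [|k]; rewrite ?ek // expr0 => o; rewrite -[e]mul1r o mul0r.
Qed.

Hypothesis hR : artinian R.

Lemma ideal_fix e : ideal [set x : R | e * x = x].
Proof.
split=> /=; first by rewrite mulr0.
  by move=> a b ea eb; rewrite mulrDr ea eb.
by move=> r a ea; rewrite mulrCA ea.
Qed.

(** The chain of ideals generated by the powers of [x] stabilises, so
    [x ^+ N.+1 = r * x ^+ (N.+1 + N.+1)] for some [r]; then [r * x ^+ N.+1] is idempotent. *)
Lemma idem_power x : exists (g r : R) N, [/\ g = r * x ^+ N.+1, g * g = g &
  g * x ^+ N.+1 = x ^+ N.+1].
Proof.
pose I k := [set y | exists r, y = r * x ^+ k].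
have [|| N HN] := hR (I := I).
- move=> k; split; first by exists 0; rewrite mul0r.
    by move=> a b [r ->] [s ->]; exists (r + s); rewrite mulrDl.
  by move=> r a [s ->]; exists (r * s); rewrite mulrA.
- by move=> k y [r ->]; exists (r * x); rewrite exprS mulrA.
have : I N.+1 (x ^+ N.+1) by exists 1; rewrite mul1r.
rewrite HN // -(HN (N.+1 + N.+1)%N); last by rewrite ltnW // ltn_addr.
move=> [r]; rewrite exprD => xN.
exists (r * x ^+ N.+1), r, N; split=> //; last by rewrite -mulrA -xN.
by rewrite mulrACA -[LHS]mulrA -xN.
Qed.

Definition decomposed (f : R) (l : seq R) : Prop :=
  [/\ forall e, e \in l -> local_idem e /\ e * f = e,
      forall i j, (i < size l)%N -> (j < size l)%N -> i != j ->
        l`_i * l`_j = 0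
    & \sum_(e <- l) e = f].

(** If [f] is not local, some [f * x] is neither nilpotent nor invertible in f R. The idempotent
    attached to a power of [f * x] is then proper: were it 0, [f * x] would be nilpotent; were it
    [f], [f * x] would be invertible. *)
Lemma idem_split f : f * f = f ->
  f = 0 \/ local_idem f \/
  exists g, [/\ g * g = g, g * f = g, g <> 0 & g <> f].
Proof.
move=> ff; have [->|/eqP f0] := eqVneq f 0; first by left.
right; have [lf|nlf] := pselect (local_idem f); [by left|right].
have [x nx] : exists x, ~ (nilp (f * x) \/ exists y, f * x * y = f).
  by apply/existsNP => H; apply: nlf.
have [g [r [N [gE gg gx]]]] := idem_power (f * x).
have gf : g * f = g.
  rewrite gE -mulrA; congr (r * _).
  by rewrite exprS mulrAC [f * x * f]mulrAC ff.
exists g; split=> // E; apply: nx.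
  by left; exists N.+1; rewrite -gx E mul0r.
by right; exists (r * (f * x) ^+ N); rewrite mulrCA -exprS -gE.
Qed.

Lemma decomposed_add f g l l' : f * f = f -> g * g = g -> g * f = g ->
  decomposed g l -> decomposed (f - g) l' -> decomposed f (l ++ l').
Proof.
move=> ff gg gf [Hl Ol Sl] [Hl' Ol' Sl'].
have O e e' : e * g = e -> e' * (f - g) = e' -> e * e' = 0.
  move=> <- <-; rewrite mulrACA mulrBr gf gg subrr mulr0; done.
have memn i : (i < size l)%N -> l`_i * g = l`_i by move=> /(mem_nth 0)/Hl[].
have memn' i : (i < size l')%N -> l'`_i * (f - g) = l'`_i.
  by move=> /(mem_nth 0)/Hl'[].
split.
- move=> e; rewrite mem_cat => /orP[/Hl[le eg]|/Hl'[le eg]]; split=> //.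
    by rewrite -eg -mulrA gf.
  by rewrite -eg -mulrA mulrBl ff gf.
- move=> i j; rewrite size_cat !nth_cat => il jl ij.
  case: (ltnP i (size l)) => il'; case: (ltnP j (size l)) => jl'.
  + exact: Ol.
  + by apply: O; [apply: memn | apply: memn'; rewrite ltn_subLR].
  + by rewrite mulrC; apply: O; [apply: memn | apply: memn'; rewrite ltn_subLR].
  + apply: Ol'; rewrite ?ltn_subLR //.
    by apply: contra ij => /eqP E; rewrite -(subnKC il') E subnKC.
- by rewrite big_cat /= Sl Sl' addrC subrK.
Qed.

(** An idempotent without decomposition splits in two, and one of the two summands has no
    decomposition either. Iterating from 1 gives a strictly decreasing sequence of idempotents,
    whose ideals of fixed elements contradict the descending chain condition. *)
Lemma idem_decomposed : exists l, decomposed 1 l.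
Proof.
apply: contrapT => bad1.
pose bad f := f * f = f /\ ~ exists l, decomposed f l.
have step (f : {f | bad f}) : exists g : {f | bad f},
    sval g * sval f = sval g /\ sval g <> sval f.
  case: f => f [ff nf] /=.
  have [f0|[lf|[g [gg gf g0 gf']]]] := idem_split ff.
  - case: nf; exists [::]; split=> //; by rewrite big_nil.
  - case: nf; exists [:: f]; split; last by rewrite big_seq1.
      by move=> e; rewrite inE => /eqP ->.
    by move=> [|i] [|j].
  have gg' : (f - g) * (f - g) = f - g.
    by rewrite mulrBr !mulrBl ff gf [f * g]mulrC gf gg subrr subr0.
  have [[l Hl]|ng] := pselect (exists l, decomposed g l); last first.
    by exists (exist _ g (conj gg ng)).
  have [[l' Hl']|ng'] := pselect (exists l, decomposed (f - g) l).
    by case: nf; exists (l ++ l'); apply: decomposed_add Hl Hl'.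
  exists (exist _ (f - g) (conj gg' ng')) => /=; split.
    by rewrite mulrBl ff gf.
  by move/eqP; rewrite subr_eq -subr_eq0 opprD addrA subrr sub0r oppr_eq0 => /eqP.
have [nx Hnx] := choice step.
pose s k := sval (iter k nx (exist _ 1 (conj (mulr1 _) bad1))).
have sE k : s k.+1 * s k = s k.+1 /\ s k.+1 <> s k by apply: Hnx.
have ss k : s k * s k = s k by rewrite /s; case: (iter _ _ _) => f [].
have [|k x /= E|N HN] := hR (I := fun k => [set x | s k * x = x]).
- by move=> k; apply: ideal_fix.
- by rewrite -E mulrA [s k * _]mulrC (sE k).1.
have [E ne] := sE N.
have : [set x | s N.+1 * x = x] (s N) by rewrite HN.
by rewrite /= E.
Qed.

Theorem artinian_idempotents : exists n (e : nat -> R),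
  [/\ forall i, (i < n)%N -> local_idem (e i),
      forall i j, (i < n)%N -> (j < n)%N -> i != j -> e i * e j = 0
    & \sum_(i < n) e i = 1].
Proof.
have [l [Hl Ol Sl]] := idem_decomposed; exists (size l), (nth 0 l); split=> //.
  by move=> i il; case: (Hl _ (mem_nth 0 il)).
by rewrite -Sl (big_nth 0) big_mkord.
Qed.

(** A maximal ideal is prime and misses some [e i], since these sum to 1. It then contains every [x]
    with [e i * x] nilpotent, hence the maximal ideal [M i], and equals it. *)
Lemma card_maximal_ideals n (e : nat -> R) :
    (forall i, (i < n)%N -> local_idem (e i)) ->
    (forall i j, (i < n)%N -> (j < n)%N -> i != j -> e i * e j = 0) ->
    \sum_(i < n) e i = 1 ->
  ([set m : set R | maximal_ideal m] #= `I_n)%card.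
Proof.
move=> le oe se; pose M i := [set x | nilp (e i * x)].
have idM i : ideal (M i).
  split=> [|a b na nb|r a na]; first by exists 1; rewrite mulr0.
    by rewrite /M /= mulrDr; apply: nilpD.
  by rewrite /M /= mulrCA; apply: nilpM.
have nM i : (i < n)%N -> ~ M i (e i).
  move=> /le[ee e0 _]; by rewrite /M /= ee => /(nilp_idem ee).
have MJ i : (i < n)%N -> M i (1 - e i).
  by move=> /le[ee _ _]; exists 1; rewrite expr1 mulrBr ee mulr1 subrr.
have maxM i : (i < n)%N -> maximal_ideal (M i).
  move=> ltin; split=> //; first by move=> E; apply: (nM i ltin); rewrite E.
  move=> J [J0 JD Jm] sMJ; have [sJM|/existsNP[x /not_implyP[Jx nMx]]] :=
    pselect (forall x, J x -> M i x); [left|right]; apply/seteqP; split=> //.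
  have [_ _ /(_ x)[//|[y exy]]] := le i ltin.
  move=> z _; rewrite -[z]mulr1 -(subrK (e i) 1); apply/Jm/JD.
    exact/sMJ/MJ.
  by rewrite -exy mulrAC; apply/Jm.
have -> : [set m | maximal_ideal m] = M @` `I_n.
  apply/seteqP; split=> [m mm|_ [i /= ltin <-]]; last exact: maxM.
  have [[m0 mD mM] mT maxm] := mm.
  have prim x y : m (x * y) -> ~ m x -> m y.
    move=> mxy nmx.
    pose J := [set z | exists a r, m a /\ z = a + r * x].
    have [||JE|JT] := maxm J.
    - split; first by exists 0, 0; rewrite mul0r addr0.
        move=> _ _ [a [r [ma ->]]] [b [s [mb ->]]]; exists (a + b), (r + s).
        by rewrite mulrDl addrACA; split=> //; apply: mD.
      move=> t _ [a [r [ma ->]]]; exists (t * a), (t * r).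
      by rewrite mulrDr mulrA; split=> //; apply: mM.
    - by move=> z mz; exists z, 0; rewrite mul0r addr0.
    - by case: nmx; rewrite -JE; exists 0, 1; rewrite mul1r add0r.
    have : J 1 by rewrite JT.
    move=> [a [r [ma E]]]; rewrite -[y]mul1r E mulrDl -mulrA.
    by apply: mD; [rewrite mulrC; apply: mM | apply: mM].
  have [i ltin nmi] : exists2 i, (i < n)%N & ~ m (e i).
    apply: contrapT => H; apply: mT; apply/seteqP; split=> // z _.
    rewrite -[z]mulr1 -se; apply: mM.
    apply: (big_ind m) => // i _; apply: contrapT => nmi.
    by apply: H; exists i.
  exists i => //; have [_ _ maxMi] := maxM i ltin.
  have [//||->//|/mT//] := maxMi m.
  move=> x [k exk]; apply: (prim (e i)) => //.
  have mex : m ((e i * x) ^+ k) by rewrite exk.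
  elim: k {exk} mex => [|k IH]; first by rewrite expr0 -[e i * x]mulr1; apply: mM.
  rewrite exprS => mex; have [//|nm] := pselect (m (e i * x)).
  exact/IH/(prim _ _ mex).
(* For distinct indices, [e i] lies in [M j] by orthogonality but not in [M i]. *)
apply: inj_card_eq => i j; rewrite !inE /= => il jl E.
apply/eqP; apply: contrapT => /negP ij; apply: (nM i il); rewrite E.
by exists 1%N; rewrite expr1 oe // eq_sym.
Qed.
End LocalIdempotents.

(** * Cohomological functors on localizations *)

(* Graded functors to abelian groups compatible with the shift.  They serve to
   extract information from localizations, whose morphisms are syntactic. *)
Record shfun (C : shiftCat) := Shfun {
  cF : int -> C -> zmodType;
  cm : forall n (X Y : C), hom X Y -> cF n X -> cF n Y;
  csh : forall n (X : C), cF n (shift X) -> cF (n + 1) X;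
  cshV : forall n (X : C), cF (n + 1) X -> cF n (shift X);
  cshD : forall n X (x y : cF n (shift X)), csh (x + y) = csh x + csh y;
  cshK : forall (n : int) X, cancel (@csh n X) (@cshV n X);
  cshVK : forall (n : int) X, cancel (@cshV n X) (@csh n X);
  cmD : forall n X Y (f : hom X Y) (x y : cF n X), cm f (x + y) = cm f x + cm f y;
  cm_eq : forall n X Y (f g : hom X Y), f ≈ g -> cm (n := n) f =1 cm g;
  cm_id : forall n X (x : cF n X), cm (idm X) x = x;
  cm_comp : forall n X Y Z (g : hom Y Z) (f : hom X Y) (x : cF n X),
    cm (g ∘ f) x = cm g (cm f x);
  cm_zero : forall n X Y (x : cF n X), cm (zerom X Y) x = 0;
  cm_add : forall n X Y (f g : hom X Y) (x : cF n X),
    cm (addm f g) x = cm f x + cm g x;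
  cm_shift : forall n X Y (f : hom X Y) (x : cF n (shift X)),
    csh (cm (shiftm f) x) = cm f (csh x)
}.

Definition cker (C : shiftCat) (c : shfun C) (X : C) : Prop :=
  forall n (x : cF c n X), x = 0.

Section ShfunTheory.
Variables (C : shiftCat) (c : shfun C).

Lemma cm0 n X Y (f : hom X Y) : cm f (0 : cF c n X) = 0.
Proof. by apply: (addrI (cm f 0)); rewrite -cmD !addr0. Qed.

Lemma cker_retract X Y (i : hom X Y) (p : hom Y X) :
  p ∘ i ≈ idm X -> cker c Y -> cker c X.
Proof.
by move=> pi Y0 n x; rewrite -(cm_id x) -(cm_eq pi) cm_comp (Y0 n (cm i x)) cm0.
Qed.

Lemma cker_is_zero X : idm X ≈ zerom X X -> cker c X.
Proof. by move=> i0 n x; rewrite -(cm_id x) (cm_eq i0) cm_zero. Qed.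

Lemma cker_iso X Y : isomorphic X Y -> cker c X -> cker c Y.
Proof. by move=> [f [g [_ fg]]]; apply: cker_retract fg. Qed.

Lemma iso_bij X Y (f : hom X Y) : is_iso f -> forall n, bijective (@cm _ c n _ _ f).
Proof.
move=> [g [gf fg]] n; exists (cm g) => x; rewrite -cm_comp.
  by rewrite (cm_eq gf) cm_id.
by rewrite (cm_eq fg) cm_id.
Qed.

Lemma isomorphic_sym (X Y : C) : isomorphic X Y -> isomorphic Y X.
Proof. by move=> [f [g [gf fg]]]; exists g, f. Qed.

Lemma triangle_iso_bij X Y Z (f : hom X Y) (g : hom Y Z) (h : hom Z (shift X))
    X' Y' Z' (f' : hom X' Y') (g' : hom Y' Z') (h' : hom Z' (shift X')) :
  triangle_iso f g h f' g' h' -> (cker c Z' -> forall n, bijective (@cm _ c n _ _ f')) ->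
  cker c Z -> forall n, bijective (@cm _ c n _ _ f).
Proof.
move=> [a [b [k [[ia ib ik] [bf _ _]]]]] f'b Z0 n.
have := f'b (cker_iso (ex_intro _ k ik) Z0) n.
have := iso_bij ia n; have := iso_bij ib n.
move=> [b' b'K bK'] ba bf'.
apply: (eq_bij (f := b' \o (cm f' \o cm a))).
  by apply: bij_comp; [exists (cm b) | apply: bij_comp].
move=> x /=; apply: (can_inj b'K).
by rewrite bK' -!cm_comp (cm_eq bf).
Qed.

Lemma triangle_iso_cker X Y Z (f : hom X Y) (g : hom Y Z) (h : hom Z (shift X))
    X' Y' Z' (f' : hom X' Y') (g' : hom Y' Z') (h' : hom Z' (shift X')) :
  triangle_iso f g h f' g' h' -> (cker c X' -> cker c Y' -> cker c Z') ->
  cker c X -> cker c Y -> cker c Z.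
Proof.
move=> [a [b [k [[ia ib ik] _]]]] H X0 Y0; apply: (@cker_iso Z').
  exact: isomorphic_sym (ex_intro _ k ik).
by apply: H; [apply: cker_iso X0; exists a | apply: cker_iso Y0; exists b].
Qed.

End ShfunTheory.

(** Two consequences of a long exact sequence: [cm_iso] lets morphisms with killed cone be inverted,
    [cm_cone] makes the kernel thick. *)
Record cohfun (T : triCat) := Cohfun {
  cfun :> shfun T;
  cm_iso : forall X Y Z (f : hom X Y) (g : hom Y Z) (h : hom Z (shift X)),
    dist f g h -> cker cfun Z -> forall n, bijective (@cm _ cfun n X Y f);
  cm_cone : forall X Y Z (f : hom X Y) (g : hom Y Z) (h : hom Z (shift X)),
    dist f g h -> cker cfun X -> cker cfun Y -> cker cfun Z
}.

Section Kernel.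
Variables (T : triCat) (c : cohfun T).

Lemma cker_thick : thick (cker c).
Proof.
split.
- by move=> X /(_ X)[+ _] => /(_ (idm X)); apply: cker_is_zero.
- exact: cker_iso.
- move=> X; split=> X0 n x; last first.
    by rewrite -(cshK x) (X0 _ (csh x)) -(X0 _ (csh 0)) cshK.
  move: n x; suff H n (x : cF c (n + 1) X) : x = 0.
    by move=> n; rewrite -(subrK 1 n).
  rewrite -(cshVK x) (X0 _ (cshV x)).
  by apply: (addrI (csh 0)); rewrite -cshD !addr0.
- by move=> X Y Z f g h fgh X0 Y0 n z; apply: cm_cone fgh X0 Y0 n z.
- by move=> X Y Z [i [j [p [q [pi _ _ _ _]]]]]; apply: cker_retract pi.
Qed.

End Kernel.

(** The inverse is wanted as data, because [lm] computes with it. *)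
Lemma bij_inv A B (f : A -> B) : bijective f -> {g | cancel f g /\ cancel g f}.
Proof. by move=> fb; apply: cid; case: fb => g; exists g. Qed.

Section Localized.
Variables (T : triCat) (c : cohfun T) (N : T -> Prop).
Hypothesis NK : forall X, N X -> cker c X.

Let W := @cone_in T N.

Lemma cm_bij X Y (s : hom X Y) : W s -> forall n, bijective (@cm _ c n X Y s).
Proof. by move=> [Z [g [h [d /NK NZ]]]] n; apply: cm_iso d _ n. Qed.

#[local] Unset Implicit Arguments.
(** Action of a word, in which a formal inverse acts by the inverse bijection. [lm_eq] checks every
    defining relation, so the action descends to morphisms of the quotient. *)
Fixpoint lm n X Y (f : lhom W X Y) {struct f} : cF c n X -> cF c n Y :=
  match f in lhom _ X Y return cF c n X -> cF c n Y with
  | lemb X Y f => cm f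
  | linv X Y s Ws => projT1 (bij_inv (cm_bij Ws n))
  | lcomp X Y Z g f => fun x => lm n _ _ g (lm n _ _ f x)
  | ladd X Y f g => fun x => lm n _ _ f x + lm n _ _ g x
  | lopp X Y f => fun x => - lm n _ _ f x
  | lshift X Y f => fun x => cshV (lm (n + 1) _ _ f (csh x))
  end.
#[local] Set Implicit Arguments.
Arguments lm n {X Y} f.

Lemma cshVD n X (x y : cF c (n + 1) X) : cshV (x + y) = cshV x + cshV y.
Proof. by rewrite -[LHS]cshK -{1}[x]cshVK -{1}[y]cshVK -cshD !cshVK !cshK. Qed.

Lemma lmD n X Y (f : lhom W X Y) x y : lm n f (x + y) = lm n f x + lm n f y.
Proof.
elim: f n x y => {X Y} /= [X Y f|X Y s Ws|X Y Z g IHg f IHf|X Y f IHf g IHg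
  |X Y f IHf|X Y f IHf] n x y.
- exact: cmD.
- case: bij_inv => g [/= fg gf].
  by rewrite -{1}[x]gf -{1}[y]gf -cmD fg.
- by rewrite IHf IHg.
- by rewrite IHf IHg addrACA.
- by rewrite IHf opprD.
- by rewrite cshD IHf cshVD.
Qed.

Lemma lm_eq X Y (f g : lhom W X Y) : lheq f g -> forall n, lm n f =1 lm n g.
Proof.
elim=> {X Y f g} /=; try by move=> *; move=> ?; rewrite ?addrA.
- by move=> X Y f g _ IH n x; rewrite IH.
- by move=> X Y f g h _ IH _ IH' n x; rewrite IH IH'.
- by move=> X Y Z g g' f f' _ IH _ IH' n x; rewrite IH IH'.
- by move=> X Y f f' g g' _ IH _ IH' n x; rewrite IH IH'.
- by move=> X Y f f' _ IH n x; rewrite IH.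
- by move=> X Y f f' _ IH n x; rewrite IH.
- by move=> X Y f n x; rewrite cm_id.
- by move=> X Y f n x; rewrite cm_id.
- by move=> X Y f g n x; rewrite addrC.
- by move=> X Y f n x; rewrite cm_zero add0r.
- by move=> X Y f n x; rewrite cm_zero addNr.
- by move=> X Y Z g f f' n x; rewrite lmD.
- by move=> X n x; rewrite !cm_id cshK.
- by move=> X Y Z g f n x; rewrite cshVK.
- by move=> X Y f g n x; rewrite cshVD.
- by move=> X Y f f' ff n x; apply: cm_eq.
- by move=> X Y Z g f n x; rewrite cm_comp.
- by move=> X Y f g n x; rewrite cm_add.
- by move=> X Y f n x; rewrite -cm_shift cshK.
- by move=> X Y s Ws n x; case: bij_inv => g [/= gf fg]; rewrite cm_id.
- by move=> X Y s Ws n x; case: bij_inv => g [/= gf fg]; rewrite cm_id.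
Qed.

(** The groups are those of [c] and the construction is transparent: vanishing in the quotient is
    convertible to vanishing in [T]. *)
Definition verdier_shfun : shfun (verdier T N).
Proof.
apply: (@Shfun (verdier T N) (@cF T c) lm (@csh T c) (@cshV T c)).
- by move=> n X x y; apply: cshD.
- by move=> n X x; apply: cshK.
- by move=> n X x; apply: cshVK.
- by move=> n X Y f x y; apply: lmD.
- by move=> n X Y f g fg; apply: lm_eq.
- by move=> n X x /=; rewrite cm_id.
- by [].
- by move=> n X Y x /=; rewrite cm_zero.
- by [].
- by move=> n X Y f x /=; rewrite cshVK.
Defined.

Definition verdier_cohfun : cohfun (verdier T N).
Proof.
apply: (@Cohfun (verdier T N) verdier_shfun).
- move=> X Y Z f g h [X' [Y' [Z' [f' [g' [h' [d tri]]]]]]].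
  by apply: (triangle_iso_bij tri) => Z'0; apply: cm_iso d Z'0.
- move=> X Y Z f g h [X' [Y' [Z' [f' [g' [h' [d tri]]]]]]].
  by apply: (triangle_iso_cker tri); apply: cm_cone d.
Defined.

End Localized.

Section Full.
Variables (T : triCat) (c : cohfun T) (P : T -> Prop).
Hypothesis shiftP : forall X, P X -> P (shift X).

Definition full_shfun : shfun (fullCat shiftP).
Proof.
apply: (@Shfun (fullCat shiftP) (fun n X => @cF T c n (sval X))
  (fun n X Y f => @cm T c n _ _ f) (fun n X => @csh T c n _)
  (fun n X => @cshV T c n _)).
- by move=> n X; apply: cshD.
- by move=> n X; apply: cshK.
- by move=> n X; apply: cshVK.
- by move=> n X Y f; apply: (@cmD T).
- by move=> n X Y f g; apply: (@cm_eq T).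
- by move=> n X; apply: (@cm_id T).
- by move=> n X Y Z g f; apply: (@cm_comp T).
- by move=> n X Y; apply: (@cm_zero T).
- by move=> n X Y f g; apply: (@cm_add T).
- by move=> n X Y f; apply: (@cm_shift T).
Defined.

Definition full_cohfun : cohfun (fullCat shiftP).
Proof.
apply: (@Cohfun (fullCat shiftP) full_shfun).
- by move=> X Y Z f g h; apply: (@cm_iso T c).
- by move=> X Y Z f g h; apply: (@cm_cone T c).
Defined.

End Full.

(** * Additivity and isomorphisms in a localization *)

Section LocalizationTheory.
Variables (C : shiftCat) (W : forall X Y : C, hom X Y -> Prop).
Let Q := localization W.

(** Absorption by zero is not among the relations of [lheq]; distributivity gives g + g = g, hence g
    = 0. *)
Lemma lcomp_zero X Y Z (f : lhom W Y Z) : lheq (lcomp f (lemb W (zerom X Y))) (lemb W (zerom X Z)).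
Proof.
set g := lcomp _ _.
have gg : lheq (ladd g g) g.
  apply: lheq_trans (lheq_sym (lcompDr _ _ _)) _.
  by apply: lheq_comp; [apply: lheq_refl | apply: ladd0].
apply: lheq_trans (lheq_sym (ladd0 _)) _.
apply: lheq_trans (lheq_add (lheq_sym (laddN g)) (lheq_refl _)) _.
apply: lheq_trans (lheq_sym (laddA _ _ _)) _.
by apply: lheq_trans (laddN g); apply: lheq_add gg; apply: lheq_refl.
Qed.

Lemma lcomp_zerol X Y Z (f : lhom W X Y) : lheq (lcomp (lemb W (zerom Y Z)) f) (lemb W (zerom X Z)).
Proof.
set g := lcomp _ _.
have gg : lheq (ladd g g) g.
  apply: lheq_trans (lheq_sym (lcompDl _ _ _)) _.
  by apply: lheq_comp; [apply: ladd0 | apply: lheq_refl].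
apply: lheq_trans (lheq_sym (ladd0 _)) _.
apply: lheq_trans (lheq_add (lheq_sym (laddN g)) (lheq_refl _)) _.
apply: lheq_trans (lheq_sym (laddA _ _ _)) _.
by apply: lheq_trans (laddN g); apply: lheq_add gg; apply: lheq_refl.
Qed.

Lemma lid_zero (X : Q) : idm X ≈ zerom X X -> is_zero X.
Proof.
move=> i0 Y; split=> f.
  apply: lheq_trans (lheq_sym (lcomp1r f)) _.
  apply: lheq_trans (lcomp_zero X f).
  by apply: lheq_comp i0; apply: lheq_refl.
apply: lheq_trans (lheq_sym (lcomp1l f)) _.
apply: lheq_trans (lcomp_zerol X f).
by apply: lheq_comp i0 _; apply: lheq_refl.
Qed.

Lemma lid_iso (X : Q) : is_iso (idm X).
Proof. by exists (idm X); split; apply: lcomp1l. Qed.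

Lemma lemb_iso (X Y : C) (f : hom X Y) : is_iso f -> @is_iso Q _ _ (lemb W f).
Proof.
move=> [g [gf fg]]; exists (lemb W g); split.
  by apply: lheq_trans (lheq_sym (lemb_comp _ _ _)) (lheq_emb _ gf).
by apply: lheq_trans (lheq_sym (lemb_comp _ _ _)) (lheq_emb _ fg).
Qed.

Lemma lemb_direct_sum (X Y Z : C) :
  is_direct_sum X Y Z -> @is_direct_sum Q X Y Z.
Proof.
move=> [i [j [p [q [pi qj pj qi s]]]]].
exists (lemb W i), (lemb W j), (lemb W p), (lemb W q); split;
  try by apply: lheq_trans (lheq_sym (lemb_comp _ _ _)) (lheq_emb _ _).
apply: lheq_trans (lheq_emb _ s).
apply: lheq_trans (lheq_sym (lembD _ _ _)).
by apply: lheq_add; apply: lheq_sym; apply: lemb_comp.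
Qed.

End LocalizationTheory.

Lemma localization_null_retract (C : shiftCat) (W : forall X Y : C, hom X Y -> Prop)
    (X Y : localization W) (i : hom X Y) (p : hom Y X) :
  p ∘ i ≈ idm X -> idm Y ≈ zerom Y Y -> idm X ≈ zerom X X.
Proof.
move=> pi /lid_zero /(_ X)[+ _] => /(_ p) p0.
apply: lheq_trans (lheq_sym pi) _.
by apply: lheq_trans (lcomp_zerol _ i); apply: lheq_comp p0 (lheq_refl _).
Qed.

Lemma verdier_dist (T : triCat) (N : T -> Prop) (X Y Z : T) (f : hom X Y)
    (g : hom Y Z) (h : hom Z (shift X)) : dist f g h ->
  @dist (verdier T N) X Y Z (lemb _ f) (lemb _ g) (lemb _ h).
Proof.
move=> d; exists X, Y, Z, f, g, h; split=> //.
exists (lemb _ (idm X)), (lemb _ (idm Y)), (lemb _ (idm Z)); split.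
  by split; apply: lid_iso.
have C (A B : T) (k : lhom (@cone_in T N) A B) :
    lheq (lcomp (lemb _ (idm B)) k) (lcomp k (lemb _ (idm A))).
  by apply: lheq_trans (lcomp1l _) (lheq_sym (lcomp1r _)).
split; try exact: C.
by apply: lheq_trans (C _ _ _); apply: lheq_comp (lshift1 _ _) (lheq_refl _).
Qed.

(** * Cohomology of complexes *)

Record submod (R : pzRingType) (V : lmodType R) := Submod {
  smP :> V -> Prop;
  sm0 : smP 0;
  smD : forall x y, smP x -> smP y -> smP (x + y);
  smZ : forall a x, smP x -> smP (a *: x)
}.

Section Submodules.
Variable R : pzRingType.
Implicit Types V W : lmodType R.

Lemma smN V (P : submod V) x : P x -> P (- x).
Proof. by rewrite -scaleN1r; apply: smZ. Qed.

Lemma smB V (P : submod V) x y : P x -> P y -> P (x - y).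
Proof. by move=> Px Py; apply: smD Px (smN Py). Qed.

Lemma sm_sum V (P : submod V) I (r : seq I) (p : pred I) (F : I -> V) :
  (forall i, p i -> P (F i)) -> P (\sum_(i <- r | p i) F i).
Proof. by move=> H; apply: big_ind => //; [apply: sm0 | apply: smD]. Qed.

Definition sm_pred V (P : submod V) : {pred V} := [pred x | `[< P x >]].

Lemma sm_predP V (P : submod V) x : reflect (P x) (x \in sm_pred P).
Proof. by rewrite inE; apply: asboolP. Qed.

Fact sm_pred_closed V (P : submod V) : submod_closed (sm_pred P).
Proof.
split; first exact/sm_predP/sm0.
by move=> a x y /sm_predP Px /sm_predP Py; apply/sm_predP/smD/Py/smZ.
Qed.

HB.instance Definition _ V (P : submod V) :=
  GRing.isSubmodClosed.Build R V (sm_pred P) (sm_pred_closed P).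

Record subm V (P : submod V) := Subm {
  smval :> V;
  smval_in : smval \in sm_pred P
}.

HB.instance Definition _ V (P : submod V) := [isSub for @smval V P].
HB.instance Definition _ V (P : submod V) := [Choice of subm P by <:].
HB.instance Definition _ V (P : submod V) :=
  [SubChoice_isSubLmodule of subm P by <:].

Definition mksub V (P : submod V) x (Px : P x) : subm P :=
  Subm (introT (sm_predP P x) Px).

Lemma subP V (P : submod V) (x : subm P) : P (smval x).
Proof. exact/sm_predP/smval_in. Qed.

Lemma smvalD V (P : submod V) (x y : subm P) : smval (x + y) = smval x + smval y.
Proof. by []. Qed.
Lemma sm_inj V (P : submod V) (x y : subm P) : smval x = smval y -> x = y.
Proof. exact: val_inj. Qed.

Section Restrict.
Variables (V W : lmodType R) (P : submod V) (Q : submod W) (f : {linear V -> W}).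
Hypothesis fPQ : forall x, P x -> Q (f x).

Definition submap (x : subm P) : subm Q := mksub (fPQ (subP x)).

Fact submap_linear : linear submap.
Proof. by move=> a x y; apply: sm_inj; rewrite /= linearP. Qed.

HB.instance Definition _ :=
  GRing.isLinear.Build R _ _ _ submap submap_linear.
End Restrict.

Section Subquotient.
Variables (V : lmodType R) (Z B : submod V).

Definition sq_pred : {pred subm Z} := [pred z | `[< B (smval z) >]].

Lemma sq_predP z : reflect (B (smval z)) (z \in sq_pred).
Proof. by rewrite inE; apply: asboolP. Qed.

Fact sq_pred_closed : zmod_closed sq_pred.
Proof.
split; first exact/sq_predP/sm0.
by move=> x y /sq_predP Bx /sq_predP By; apply/sq_predP; apply: smB.
Qed.

HB.instance Definition _ :=
  GRing.isZmodClosed.Build (subm Z) sq_pred sq_pred_closed.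

(** This is Z / (Z ∩ B), where [B] need not lie in [Z]. *)
Definition sq : zmodType := Quotient.quot sq_pred.

Definition cls x (Zx : Z x) : sq := (\pi_(Quotient.quot sq_pred) (mksub Zx))%qT.

Definition sqrep (q : sq) : subm Z := repr q.

Lemma sqrepK (q : sq) : cls (subP (sqrep q)) = q.
Proof.
rewrite /cls -[RHS]reprK; congr (\pi _)%qT; exact: sm_inj.
Qed.

Lemma clsP (q : sq) : exists x (Zx : Z x), q = cls Zx.
Proof. by exists (smval (sqrep q)), (subP (sqrep q)); rewrite sqrepK. Qed.

Lemma cls_eq x y (Zx : Z x) (Zy : Z y) : cls Zx = cls Zy <-> B (x - y).
Proof.
split=> [/eqP|Bxy]; last apply/eqP;
  rewrite /cls -Quotient.idealrBE; last exact/sq_predP.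
by move/sq_predP.
Qed.

Lemma clsD x y (Zx : Z x) (Zy : Z y) : cls Zx + cls Zy = cls (smD Zx Zy).
Proof.
rewrite /cls -[LHS]/(Quotient.add _ _) -Quotient.pi_add; congr (\pi _)%qT.
exact: sm_inj.
Qed.

Lemma cls_eq0 x (Zx : Z x) : cls Zx = 0 <-> B x.
Proof.
have -> : 0 = cls (sm0 Z) by apply: (addrI (cls (sm0 Z))); rewrite addr0 clsD cls_eq addr0 subr0; apply: sm0.
by rewrite cls_eq subr0.
Qed.

End Subquotient.

Section SubquotientMap.
Variables (V W : lmodType R) (Z B : submod V) (Z' B' : submod W).
Variable f : {linear V -> W}.
Hypothesis fZ : forall x, Z x -> Z' (f x).
Hypothesis fB : forall x, Z x -> B x -> B' (f x).

Definition sqmap (q : sq Z B) : sq Z' B' :=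
  cls B' (fZ (subP (sqrep q))).

Lemma sqmapE x (Zx : Z x) : sqmap (cls B Zx) = cls B' (fZ Zx).
Proof.
apply/cls_eq; rewrite -raddfB; apply: fB; first exact: smB (subP _) Zx.
by apply/(cls_eq B (subP _) Zx); rewrite sqrepK.
Qed.

Lemma sqmapD : {morph sqmap : x y / x + y}.
Proof.
move=> q r; have [x [Zx ->]] := clsP q; have [y [Zy ->]] := clsP r.
rewrite clsD !sqmapE clsD; apply/cls_eq.
by rewrite raddfD subrr; apply: sm0.
Qed.
End SubquotientMap.

End Submodules.

(** Turns an arbitrary degree into a successor, which avoids transport along n - 1 + 1 = n. *)
Lemma int_shift_ind (P : int -> Prop) : (forall n, P (n + 1)) -> forall n, P n.
Proof. by move=> H n; rewrite -(subrK 1 n). Qed.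

Lemma inj_surj_bij A B (f : A -> B) :
  injective f -> (forall y, exists x, f x = y) -> bijective f.
Proof.
move=> fi /choice[g gK]; exists g => // x; exact: fi.
Qed.

Lemma cone_diffE (R : pzRingType) (X Y : complex R) (f : chainMap X Y) (i : int)
    (x : X (i + 1)) (y : Y i) :
  cdiff (cone f) i (x, y) = (- cdiff X (i + 1) x, f (i + 1) x + cdiff Y i y).
Proof. by []. Qed.

Section Cohomology.
Variables (R : comPzRingType) (e : R).
Hypothesis ee : e * e = e.
Implicit Types X Y : complex R.

Definition cyc_prop (n : int) X (x : X (n + 1)) : Prop := cdiff X (n + 1) x = 0 /\ e *: x = x.

Definition cyc (n : int) X : submod (X (n + 1)).
Proof.
apply: (@Submod _ _ (@cyc_prop n X)); rewrite /cyc_prop.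
- by rewrite raddf0 scaler0.
- by move=> x y [dx ex] [dy ey]; rewrite raddfD /= dx dy addr0 scalerDr ex ey.
- by move=> a x [dx ex]; rewrite linearZ /= dx scaler0 scalerA mulrC -scalerA ex.
Defined.

Definition bnd (n : int) X : submod (X (n + 1)).
Proof.
apply: (@Submod _ _ (fun x => exists y, cdiff X n y = x)).
- by exists 0; rewrite raddf0.
- by move=> x y [u <-] [v <-]; exists (u + v); rewrite raddfD.
- by move=> a x [u <-]; exists (a *: u); rewrite linearZ.
Defined.

(** This is e H in degree [n + 1]; with this indexing the differentials into and out of the degree
    compose without transport. *)
Definition coh (n : int) X : zmodType := sq (cyc n X) (bnd n X).

Lemma cyc_chain (n : int) X Y (f : chainMap X Y) x : cyc n X x -> cyc n Y (f _ x).
Proof. by move=> [dx ex]; split; rewrite -?cmapP ?dx ?raddf0 // -linearZ ex. Qed.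

Lemma bnd_chain (n : int) X Y (f : chainMap X Y) x : bnd n X x -> bnd n Y (f _ x).
Proof. by move=> [u <-]; exists (f _ u); rewrite cmapP. Qed.

Definition cohm (n : int) X Y (f : chainMap X Y) : coh n X -> coh n Y :=
  sqmap (bnd n Y) (@cyc_chain n X Y f).

Lemma cohmE (n : int) X Y (f : chainMap X Y) x (Zx : cyc n X x) :
  cohm f (cls _ Zx) = cls _ (cyc_chain f Zx).
Proof. by apply: sqmapE => y _; apply: bnd_chain. Qed.

Lemma cyc_shift (n : int) X x : cyc n (shift_complex X) x -> cyc (n + 1) X x.
Proof. by move=> [/eqP dx ex]; split=> //; apply/eqP; rewrite -oppr_eq0. Qed.

Lemma cyc_unshift (n : int) X x : cyc (n + 1) X x -> cyc n (shift_complex X) x.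
Proof. by move=> [dx ex]; split=> //=; rewrite dx oppr0. Qed.

Lemma bnd_shift (n : int) X x : bnd n (shift_complex X) x -> bnd (n + 1) X x.
Proof. by move=> [y /= <-]; exists (- y); rewrite raddfN. Qed.

Lemma bnd_unshift (n : int) X x : bnd (n + 1) X x -> bnd n (shift_complex X) x.
Proof. by move=> [y /= <-]; exists (- y); rewrite /= raddfN opprK. Qed.

Definition cohsh (n : int) X : coh n (shift_complex X) -> coh (n + 1) X :=
  sqmap (bnd (n + 1) X)
    (f := (idfun : {linear shift_complex X (n + 1) -> X (n + 1 + 1)})) (@cyc_shift n X).

Definition cohshV (n : int) X : coh (n + 1) X -> coh n (shift_complex X) :=
  sqmap (bnd n (shift_complex X))
    (f := (idfun : {linear X (n + 1 + 1) -> shift_complex X (n + 1)})) (@cyc_unshift n X).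

Lemma cohshE (n : int) X x (Zx : cyc n (shift_complex X) x) :
  cohsh (cls _ Zx) = cls _ (cyc_shift Zx).
Proof. by apply: sqmapE => y _; apply: bnd_shift. Qed.

Lemma cohshVE (n : int) X x (Zx : cyc (n + 1) X x) :
  cohshV (cls _ Zx) = cls _ (cyc_unshift Zx).
Proof. by apply: sqmapE => y _; apply: bnd_unshift. Qed.

Definition coh_shfun : shfun (homotopyCat R).
Proof.
apply: (@Shfun (homotopyCat R) coh cohm cohsh cohshV).
- by move=> n X; apply: sqmapD => y _; apply: bnd_shift.
- move=> n X q; have [x [Zx ->]] := clsP q; rewrite cohshE cohshVE.
  by apply/cls_eq; rewrite subrr; apply: sm0.
- move=> n X q; have [x [Zx ->]] := clsP q; rewrite cohshVE cohshE.
  by apply/cls_eq; rewrite subrr; apply: sm0.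
- by move=> n X Y f; apply: sqmapD => y _; apply: bnd_chain.
- move=> n X Y f g [h fgh] q; have [x [Zx ->]] := clsP q.
  by rewrite !cohmE; apply/cls_eq; rewrite fgh Zx.1 raddf0 addr0; exists (h n x).
- move=> n X q; have [x [Zx ->]] := clsP q; rewrite cohmE.
  by apply/cls_eq; rewrite subrr; apply: sm0.
- move=> n X Y Z g f q; have [x [Zx ->]] := clsP q; rewrite !cohmE.
  by apply/cls_eq; rewrite subrr; apply: sm0.
- by move=> n X Y q; have [x [Zx ->]] := clsP q; rewrite cohmE; apply/cls_eq0/sm0.
- move=> n X Y f g q; have [x [Zx ->]] := clsP q; rewrite !cohmE clsD.
  by apply/cls_eq; rewrite subrr; apply: sm0.
- move=> n X Y f q; have [x [Zx ->]] := clsP q; rewrite cohmE !cohshE cohmE.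
  by apply/cls_eq; rewrite subrr; apply: sm0.
Defined.

Lemma cker_coh X : cker coh_shfun X <->
  forall n x, cyc n X x -> exists y, cdiff X n y = x.
Proof.
split=> [X0 n x Zx|X0 n q]; first exact/(cls_eq0 (bnd n X) Zx)/X0.
by have [x [Zx ->]] := clsP q; apply/cls_eq0/X0.
Qed.

(** Both halves come from explicit cone cycles: [(x, - (e *: v))], for a cycle [x] whose image is
    the boundary of [v], gives injectivity, and [(0, y)] gives surjectivity. Multiplication by [e]
    keeps everything in the part fixed by [e]. *)
Lemma coh_cone_bij X Y (f : chainMap X Y) : cker coh_shfun (cone f) ->
  forall n, bijective (@cohm n X Y f).
Proof.
move=> /cker_coh C0 n.
apply: inj_surj_bij => q.
  have [x [Zx ->]] := clsP q => r; have [y [Zy ->]] := clsP r.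
  rewrite !cohmE => /cls_eq; rewrite -raddfB /= => -[v dv].
  apply/cls_eq; have := smB Zx Zy; move: (x - y) dv => {q r Zx Zy y} {}x.
  (* The cone cycle lies one degree below [x], so the degree [n] must itself be a successor. *)
  elim/int_shift_ind: n v x => n v x dv [dx ex].
  have [|[u w] [E _]] := C0 n (x, - (e *: v)).
    split; last by congr pair => /=; rewrite ?ex // scalerN scalerA ee.
    rewrite cone_diffE dx oppr0; congr pair.
    by rewrite linearN linearZ /= dv -linearZ ex subrr.
  by exists (- u); rewrite raddfN.
have [y [[dy ey] ->]] := clsP q.
have [|[u v] [du fuv]] := C0 n (0, y).
  split; first by congr pair => /=; rewrite ?raddf0 ?oppr0 ?add0r.
  by congr pair => /=; rewrite ?scaler0.
have Zu : cyc n X (e *: u).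
  split; last by rewrite scalerA ee.
  by rewrite linearZ /=; move/eqP: du; rewrite oppr_eq0 => /eqP->; rewrite scaler0.
exists (cls _ Zu); rewrite cohmE; apply/cls_eq; exists (- (e *: v)).
have -> : f (n + 1) (e *: u) - y = - (e *: cdiff Y n v).
  by rewrite linearZ /= -[y in LHS]ey -fuv scalerDr opprD addrA subrr sub0r.
by rewrite linearN linearZ.
Qed.

Lemma cone_coh X Y (f : chainMap X Y) : cker coh_shfun X -> cker coh_shfun Y ->
  cker coh_shfun (cone f).
Proof.
move=> /cker_coh X0 /cker_coh Y0; apply/cker_coh => n [x y] [/= [dx fxy] [ex ey]].
have {}dx : cdiff X (n + 1 + 1) x = 0 by apply/eqP; rewrite -oppr_eq0; apply/eqP.
have [u du] := X0 _ x (conj dx ex).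
have [|v dv] := Y0 n (f _ (e *: u) + y).
  split; first by rewrite raddfD /= -cmapP linearZ /= du ex.
  by rewrite scalerDr ey -linearZ /= scalerA ee.
exists (- (e *: u), v); rewrite /cone_diff /=.
congr pair; first by rewrite linearN opprK linearZ /= du.
by rewrite dv linearN addKr.
Qed.

Definition coh_cohfun : cohfun (homotopyCat R).
Proof.
apply: (@Cohfun (homotopyCat R) coh_shfun).
  move=> X Y Z f g h [X' [Y' [f' tri]]]; apply: (triangle_iso_bij tri).
  exact: coh_cone_bij.
move=> X Y Z f g h [X' [Y' [f' tri]]]; apply: (triangle_iso_cker tri).
exact: cone_coh.
Defined.

Lemma acyclic_cker X : acyclic X -> cker coh_cohfun X.
Proof. by move=> aX; apply/cker_coh => n x [dx _]; apply: aX. Qed.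

End Cohomology.

Definition perf_cohfun (R : comPzRingType) (e : R) (ee : e * e = e) : cohfun (Perf R) :=
  full_cohfun (@verdier_cohfun (homotopyCat R) (coh_cohfun ee) _ (@acyclic_cker R e ee))
    (@perfect_shift R).

(** * Thick subcategories of perfect complexes *)

Section LinearMaps.
Variables (R : pzRingType) (V W : lmodType R) (f : V -> W) (Hf : linear f).

Definition mklin : {linear V -> W} :=
  HB.pack f (GRing.isLinear.Build R V W _ f Hf).

Lemma mklinE x : mklin x = f x. Proof. by []. Qed.

End LinearMaps.

(** * Finitely generated projective modules and strictly perfect complexes *)

Section FGProjective.
Variable R : pzRingType.
Implicit Types M N : lmodType R.

(** The dual basis criterion: retracts and products inherit a dual basis directly, with no lifting
    problem to solve. *)
Definition fgp M : Prop :=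
  exists (I : finType) (x : I -> M) (xi : I -> {linear M -> R^o}),
    forall m, m = \sum_i (xi i m : R) *: x i.

Lemma sum_linear M (I : finType) (x : I -> M) :
  linear (fun c : {ffun I -> R^o} => \sum_i (c i : R) *: x i).
Proof.
move=> a u v; rewrite scaler_sumr -big_split; apply: eq_bigr => i _.
by rewrite !ffunE scalerDl scalerA.
Qed.

Lemma fgpP M : finitely_generated M /\ projective M <-> fgp M.
Proof.
split=> [[[k [x gen]] pr]|[I [x [xi H]]]].
  have [|g gK] := pr _ _ (mklin (sum_linear x)) (idfun : {linear M -> M}).
    move=> y; have [c ->] := gen y; exists [ffun j => c j : R^o].
    by rewrite mklinE; apply: eq_bigr => j _; rewrite ffunE.
  have Hxi j : linear (fun m => g m j : R^o).
    by move=> a u v; rewrite linearP !ffunE.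
  exists 'I_k, x, (fun j => mklin (Hxi j)) => m; exact: esym (gK m).
split.
  exists #|I|, (fun j => x (enum_val j)) => m.
  exists (fun j => xi (enum_val j) m); rewrite {1}[m]H.
  by rewrite (reindex (@enum_val I I)) //; apply: onW_bij; apply: enum_val_bij.
move=> M' N p f ps.
have /choice[y yE] : forall i, exists y, p y = f (x i) by move=> i; apply: ps.
have Hg : linear (fun m => \sum_i (xi i m : R) *: y i).
  move=> a u v; rewrite scaler_sumr -big_split; apply: eq_bigr => i _.
  by rewrite linearP scalerDl scalerA.
exists (mklin Hg) => m; rewrite mklinE [m in RHS]H !linear_sum.
by apply: eq_bigr => i _; rewrite !linearZ /= yE.
Qed.

Lemma fgp_retract M N (f : {linear M -> N}) (g : {linear N -> M}) :
  cancel g f -> fgp M -> fgp N.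
Proof.
move=> gK [I [x [xi H]]].
have Hxi i : linear (fun n => xi i (g n) : R^o) by move=> a u v; rewrite !linearP.
exists I, (fun i => f (x i)), (fun i => mklin (Hxi i)) => n.
rewrite -{1}[n]gK [g n]H linear_sum; apply: eq_bigr => i _; by rewrite linearZ.
Qed.

Lemma fgp_prod M N : fgp M -> fgp N -> fgp (M * N)%type.
Proof.
move=> [I [x [xi Hx]]] [J [y [yj Hy]]].
have H1 i : linear (fun p : M * N => xi i p.1 : R^o) by move=> a u v; rewrite /= linearP.
have H2 j : linear (fun p : M * N => yj j p.2 : R^o) by move=> a u v; rewrite /= linearP.
exists (I + J)%type,
  (fun k => match k with inl i => (x i, 0) | inr j => (0, y j) end),
  (fun k => match k with inl i => mklin (H1 i) | inr j => mklin (H2 j) end).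
move=> [m n]; rewrite big_sumType /= {1}[m]Hx {1}[n]Hy.
have -> : \sum_i (xi i m : R) *: (x i, 0 : N) = (\sum_i (xi i m : R) *: x i, 0).
  apply: (big_ind2 (fun (u : M * N) v => u = (v, 0))) => //.
    by move=> _ u _ v -> ->; congr pair; rewrite addr0.
  by move=> i _; congr pair; rewrite /= scaler0.
have -> : \sum_j (yj j n : R) *: (0 : M, y j) = (0, \sum_j (yj j n : R) *: y j).
  apply: (big_ind2 (fun (u : M * N) v => u = (0, v))) => //.
    by move=> _ u _ v -> ->; congr pair; rewrite addr0.
  by move=> i _; congr pair; rewrite /= scaler0.
by congr pair; rewrite /= ?addr0 ?add0r.
Qed.

Definition bounded (P : complex R) : Prop :=
  exists a b : int, forall i, i < a \/ b < i -> forall x : P i, x = 0.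

Lemma strictly_perfectP (P : complex R) :
  strictly_perfect P <-> bounded P /\ forall i, fgp (P i).
Proof.
by split=> -[bP H]; split=> // i; apply/fgpP/H.
Qed.

Lemma bounded_le (P Q : complex R) :
  (forall i, (forall x : P i, x = 0) -> forall y : Q i, y = 0) ->
  bounded P -> bounded Q.
Proof. by move=> H [a [b B]]; exists a, b => i /B /H. Qed.

(** Boundedness and projectivity are conditions degree by degree, so a degreewise retraction
    suffices. *)
Lemma strictly_perfect_retract (P Q : complex R) (f : forall i, {linear P i -> Q i})
    (g : forall i, {linear Q i -> P i}) :
  (forall i, cancel (g i) (f i)) -> strictly_perfect P -> strictly_perfect Q.
Proof.
move=> gK /strictly_perfectP[bP fP]; apply/strictly_perfectP; split.
  by apply: bounded_le bP => i P0 y; rewrite -(gK i y) (P0 (g i y)) raddf0.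
by move=> i; apply: fgp_retract (gK i) (fP i).
Qed.

Lemma strictly_perfect_shift (P : complex R) :
  strictly_perfect (shift_complex P) <-> strictly_perfect P.
Proof.
split=> /strictly_perfectP[[a [b B]] F]; apply/strictly_perfectP; split.
- exists (a + 1), (b + 1); elim/int_shift_ind => i H; apply: B.
  by rewrite !ltrD2r in H.
- by elim/int_shift_ind.
- exists (a - 1), (b - 1) => i H; apply: B.
  by case: H => H; [left; rewrite -ltrBrDr | right; rewrite -ltrBlDr].
- by move=> i; apply: F.
Qed.

Lemma strictly_perfect_cone (P Q : complex R) (f : chainMap P Q) :
  strictly_perfect P -> strictly_perfect Q -> strictly_perfect (cone f).
Proof.
move=> /strictly_perfect_shift/strictly_perfectP[[a [b B]] F].
move=> /strictly_perfectP[[a' [b' B']] F']; apply/strictly_perfectP; split.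
  exists (Order.min a a'), (Order.max b b') => i H [x y].
  have [H1 H2] : (i < a \/ b < i) /\ (i < a' \/ b' < i).
    by case: H; rewrite ?lt_min ?gt_max => /andP[H H']; split; auto.
  by congr pair; [apply: B H1 x | apply: B' H2 y].
by move=> i; apply: fgp_prod (F i) (F' i).
Qed.

End FGProjective.

Section ChainIso.
Variable R : pzRingType.
Implicit Types X Y : complex R.

Lemma homotopic_eq X Y (f g : chainMap X Y) :
  (forall i x, f i x = g i x) -> @heq (homotopyCat R) X Y f g.
Proof.
move=> fg; exists (fun i => \0 : {linear X (i + 1) -> Y i}) => i x.
by rewrite fg subrr /= raddf0 addr0.
Qed.

Definition chain_iso X Y (f : forall i, {linear X i -> Y i})
    (g : forall i, {linear Y i -> X i}) : Prop :=
  [/\ forall i x, f (i + 1) (cdiff X i x) = cdiff Y i (f i x),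
      forall i, cancel (f i) (g i) & forall i, cancel (g i) (f i)].

Lemma chain_iso_isomorphic X Y f g : @chain_iso X Y f g -> @isomorphic (homotopyCat R) X Y.
Proof.
move=> [fd fK gK].
have gd i y : g (i + 1) (cdiff Y i y) = cdiff X i (g i y).
  by rewrite -(fK (i + 1) (cdiff X i _)) fd gK.
exists (ChainMap fd), (ChainMap gd); split; apply: homotopic_eq => i x /=.
  exact: fK.
exact: gK.
Qed.

End ChainIso.

(** * Closure properties of thick subcategories in terms of complexes *)

Section Thick.
Variable R : pzRingType.
Let D := derivedCat R.
Let K := homotopyCat R.

Lemma disomorphic_trans (X Y Z : D) : isomorphic X Y -> isomorphic Y Z -> isomorphic X Z.
Proof.
have C (A B E : D) (f : hom A B) (g : hom B E) (f' : hom B A) (g' : hom E B) :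
    f' ∘ f ≈ idm A -> g' ∘ g ≈ idm B -> (f' ∘ g') ∘ (g ∘ f) ≈ idm A.
  move=> H1 H2; apply: lheq_trans (lheq_sym (lcompA _ _ _)) _.
  apply: lheq_trans H1; apply: lheq_comp; first exact: lheq_refl.
  apply: lheq_trans (lcompA _ _ _) _.
  by apply: lheq_trans (lcomp1l _); apply: lheq_comp H2 (lheq_refl _).
move=> [f [f' [f1 f2]]] [g [g' [g1 g2]]]; exists (g ∘ f), (f' ∘ g'); split; exact: C.
Qed.

Lemma strictly_perfect_perfect (P : complex R) : strictly_perfect P -> @perfect R P.
Proof. by move=> sP; exists P; split=> //; exists (idm (P : D)); apply: lid_iso. Qed.

Variables (S : Perf R -> Prop) (thS : thick S).

Definition inS (X : complex R) : Prop := exists p : @perfect R X, S (exist _ X p).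

Lemma inSE (X : complex R) (p : @perfect R X) : inS X <-> S (exist _ X p).
Proof. by split=> [[q]|Sp]; [rewrite (Prop_irrelevance p q) | exists p]. Qed.

Lemma inS_diso (X Y : complex R) : @isomorphic D X Y -> inS X -> inS Y.
Proof.
move=> XY [p Sp]; have [P [sP XP]] := p.
have q : @perfect R Y.
  by exists P; split=> //; apply: disomorphic_trans XP; apply: isomorphic_sym XY.
by exists q; apply: (thick_iso thS) Sp; case: XY => f ?; exists f.
Qed.

Lemma inS_iso (X Y : complex R) : @isomorphic K X Y -> inS X -> inS Y.
Proof. by move=> [f fi]; apply: inS_diso; exists (lemb _ f); apply: lemb_iso. Qed.

(** On strictly perfect complexes, cones, shifts and summands are explicit complexes, while [inS] is
    invariant under isomorphism in the derived category. *)
Definition Sp (X : complex R) : Prop := strictly_perfect X /\ inS X.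

Lemma Sp_iso (X Y : complex R) f g : @chain_iso R X Y f g -> Sp X -> Sp Y.
Proof.
move=> fg [sX SX]; split; last by apply: inS_iso SX; apply: chain_iso_isomorphic fg.
by case: fg => _ _ gK; apply: strictly_perfect_retract gK sX.
Qed.

Lemma Sp_shift (X : complex R) : Sp (shift_complex X) <-> Sp X.
Proof.
split=> -[sX SX].
  have sX' := (strictly_perfect_shift X).1 sX; split=> //.
  have p := strictly_perfect_perfect sX'.
  apply/(inSE p)/(thick_shift thS).
  exact: (inSE (perfect_shift (svalP (exist _ X p)))).1 SX.
split; first exact/strictly_perfect_shift.
case: SX => p SX; exists (perfect_shift (svalP (exist (@perfect R) X p))).
exact/(thick_shift thS (exist _ X p)).
Qed.

Lemma cone_dist (X Y : complex R) (f : chainMap X Y) :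
  @dist K X Y (cone f) f (cone_in_chain f) (cone_out_chain f).
Proof.
exists X, Y, f, (idm (X : K)), (idm (Y : K)), (idm (cone f : K)).
split; last by split; apply: homotopic_eq.
by split; [exists (idm (X : K)) | exists (idm (Y : K)) | exists (idm (cone f : K))];
  split; apply: homotopic_eq.
Qed.

Lemma Sp_cone (X Y : complex R) (f : chainMap X Y) : Sp X -> Sp Y -> Sp (cone f).
Proof.
move=> [sX SX] [sY SY]; have sC := strictly_perfect_cone f sX sY; split=> //.
have [pX pY pC] := And3 (strictly_perfect_perfect sX) (strictly_perfect_perfect sY)
  (strictly_perfect_perfect sC).
have d := @verdier_dist K (@acyclic R) _ _ _ _ _ _ (cone_dist f).
apply/(inSE pC); move: SX SY => /(inSE pX) SX /(inSE pY) SY.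
exact: (@thick_cone (Perf R) S thS (exist _ X pX) (exist _ Y pY) (exist _ (cone f) pC)
  _ _ _ d).
Qed.

Lemma Sp_summand (X Y Z : complex R) : @is_direct_sum K X Y Z ->
  strictly_perfect X -> strictly_perfect Y -> Sp Z -> Sp X.
Proof.
move=> dXYZ sX sY [sZ SZ]; split=> //.
have [pX pY pZ] := And3 (strictly_perfect_perfect sX) (strictly_perfect_perfect sY)
  (strictly_perfect_perfect sZ).
have d := @lemb_direct_sum K (@cone_in K (@acyclic R)) _ _ _ dXYZ.
apply/(inSE pX); move: SZ => /(inSE pZ).
exact: (@thick_summand (Perf R) S thS (exist _ X pX) (exist _ Y pY) (exist _ Z pZ) d).
Qed.

End Thick.

Section ZeroObjects.
Variable R : pzRingType.
Let D := derivedCat R.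
Let K := homotopyCat R.

Definition null (X : D) : Prop := idm X ≈ zerom X X.

Lemma null_direct_sum (X Y Z : D) :
  is_direct_sum X Y Z -> null X -> null Y -> null Z.
Proof.
move=> [i [j [p [q [_ _ _ _ s]]]]] X0 Y0.
have H (A : D) (f : hom A Z) (g : hom Z A) : null A -> f ∘ g ≈ zerom Z Z.
  move=> /lid_zero /(_ Z)[+ _] => /(_ f) f0.
  by apply: lheq_trans (lcomp_zerol _ g); apply: lheq_comp f0 (lheq_refl _).
apply: lheq_trans (lheq_sym s) _.
by apply: lheq_trans (lheq_add (H _ i p X0) (H _ j q Y0)) (ladd0 _).
Qed.

Lemma null_iso (X Y : D) : isomorphic X Y -> null X -> null Y.
Proof. by move=> [f [g [_ fg]]]; apply: localization_null_retract fg. Qed.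

Lemma null_is_zero (X : Perf R) : null (sval X) -> is_zero X.
Proof. by move=> /lid_zero X0 Y; apply: (X0 (sval Y)). Qed.

Lemma null_Sp (S : Perf R -> Prop) (X : complex R) :
  thick S -> strictly_perfect X -> null X -> Sp S X.
Proof.
move=> thS sX X0; have pX := strictly_perfect_perfect sX; split=> //; exists pX.
exact/(thick_zero thS)/null_is_zero.
Qed.

Lemma chain_iso_diso (X Y : complex R) f g : @chain_iso R X Y f g -> @isomorphic D X Y.
Proof.
by move=> /chain_iso_isomorphic[h hi]; exists (lemb _ h); apply: lemb_iso.
Qed.

End ZeroObjects.

(** * Splitting a complex along orthogonal idempotents *)

Section IdempotentPart.
Variable R : comPzRingType.

(** For idempotent [a] this is a V, with membership expressed by an equation. *)
Definition fixm (a : R) (V : lmodType R) : submod V.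
Proof.
apply: (@Submod _ _ (fun x => a *: x = x)).
- exact: scaler0.
- by move=> x y ax ay; rewrite scalerDr ax ay.
- by move=> b x ax; rewrite scalerA mulrC -scalerA ax.
Defined.

Fact fixm_map a (V W : lmodType R) (f : {linear V -> W}) x : fixm a V x -> fixm a W (f x).
Proof. by move=> /= ax; rewrite -linearZ ax. Qed.

Program Definition idem_part (a : R) (P : complex R) : complex R :=
  @Complex R (fun i => subm (fixm a (P i)))
    (fun i => submap (@fixm_map a _ _ (cdiff P i))) _.
Next Obligation. by apply: sm_inj; apply: cdiffK. Qed.

Lemma fixm_scale a (V : lmodType R) (x : V) : a * a = a -> fixm a V (a *: x).
Proof. by move=> aa; rewrite /= scalerA aa. Qed.

Lemma scale_linear (c : R) (V : lmodType R) : linear (fun x : V => c *: x).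
Proof. by move=> t x y; rewrite scalerDr !scalerA mulrC. Qed.

Definition idem_proj a (aa : a * a = a) (V : lmodType R) : {linear V -> subm (fixm a V)}.
Proof.
apply: (@mklin _ _ _ (fun x => mksub (fixm_scale x aa))).
by move=> b x y; apply: sm_inj; rewrite /= scalerDr !scalerA mulrC.
Defined.

Definition idem_incl a (V : lmodType R) : {linear subm (fixm a V) -> V}.
Proof. by apply: (@mklin _ _ _ (@smval _ _ _)). Defined.

Lemma strictly_perfect_idem a (aa : a * a = a) (P : complex R) :
  strictly_perfect P -> strictly_perfect (idem_part a P).
Proof.
apply: (@strictly_perfect_retract _ P (idem_part a P)
  (fun i => idem_proj aa (P i)) (fun i => idem_incl a (P i))).
by move=> i x; apply: sm_inj; apply: (subP x).
Qed.

Lemma idem_part1 (P : complex R) : exists f g, @chain_iso R (idem_part 1 P) P f g.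
Proof.
exists (fun i => idem_incl 1 (P i)), (fun i => idem_proj (mulr1 1) (P i)).
split=> i x //; last exact: scale1r.
by apply: sm_inj; apply: scale1r.
Qed.

Lemma idem_part0 (P : complex R) : @null R (idem_part 0 P).
Proof.
apply: lheq_emb; apply: homotopic_eq => i x; apply: sm_inj.
by rewrite /= -(subP x) /= scale0r.
Qed.

Section Orthogonal.
Variables (a b : R) (P : complex R).
Hypotheses (aa : a * a = a) (bb : b * b = b) (ab : a * b = 0).

Let ba : b * a = 0. Proof. by rewrite mulrC. Qed.

Lemma idemD : (a + b) * (a + b) = a + b.
Proof. by rewrite mulrDl !mulrDr aa bb ab ba addr0 add0r. Qed.

Let incl c (cab : (a + b) * c = c) (V : lmodType R) (x : V) : fixm c V x -> fixm (a + b) V x.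
Proof. by move=> /= cx; rewrite -{1}cx scalerA cab. Qed.

Let abl : (a + b) * a = a. Proof. by rewrite mulrDl aa ba addr0. Qed.
Let abr : (a + b) * b = b. Proof. by rewrite mulrDl bb ab add0r. Qed.

Let proj (c : R) (cc : c * c = c) (V : lmodType R) (x : V) : fixm (a + b) V x -> fixm c V (c *: x).
Proof. by move=> _; apply: fixm_scale. Qed.

Definition part_incl c (cab : (a + b) * c = c) : chainMap (idem_part c P) (idem_part (a + b) P).
Proof.
apply: (@ChainMap _ (idem_part c P) (idem_part (a + b) P)
  (fun i => submap (f := (idfun : {linear P i -> P i})) (@incl c cab (P i)))).
by move=> i x; apply: sm_inj.
Defined.

Definition part_proj c (cc : c * c = c) : chainMap (idem_part (a + b) P) (idem_part c P).
Proof.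
apply: (@ChainMap _ (idem_part (a + b) P) (idem_part c P)
  (fun i => submap (f := mklin (@scale_linear c (P i))) (@proj c cc (P i)))).
by move=> i x; apply: sm_inj; rewrite /= linearZ.
Defined.

Lemma part_inclE c (cab : (a + b) * c = c) i x : smval (part_incl cab i x) = smval x.
Proof. by []. Qed.

Lemma part_projE (c : R) (cc : c * c = c) i x : smval (part_proj cc i x) = c *: smval x.
Proof. by []. Qed.

Lemma idem_part_direct_sum :
  @is_direct_sum (homotopyCat R) (idem_part a P) (idem_part b P) (idem_part (a + b) P).
Proof.
exists (part_incl abl), (part_incl abr), (part_proj aa), (part_proj bb).
split; apply: homotopic_eq => i x; apply: sm_inj.
- by rewrite part_projE part_inclE; apply: (subP x).
- by rewrite part_projE part_inclE; apply: (subP x).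
- by rewrite part_projE part_inclE -(subP x) /= scalerA ab scale0r.
- by rewrite part_projE part_inclE -(subP x) /= scalerA ba scale0r.
- rewrite smvalD !part_inclE !part_projE -scalerDl; apply: (subP x).
Qed.

Variables (S : Perf R -> Prop) (thS : thick S).
Hypothesis sP : strictly_perfect P.

Lemma Sp_idem_summand : Sp S (idem_part (a + b) P) -> Sp S (idem_part a P).
Proof.
apply: (Sp_summand thS idem_part_direct_sum); exact: strictly_perfect_idem.
Qed.

(** Closure under cones gives closure under sums: the sum, shifted by one, is the cone of the zero
    map from a P to the shift of b P. *)
Lemma Sp_idem_sum : Sp S (idem_part a P) -> Sp S (idem_part b P) ->
  Sp S (idem_part (a + b) P).
Proof.
move=> Sa Sb; apply/(Sp_shift thS).
have := Sp_cone thS (chain_zero (idem_part a P) (shift_complex (idem_part b P))) Sa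
  ((Sp_shift thS _).2 Sb).
have Hf (i : int) : linear (fun u : cone (chain_zero (idem_part a P)
    (shift_complex (idem_part b P))) i =>
    part_incl abl (i + 1) u.1 + part_incl abr (i + 1) u.2).
  by move=> t u v; rewrite !linearP scalerDr addrACA.
have Hg (i : int) : linear (fun z : idem_part (a + b) P (i + 1) =>
    (part_proj aa (i + 1) z, part_proj bb (i + 1) z)
      : cone (chain_zero (idem_part a P) (shift_complex (idem_part b P))) i).
  by move=> t u v; rewrite !linearP.
apply: (@Sp_iso _ _ thS (cone (chain_zero (idem_part a P) (shift_complex (idem_part b P))))
  (shift_complex (idem_part (a + b) P)) (fun i => mklin (@Hf i)) (fun i => mklin (@Hg i))).
split=> i.
- move=> [x y]; apply: sm_inj; rewrite /= add0r.
  by rewrite linearD opprD.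
- move=> [x y]; congr pair; apply: sm_inj; rewrite /= scalerDr.
    by rewrite (subP x) /= -(subP y) /= scalerA ab scale0r addr0.
  by rewrite (subP y) /= -(subP x) /= scalerA ba scale0r add0r.
- by move=> z; apply: sm_inj; rewrite /= -scalerDl; apply: (subP z).
Qed.

End Orthogonal.

End IdempotentPart.

(** * Internally graded complexes and tensor products *)

Section InternalComplexes.
Variable R : comPzRingType.

Definition sgn (n : int) : R := (-1) ^+ `|n|%N.

Lemma sgnS n : sgn (n + 1) = - sgn n.
Proof.
rewrite /sgn; case: n => n; first by rewrite -PoszD addn1 exprS mulN1r.
have -> : Negz n + 1 = - n%:Z by rewrite NegzE; lia.
by rewrite abszN [in RHS]/absz exprS mulN1r opprK.
Qed.

Lemma sgn_cases n : sgn n = 1 \/ sgn n = -1.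
Proof. by rewrite /sgn -signr_odd; case: odd; [right|left]. Qed.

Lemma sgn_sq n : sgn n * sgn n = 1.
Proof. by case: (sgn_cases n) => ->; rewrite ?mulrNN mulr1. Qed.

(* Complexes whose terms are submodules of one ambient module [iV]: this avoids
   transporting elements along equalities between integer degrees. *)
Record icx := Icx {
  iV : lmodType R;
  igr : int -> submod iV;
  iD : {linear iV -> iV};
  iDgr : forall n x, igr n x -> igr (n + 1) (iD x);
  iDD : forall n x, igr n x -> iD (iD x) = 0
}.

Program Definition icomplex (A : icx) : complex R :=
  @Complex R (fun n => subm (igr A n)) (fun n => submap (@iDgr A n)) _.
Next Obligation. by apply: sm_inj; apply: iDD (subP x). Qed.

Fact sign_gr (A : icx) (c : R) n x : igr A n x -> igr A (n + 1) (c *: iD A x).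
Proof. by move=> /iDgr Hx; apply: smZ. Qed.

Fact sign_linear (A : icx) (c : R) : linear (fun x : iV A => c *: iD A x).
Proof. by move=> t x y; rewrite linearP scalerDr !scalerA mulrC. Qed.

Program Definition isign (c : R) (A : icx) : icx :=
  @Icx (iV A) (igr A) (mklin (@sign_linear A c)) _ _.
Next Obligation. exact: sign_gr. Qed.
Next Obligation. by rewrite linearZ /= (iDD H) !scaler0. Qed.

Program Definition ishift (k : int) (A : icx) : icx :=
  @Icx (iV A) (fun n => igr A (n + k)) (iD A) _ _.
Next Obligation. by rewrite addrAC; apply: iDgr. Qed.
Next Obligation. exact: iDD H. Qed.

(** Extension with subcomplex [B] and quotient [A], both unshifted: the differential is triangular
    with twisting [f], and [fd] makes its square vanish. *)
Program Definition iext (A B : icx) (f : {linear iV A -> iV B})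
    (fgr : forall n x, igr A n x -> igr B (n + 1) (f x))
    (fd : forall n x, igr A n x -> f (iD A x) + iD B (f x) = 0) : icx :=
  @Icx (iV A * iV B)%type (fun n => @Submod _ _ (fun x => igr A n x.1 /\ igr B n x.2) _ _ _)
    (@mklin _ _ _ (fun x => (iD A x.1, f x.1 + iD B x.2)) _) _ _.
Next Obligation. by split; apply: sm0. Qed.
Next Obligation. by split; apply: smD. Qed.
Next Obligation. by split; apply: smZ. Qed.
Next Obligation.
move=> t [x y] [x' y']; congr pair; rewrite /= !linearP //.
by rewrite scalerDr addrACA.
Qed.
Next Obligation.
split; first exact: iDgr.
by apply: smD; [apply: fgr | apply: iDgr].
Qed.
Next Obligation.
congr pair; rewrite /= ?(iDD H) //.
by rewrite linearD /= addrA (fd n) ?(iDD H0) ?addr0.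
Qed.

Section Transfer.
Variables (A B : icx) (f : int -> {linear iV A -> iV B}) (g : int -> {linear iV B -> iV A}).
Hypothesis fgr : forall n x, igr A n x -> igr B n (f n x).
Hypothesis ggr : forall n x, igr B n x -> igr A n (g n x).
Hypothesis fd : forall n x, igr A n x -> f (n + 1) (iD A x) = iD B (f n x).
Hypothesis fK : forall n x, igr A n x -> g n (f n x) = x.
Hypothesis gK : forall n x, igr B n x -> f n (g n x) = x.

Lemma icomplex_iso : exists f' g', @chain_iso R (icomplex A) (icomplex B) f' g'.
Proof.
exists (fun n => submap (@fgr n)), (fun n => submap (@ggr n)).
split=> n x; apply: sm_inj.
- exact: fd (subP x).
- exact: fK (subP x).
- exact: gK (subP x).
Qed.
End Transfer.

Section Closure.
Variables (S : Perf R -> Prop) (thS : thick S).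
Let SI (A : icx) := Sp S (icomplex A).

Lemma Sp_transfer (A B : icx) (f : {linear iV A -> iV B}) (g : {linear iV B -> iV A}) :
  (forall n x, igr A n x -> igr B n (f x)) ->
  (forall n x, igr B n x -> igr A n (g x)) ->
  (forall n x, igr A n x -> f (iD A x) = iD B (f x)) ->
  (forall n x, igr A n x -> g (f x) = x) ->
  (forall n x, igr B n x -> f (g x) = x) -> SI A -> SI B.
Proof.
move=> H1 H2 H3 H4 H5; have [|||||f' [g' fg]] := @icomplex_iso A B (fun=> f) (fun=> g) => //.
exact: (Sp_iso thS fg).
Qed.

(** Multiplication by (-1)^n in degree n identifies a complex with the one of opposite
    differential. *)
Lemma Sp_isign c A : c = 1 \/ c = -1 -> SI A -> SI (isign c A).
Proof.
move=> [->|->].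
  by apply: (@Sp_transfer A (isign 1 A) idfun idfun) => // n x _ /=; rewrite scale1r.
pose f n := mklin (@scale_linear R (sgn n) (iV A)).
have fgr n x : igr A n x -> igr A n (f n x) by apply: smZ.
have [|||f' [g' fg]] := @icomplex_iso A (isign (-1) A) f f fgr fgr.
- by move=> n x _; rewrite /= sgnS scaleNr [iD A (_ *: x)]linearZ /= scaleN1r.
- by move=> n x _; rewrite /= scalerA sgn_sq scale1r.
- by move=> n x _; rewrite /= scalerA sgn_sq scale1r.
exact: (Sp_iso thS fg).
Qed.

(** [f] is a chain map from [A] to the shift of [B]; its cone is the shift of the extension, up to
    the sign of the second coordinate. *)
Lemma Sp_iext (A B : icx) (f : {linear iV A -> iV B}) fgr fd :
  SI A -> SI B -> SI (@iext A B f fgr fd).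
Proof.
move=> SA /(Sp_shift thS) SB; apply/(Sp_shift thS).
pose fB n : {linear icomplex A n -> shift_complex (icomplex B) n} := submap (f := f) (@fgr n).
have fBd n (x : icomplex A n) :
    fB (n + 1) (cdiff (icomplex A) n x) = cdiff (shift_complex (icomplex B)) n (fB n x).
  apply: sm_inj; apply/eqP; rewrite -subr_eq0 /= opprK; apply/eqP; exact: fd (subP x).
pose F : chainMap (icomplex A) (shift_complex (icomplex B)) := ChainMap fBd.
have := Sp_cone thS F SA SB.
pose E := iext fgr fd.
have pE n (u : cone F n) : igr E (n + 1) (smval u.1, - smval u.2).
  by split; [exact: (subP u.1) | apply: smN; exact: (subP u.2)].
have Hf n : linear (fun u : cone F n => mksub (pE n u) : shift_complex (icomplex E) n).
  move=> t u v; apply: sm_inj; congr pair => //=.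
  by rewrite opprD scalerN.
have Hg n : linear (fun u : shift_complex (icomplex E) n =>
    (mksub (subP u).1, mksub (smN (subP u).2)) : cone F n).
  by move=> t u v; congr pair; apply: sm_inj => //=; rewrite opprD scalerN.
apply: (@Sp_iso _ _ thS (cone F) (shift_complex (icomplex E)) (fun i => mklin (@Hf i))
  (fun i => mklin (@Hg i))).
split=> n.
- move=> [x y]; apply: sm_inj; congr pair => //=.
  by rewrite !linearN opprD opprK.
- by move=> [x y]; congr pair; apply: sm_inj => //=; rewrite opprK.
- by move=> x; apply: sm_inj => /=; case: x => -[x1 x2] H; rewrite /= opprK.
Qed.

(** [shift_complex] negates the differential and [ishift] does not; [Sp_isign] absorbs the
    difference. *)
Lemma Sp_ishift1 A : SI (ishift 1 A) <-> SI A.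
Proof.
have H : SI (isign (-1) (ishift 1 A)) <-> SI A.
  have [f [g [fd fK gK]]] : exists f g,
      @chain_iso R (shift_complex (icomplex A)) (icomplex (isign (-1) (ishift 1 A))) f g.
    exists (fun i => idfun), (fun i => idfun); split=> // n x.
    by apply: sm_inj; rewrite /= scaleN1r.
  have gd : forall i x, g (i + 1) (cdiff _ i x) = cdiff _ i (g i x).
    by move=> i y; rewrite -(fK (i + 1) (cdiff _ i _)) fd gK.
  split=> [SA|/(Sp_shift thS)]; last exact: (Sp_iso thS (And3 fd fK gK)).
  by apply/(Sp_shift thS)/(Sp_iso thS (And3 gd gK fK)).
split=> SA; first by apply/H/Sp_isign => //; right.
have := Sp_isign (c := -1) (or_intror erefl) (H.2 SA).
by apply: (@Sp_transfer (isign (-1) (isign (-1) (ishift 1 A))) (ishift 1 A) idfun idfun)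
  => // n x _ /=; rewrite !scaleN1r opprK.
Qed.

Lemma Sp_ishift k A : SI (ishift k A) <-> SI A.
Proof.
have step j : SI (ishift (j + 1) A) <-> SI (ishift j A).
  apply: iff_trans (Sp_ishift1 _).
  split; [apply: (@Sp_transfer (ishift (j + 1) A) (ishift 1 (ishift j A)) idfun idfun)
    | apply: (@Sp_transfer (ishift 1 (ishift j A)) (ishift (j + 1) A) idfun idfun)] => // n x;
    by rewrite /= addrA [n + j + 1]addrAC.
have base : SI (ishift 0 A) <-> SI A.
  split; [apply: (@Sp_transfer (ishift 0 A) A idfun idfun)
    | apply: (@Sp_transfer A (ishift 0 A) idfun idfun)] => // n x /=; by rewrite addr0.
elim: k => [|k IH|k IH]; first exact: base.
  by rewrite -addn1 PoszD; apply: iff_trans (step k) IH.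
apply: iff_trans IH; apply: iff_sym; rewrite -addn1 PoszD opprD.
by rewrite -{1}[- k%:Z](subrK 1); apply: step.
Qed.

Lemma Sp_izero A : (forall n x, igr A n x -> x = 0) -> SI A.
Proof.
move=> A0; have Z n (x : icomplex A n) : x = 0 by apply: sm_inj; apply: A0 (subP x).
apply: null_Sp => //.
  apply/strictly_perfectP; split; first by exists 0, 0 => i _ x; apply: Z.
  move=> i; exists void, (of_void _), (of_void _).
  by move=> m; rewrite (Z i m); apply/esym/Z.
by apply: lheq_emb; apply: homotopic_eq => i x; rewrite (Z i x) raddf0 raddf0.
Qed.

End Closure.

(* Matrices of bounded complexes of free modules over the ring [e R], with
   rows and columns outside [qsupp] ignored. *)
Record mtx (e : R) := Mtx {
  qI : finType;
  qsupp : {set qI};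
  qdeg : qI -> int;
  qD : qI -> qI -> R;
  qDe : forall i j, e * qD i j = qD i j;
  qDdeg : forall i j, qD i j <> 0 -> qdeg i = qdeg j + 1;
  qDsupp : forall i j, qD i j <> 0 -> i \in qsupp /\ j \in qsupp;
  qDD : forall i j, \sum_k qD i k * qD k j = 0
}.

Section Tensor.
Variables (e : R) (Q : mtx e) (A : icx).

(** Column [j] of [qD] is the differential of the basis vector [j], so this says that [P] spans a
    subcomplex. *)
Definition qclosed (P : {set qI Q}) : Prop :=
  forall i j, qD (m := Q) i j <> 0 -> j \in P -> i \in P.

Section TensorPart.
Variables (P : {set qI Q}) (clP : qclosed P).

Fact tens_linear : linear (fun u : {ffun qI Q -> iV A} =>
  [ffun i => if i \in P then sgn (qdeg i) *: iD A (u i) + \sum_j qD (m := Q) i j *: u j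
             else 0]).
Proof.
move=> t u v; apply/ffunP => i; rewrite !ffunE; case: ifP => _; last first.
  by rewrite scaler0 addr0.
rewrite linearP scalerDr scalerDr !scalerA [sgn _ * t]mulrC addrACA -scalerA; congr (_ + _).
rewrite scaler_sumr -big_split; apply: eq_bigr => j _.
by rewrite !ffunE scalerDr !scalerA mulrC.
Qed.

Lemma qD_eq i j : (qD (m := Q) i j = 0) \/ (qdeg i = qdeg j + 1 /\ (j \in P -> i \in P)).
Proof.
have [->|/eqP ne] := eqVneq (qD i j) 0; [by left|right].
by split; [apply: qDdeg | apply: clP].
Qed.

(* The part of [Q ⊗ A] spanned by the basis vectors of [Q] in [P]. *)
Program Definition itens : icx :=
  @Icx {ffun qI Q -> iV A}
    (fun n => @Submod _ _ (fun u => forall i, if i \in P then igr A (n - qdeg i) (u i) else u i = 0)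
       _ _ _)
    (mklin tens_linear) _ _.
Next Obligation. by case: ifP => _; rewrite ffunE //; apply: sm0. Qed.
Next Obligation.
move: (H i) (H0 i); case: ifP => _; rewrite ffunE.
  by move=> Hx Hy; exact (smD Hx Hy).
by move=> -> ->; rewrite addr0.
Qed.
Next Obligation.
move: (H i); case: ifP => _; rewrite ffunE.
  by move=> Hx; apply: smZ.
by move=> ->; rewrite scaler0.
Qed.
Next Obligation.
case: ifP => iP; rewrite ffunE iP //; apply: smD.
  apply: smZ; rewrite addrAC; apply: iDgr; by have := H i; rewrite iP.
apply: sm_sum => j _; have [->|[dj _]] := qD_eq i j; first by rewrite scale0r; apply: sm0.
have := H j; case: ifP => [jP gj|_ ->]; last by rewrite scaler0; apply: sm0.
by apply: smZ; rewrite dj opprD addrA addrAC addrK.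
Qed.
Next Obligation.
apply/ffunP => i; rewrite !ffunE; case: ifP => // iP.
rewrite iP linearD linearZ /= (iDD (n := n - qdeg i)); last by have := H i; rewrite iP.
rewrite scaler0 add0r linear_sum scaler_sumr -big_split /=.
transitivity (\sum_j \sum_k (qD (m := Q) i j * qD (m := Q) j k) *: x k).
  apply: eq_bigr => j _; rewrite ffunE linearZ /=.
  have [-> |[dj _]] := qD_eq i j.
    by rewrite !scale0r scaler0 addr0 big1 // => k _; rewrite mul0r scale0r.
  rewrite dj sgnS; case: ifP => jP.
    rewrite scalerDr !scalerA mulNr scaleNr mulrC addrA addNr add0r scaler_sumr.
    by apply: eq_bigr => k _; rewrite scalerA.
  have xj : x j = 0 by have := H j; rewrite jP.
  rewrite xj linear0 !scaler0 addr0 big1 // => k _.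
  have [->|[_ kj]] := qD_eq j k; first by rewrite mulr0 scale0r.
  have := H k; case: ifP => [kP|_ ->]; last by rewrite scaler0.
  by rewrite kj in jP.
rewrite exchange_big big1 // => k _.
by rewrite -scaler_suml qDD scale0r.
Qed.

End TensorPart.
End Tensor.
End InternalComplexes.

(** * Thick subcategories absorb tensor products with finite free complexes *)

Section TensorThick.
Variables (R : comPzRingType) (e : R) (Q : mtx e).
Variables (S : Perf R -> Prop) (thS : thick S) (A : icx R).

Lemma qDdeg0 i j : qdeg (m := Q) i <> qdeg j + 1 -> qD (m := Q) i j = 0.
Proof. by move=> H; apply: contrapT => /qDdeg. Qed.

Section Split.
Variables (P : {set qI Q}) (clP : qclosed P) (a : qI Q).
Hypotheses (aP : a \in P) (mina : forall b, b \in P -> qdeg a <= qdeg b).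

Fact qclosedD1 : qclosed (P :\ a).
Proof.
move=> i j Dij; rewrite !inE => /andP[_ jP]; rewrite (clP Dij jP) andbT.
apply/eqP => ia; have := qDdeg Dij; have := mina jP; rewrite ia; lia.
Qed.

Let A1 := isign (sgn R (qdeg a)) (ishift (- qdeg a) A).
Let B1 := itens A qclosedD1.

Fact split_linear : linear (fun x : iV A => [ffun b => qD (m := Q) b a *: x]).
Proof.
move=> t x y; apply/ffunP => b; rewrite !ffunE scalerDr !scalerA.
by rewrite [t * _]mulrC.
Qed.

Let f : {linear iV A1 -> iV B1} := mklin split_linear.

Let Daa : qD (m := Q) a a = 0. Proof. by apply: qDdeg0; lia. Qed.

Let fgr n x : igr A1 n x -> igr B1 (n + 1) (f x).
Proof.
move=> gx b; rewrite !inE ffunE.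
have [->|nD] := pselect (qD (m := Q) b a = 0).
  by rewrite scale0r; case: ifP => // _; apply: sm0.
have bP := clP nD aP; rewrite bP; have -> : b != a by apply/eqP => ba; rewrite ba Daa in nD.
apply: smZ; have -> : n + 1 - qdeg b = n - qdeg a by have := qDdeg nD; lia.
exact: gx.
Qed.

Let fd n x : igr A1 n x -> f (iD A1 x) + iD B1 (f x) = 0.
Proof.
move=> gx; apply/ffunP => b; rewrite !ffunE !inE.
have -> : \sum_j qD (m := Q) b j *: f x j = 0.
  transitivity (\sum_j (qD (m := Q) b j * qD (m := Q) j a) *: x).
    by apply: eq_bigr => j _; rewrite ffunE scalerA.
  by rewrite -scaler_suml qDD scale0r.
rewrite addr0 -[iD A1 x]/(sgn R (qdeg a) *: iD A x).
have [->|nD] := pselect (qD (m := Q) b a = 0).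
  by rewrite !scale0r linear0 scaler0 add0r; case: ifP.
rewrite (clP nD aP); have -> : b != a by apply/eqP => ba; rewrite ba Daa in nD.
have -> : iD A (qD b a *: x) = qD b a *: iD A x by rewrite linearZ.
by rewrite /= (qDdeg nD) sgnS !scalerA -scalerDl mulNr mulrC subrr scale0r.
Qed.

(** No differential reaches the basis vector [a] of lowest degree. The others thus span a
    subcomplex, and the quotient is a shift of [A], with the sign of the tensor differential. *)
Lemma Sp_itens_split : Sp S (icomplex A) -> Sp S (icomplex B1) -> Sp S (icomplex (itens A clP)).
Proof.
move=> SA SB.
have SA1 : Sp S (icomplex A1).
  by apply: (Sp_isign thS); [apply: sgn_cases | apply/(Sp_ishift thS)].
have := Sp_iext thS fgr fd SA1 SB.
have Hp : linear (fun u : iV A * {ffun qI Q -> iV A} =>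
    [ffun b => if b == a then u.1 else u.2 b]).
  move=> t u v; apply/ffunP => b; rewrite !ffunE; case: eqP => _ //=.
have Hq : linear (fun u : {ffun qI Q -> iV A} =>
    (u a, [ffun b => if b == a then 0 else u b]) : iV A * {ffun qI Q -> iV A}).
  move=> t u v; congr pair; first by rewrite /= !ffunE.
  apply/ffunP => b; rewrite !ffunE; case: eqP => _ //=.
  by rewrite scaler0 addr0.
apply: (@Sp_transfer _ _ thS (iext fgr fd) (itens A clP) (mklin Hp) (mklin Hq)).
- move=> n [x u] [/= gx gu] b; rewrite ffunE /=; have := gu b; rewrite !inE.
  by case: eqP => [->|_] //=; rewrite aP.
- move=> n u gu; split=> /=; first by have := gu a; rewrite aP.
  move=> b; rewrite !inE ffunE; have := gu b.
  by case: eqP => [->|_] //=.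
- move=> n [x u] [/= gx gu]; apply/ffunP => b; rewrite !ffunE /=.
  have E c : \sum_j qD (m := Q) c j *: [ffun b => if b == a then x else u b] j =
      qD (m := Q) c a *: x + \sum_j qD (m := Q) c j *: u j.
    rewrite (bigD1 a) //= [in RHS](bigD1 a) //= ffunE eqxx.
    have -> : u a = 0 by have := gu a; rewrite !inE eqxx.
    rewrite scaler0 add0r; congr (_ + _); apply: eq_bigr => j ja.
    by rewrite ffunE (negPf ja).
  rewrite E !inE; case: eqP => [->|ba] /=; last first.
    case: ifP => bP; first by rewrite addrCA.
    rewrite addr0.
    have [->|nD] := pselect (qD (m := Q) b a = 0); first by rewrite scale0r.
    by rewrite (clP nD aP) in bP.
  rewrite aP Daa scale0r add0r big1 ?addr0 // => j _.
  have := gu j; rewrite !inE; case: ifP => [/andP[ja jP] _|_ ->]; last by rewrite scaler0.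
  by rewrite qDdeg0 ?scale0r //; have := mina jP; lia.
- move=> n [x u] [/= gx gu]; congr pair; rewrite ?ffunE ?eqxx //.
  apply/ffunP => b; rewrite !ffunE; case: eqP => [->|//].
  by have := gu a; rewrite !inE eqxx.
- by move=> n u gu; apply/ffunP => b; rewrite !ffunE /=; case: eqP => [->|].
Qed.
End Split.

Lemma Sp_itens (P : {set qI Q}) (clP : qclosed P) :
  Sp S (icomplex A) -> Sp S (icomplex (itens A clP)).
Proof.
move=> SA; have [k Pk] := ubnP #|P|; elim: k => // k IH in P clP Pk *.
have [P0|[a0 a0P]] := set_0Vmem P.
  apply: (Sp_izero thS) => n u gu; apply/ffunP => b; have := gu b.
  by rewrite {1}P0 inE ffunE.
case: (@arg_minP _ _ _ a0 (mem P) (fun b => qdeg b) a0P) => a aP mina.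
have {}aP : a \in P := aP.
have {}mina b (bP : b \in P) : qdeg a <= qdeg b := mina b bP.
apply: (@Sp_itens_split P clP a aP mina SA); apply: IH.
by move: Pk; rewrite (cardsD1 a) aP.
Qed.

End TensorThick.

(** * The complex e R and its generation by a complex with a pivot *)

Section UnitComplex.
Variables (R : comPzRingType) (e : R).
Hypothesis ee : e * e = e.

Program Definition iunit : icx R :=
  @Icx R R^o (fun n => @Submod _ _ (fun r : R^o => if n == 0 then e *: r = r else r = 0) _ _ _)
    \0 _ _.
Next Obligation. by case: ifP; rewrite ?scaler0. Qed.
Next Obligation.
move: H H0; case: ifP => _; first by move=> Hx Hy; rewrite scalerDr Hx Hy.
by move=> -> ->; rewrite addr0.
Qed.
Next Obligation.
move: H; case: ifP => _; first by move=> Hx; rewrite scalerA mulrC -scalerA Hx.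
by move=> ->; rewrite scaler0.
Qed.
Next Obligation. by case: ifP; rewrite ?scaler0. Qed.

Lemma iunit_fix n (r : iV iunit) : igr iunit n r -> e * r = r.
Proof. by move=> /=; case: eqP => // _ ->; rewrite mulr0. Qed.

Lemma qsupp_closed (Q : mtx e) : qclosed (qsupp Q).
Proof. by move=> i j /qDsupp[]. Qed.

Definition mcx (Q : mtx e) : icx R := itens iunit (@qsupp_closed Q).

Section Retract.
Variables (A : icx R) (phi : {linear iV A -> R^o}) (w : iV A).
Hypothesis phi_gr : forall n x, igr A n x -> igr iunit n (phi x).
Hypothesis phi_d : forall n x, igr A n x -> phi (iD A x) = 0.
Hypothesis w0 : igr A 0 w.
Hypothesis phi_w : phi w = e.
Hypothesis dw : iD A w = 0.

Definition ker_gr (n : int) : submod (iV A).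
Proof.
apply: (@Submod _ _ (fun x => igr A n x /\ phi x = 0)).
- by split; [apply: sm0 | apply: linear0].
- move=> x y [gx px] [gy py]; split; first exact: smD.
  by rewrite linearD px py addr0.
- move=> a x [gx px]; split; first exact: smZ.
  by rewrite linearZ /= px scaler0.
Defined.

Fact ker_D_gr n x : ker_gr n x -> ker_gr (n + 1) (iD A x).
Proof. by move=> [gx _]; split; [apply: iDgr | apply: phi_d gx]. Qed.

Definition iker : icx R :=
  @Icx R (iV A) ker_gr (iD A) ker_D_gr (fun n x kx => iDD kx.1).

Fact unit_in_gr n (r : iV iunit) : igr iunit n r -> igr A n (r *: w).
Proof.
by move=> /=; case: eqP => [-> _|_ ->]; [apply: smZ | rewrite scale0r; apply: sm0].
Qed.

Fact unit_in_linear : linear (fun r : R^o => r *: w).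
Proof. by move=> t r s; rewrite scalerDl scalerA. Qed.

Fact ker_proj_linear : linear (fun x => x - phi x *: w).
Proof.
move=> t x y; rewrite linearP scalerDl -[t *: phi x]/(t * phi x) -scalerA opprD addrACA.
by rewrite -scalerBr.
Qed.

Lemma phi_fix n x : igr A n x -> e * phi x = phi x.
Proof. by move=> /phi_gr/iunit_fix. Qed.

Fact ker_proj_gr n x : igr A n x -> igr iker n (x - phi x *: w).
Proof.
move=> gx; split; first by apply: smB => //; apply/unit_in_gr/phi_gr.
by rewrite linearB linearZ /= phi_w [_ *: _]mulrC (phi_fix gx) subrr.
Qed.

Let inu n : {linear icomplex iunit n -> icomplex A n} :=
  submap (f := mklin unit_in_linear) (@unit_in_gr n).
Let outu n : {linear icomplex A n -> icomplex iunit n} := submap (@phi_gr n).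
Let ink n : {linear icomplex iker n -> icomplex A n} :=
  submap (f := (idfun : {linear iV A -> iV A})) (fun x (kx : igr iker n x) => kx.1).
Let outk n : {linear icomplex A n -> icomplex iker n} :=
  submap (f := mklin ker_proj_linear) (@ker_proj_gr n).

(** The cycle [w] lies over [e], so r ↦ [r *: w] is a section of the chain map [phi] and A = e R ⊕
    ker phi. Both summands are degreewise retracts of [A], hence strictly perfect. *)
Lemma Sp_unit_retract (S : Perf R -> Prop) : thick S ->
  Sp S (icomplex A) -> Sp S (icomplex iunit).
Proof.
move=> thS SA.
have iuK n : cancel (inu n) (outu n).
  move=> r; apply: sm_inj; rewrite /= linearZ /= phi_w [_ *: _]mulrC.
  exact: iunit_fix (subP r).
have ikK n : cancel (ink n) (outk n).
  by move=> x; apply: sm_inj; rewrite /= (subP x).2 scale0r subr0.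
have sU := strictly_perfect_retract iuK SA.1.
have sK := strictly_perfect_retract ikK SA.1.
apply: (Sp_summand thS _ sU sK SA).
have d1 n r : inu (n + 1) (cdiff (icomplex iunit) n r) = cdiff (icomplex A) n (inu n r).
  by apply: sm_inj; rewrite /= scale0r linearZ /= dw scaler0.
have d2 n x : ink (n + 1) (cdiff (icomplex iker) n x) = cdiff (icomplex A) n (ink n x).
  by apply: sm_inj.
have d3 n x : outu (n + 1) (cdiff (icomplex A) n x) = cdiff (icomplex iunit) n (outu n x).
  by apply: sm_inj; apply: phi_d (subP x).
have d4 n x : outk (n + 1) (cdiff (icomplex A) n x) = cdiff (icomplex iker) n (outk n x).
  apply: sm_inj; rewrite /= (phi_d (subP x)) scale0r subr0.
  by rewrite linearB linearZ /= dw scaler0 subr0.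
exists (ChainMap d1 : chainMap _ _), (ChainMap d2 : chainMap _ _),
  (ChainMap d3 : chainMap _ _), (ChainMap d4 : chainMap _ _).
split; apply: homotopic_eq => n x; apply: sm_inj.
- exact: congr1 (iuK n x).
- exact: congr1 (ikK n x).
- exact: (subP x).2.
- by rewrite /= -[phi _]/(smval (outu n (inu n x))) iuK subrr.
- by rewrite /= addrC subrK.
Qed.

End Retract.

Section Generation.
Variables (Q : mtx e) (S : Perf R -> Prop) (thS : thick S).
Hypothesis SX : Sp S (icomplex (mcx Q)).
Variable x0 : qI Q.
Hypotheses (x0P : x0 \in qsupp Q) (x0deg : qdeg x0 = 0).
Hypothesis row0 : forall j, qD (m := Q) x0 j = 0.

Let c p := qD (m := Q) p x0.
Let cs := [seq c p | p <- enum (qI Q)].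
Let X := mcx Q.

(* [lv_kill] expresses that [iD A w] has coefficients in the [k]-th power of the
   ideal generated by [cs], without mentioning that ideal. *)
Record level (k : nat) (A : icx R) (phi : {linear iV A -> R^o}) (w : iV A) : Prop := Level {
  lv_Sp : Sp S (icomplex A);
  lv_gr : forall n x, igr A n x -> igr iunit n (phi x);
  lv_d : forall n x, igr A n x -> phi (iD A x) = 0;
  lv_w0 : igr A 0 w;
  lv_w : phi w = e;
  lv_kill : forall t, kills cs k t -> t *: iD A w = 0
}.

Fact coord_linear : linear (fun x : iV X => x x0).
Proof. by move=> t x y; rewrite !ffunE. Qed.

Let delta : iV X := [ffun a => if a == x0 then e : R^o else 0].

Let c_cases a : c a = 0 \/ (a \in qsupp Q /\ qdeg a = 1).
Proof.
have [->|nD] := pselect (c a = 0); [by left|right].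
by rewrite (qDdeg nD) x0deg add0r; case: (qDsupp nD).
Qed.

Let c_in a : c a \in cs. Proof. by apply: map_f; rewrite mem_enum. Qed.

Let Xx0 n x : igr X n x -> igr iunit n (x x0).
Proof. by move=> /(_ x0); rewrite x0P x0deg subr0. Qed.

Let dXx0 x : iD X x x0 = 0.
Proof.
by rewrite ffunE x0P scaler0 add0r big1 // => j _; rewrite row0 scale0r.
Qed.

Let delta0 : igr X 0 delta.
Proof.
move=> a; rewrite ffunE; case: eqP => [->|_].
  by rewrite x0P x0deg subr0; apply: ee.
by case: ifP => // _; apply: sm0.
Qed.

Let d_delta a : iD X delta a = c a.
Proof.
rewrite ffunE; case: ifP => aP.
  rewrite scaler0 add0r (bigD1 x0) //= big1 ?addr0 => [|j /negPf jx].
    by rewrite ffunE eqxx [_ *: _]mulrC qDe.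
  by rewrite ffunE jx scaler0.
by case: (c_cases a) => [->//|[aP']]; rewrite aP' in aP.
Qed.

Lemma level1 : exists A phi w, @level 1 A phi w.
Proof.
exists X, (mklin coord_linear), delta; split=> //.
- by move=> n x _; apply: dXx0.
- by rewrite /= ffunE eqxx.
- move=> t kt; apply/ffunP => a; rewrite ffunE d_delta ffunE.
  by have := kt [:: c a]; rewrite big_seq1; apply=> // b; rewrite inE => /eqP->.
Qed.

(* The next complex is the homotopy pushout [X ⊕ A ⊕ (X ⊗ A)[1]] of [X] and [A]
   over [X ⊗ A]; the differential of the vector [w'] below is [- c ⊗ iD A w]. *)
Section Step.
Variables (k : nat) (A : icx R) (phi : {linear iV A -> R^o}) (w : iV A).
Hypothesis lv : level k phi w.

Let XA := isign (-1) (ishift 1 (itens A (@qsupp_closed Q))).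

Let DS0 n x : igr A n x -> igr X (n + 1) ((\0 : {linear iV A -> iV X}) x).
Proof. by move=> _; apply: sm0. Qed.

Let DSd n x : igr A n x ->
  (\0 : {linear iV A -> iV X}) (iD A x) + iD X ((\0 : {linear iV A -> iV X}) x) = 0.
Proof. by move=> _; rewrite linear0 addr0. Qed.

Let DS := iext DS0 DSd.

Fact step_linear : linear (fun u : iV XA =>
  (- u x0, [ffun a => phi (u a)]) : iV A * iV X).
Proof.
move=> t u v; congr pair; first by rewrite /= !ffunE opprD scalerN.
by apply/ffunP => a; rewrite !ffunE linearP.
Qed.

Let F : {linear iV XA -> iV DS} := mklin step_linear.

Let Fgr n u : igr XA n u -> igr DS (n + 1) (F u).
Proof.
move=> gu; split=> [|a] /=.
  by apply: smN; have := gu x0; rewrite x0P x0deg subr0.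
have := gu a; rewrite ffunE; case: ifP => _; last by move=> ->; rewrite linear0.
exact: (lv_gr lv).
Qed.

Let Fd n u : igr XA n u -> F (iD XA u) + iD DS (F u) = 0.
Proof.
move=> gu; congr pair => /=.
  rewrite !ffunE x0P x0deg [sgn _ _]expr0 scale1r big1 ?addr0.
    by rewrite scaleN1r opprK linearN subrr.
  by move=> j _; rewrite row0 scale0r.
apply/ffunP => a; rewrite add0r !ffunE scaleN1r linearN; have := gu a.
case: ifP => aP ga; last by rewrite linear0 oppr0 addr0.
have E : phi (sgn R (qdeg a) *: iD A (u a)) = 0.
  by rewrite linearZ /= (lv_d lv ga) scaler0.
rewrite linearD E add0r scaler0 add0r linear_sum.
apply/eqP; rewrite addrC subr_eq0; apply/eqP; apply: eq_bigr => j _.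
by rewrite ffunE linearZ.
Qed.

Let A' := iext Fgr Fd.

Fact phi'_linear : linear (fun v : iV A' => phi v.2.1 + v.2.2 x0 : R^o).
Proof.
by move=> t u v; rewrite /= linearP !ffunE scalerDr addrACA.
Qed.

(** The component in X ⊗ A corrects [delta]: as [phi w = e], its image under [F] has [X]-component
    -c, which cancels the differential c of [delta]. The [A]-component of that image vanishes
    because [c x0 = 0]. *)
Let w' : iV A' := ([ffun a => - c a *: w], (0, delta)).

Lemma level_step : exists A phi w, @level k.+1 A phi w.
Proof.
exists A', (mklin phi'_linear), w'; split.
- apply: (Sp_iext thS); last exact: (Sp_iext thS DS0 DSd (lv_Sp lv) SX).
  apply: (Sp_isign thS); [by right | apply/(Sp_ishift1 thS)].
  exact/(Sp_itens thS)/lv_Sp/lv.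
- by move=> n [u [al x]] [_ [gal gx]]; exact: (smD (lv_gr lv gal) (Xx0 gx)).
- move=> n [u [al x]] [gu [gal gx]].
  transitivity (phi (- u x0 + iD A al) + ([ffun a => phi (u a)] + (0 + iD X x) : iV X) x0).
    by [].
  rewrite add0r linearD (lv_d lv gal) addr0 linearN ffunE dXx0.
  by rewrite ffunE addr0 addNr.
- split=> [a|]; last by split; [apply: sm0 | apply: delta0].
  rewrite ffunE; case: (c_cases a) => [->|[-> ->]].
    by rewrite oppr0 scale0r; case: ifP => // _; apply: sm0.
  by apply: smZ; rewrite addrK; apply: lv_w0 lv.
- by rewrite /= linear0 add0r ffunE eqxx.
- move=> t kt; congr pair; last congr pair.
  + apply/ffunP => a; rewrite !ffunE; case: ifP => aP; last by rewrite !scaler0.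
    (* The differential of [Q] applied to c gives 0, because c is itself d x0. Only the term with
       [iD A w] remains, and [t * c a] kills words one letter shorter than [t] does. *)
    rewrite [X in _ + X](_ : _ = 0) ?addr0; last first.
      transitivity (\sum_j - (qD (m := Q) a j * qD (m := Q) j x0) *: w).
        by apply: eq_bigr => j _; rewrite ffunE scalerA mulrN.
      by rewrite -scaler_suml sumrN qDD oppr0 scale0r.
    rewrite [iD A _]linearZ /= !scalerA.
    rewrite (_ : _ * _ = sgn R (qdeg a) * (t * c a)); last by ring.
    rewrite -scalerA (lv_kill lv) ?scaler0 //; exact: killsS (c_in a) kt.
  + transitivity (t *: (- ([ffun a => - c a *: w] : iV XA) x0 + iD A 0)); first by [].
    by rewrite ffunE /c row0 oppr0 scale0r linear0 oppr0 addr0 scaler0.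
  + transitivity (t *: ([ffun a => phi (([ffun a => - c a *: w] : iV XA) a)]
      + (0 + iD X delta) : iV X)); first by [].
    rewrite add0r [X in _ *: X](_ : _ = 0) ?scaler0 //.
    apply/ffunP => a; rewrite ffunE d_delta 3!ffunE.
    have -> : phi (- c a *: w) = - c a * e by rewrite linearZ /= (lv_w lv).
    by rewrite mulNr mulrC qDe addNr.
Qed.

End Step.
(** Once all words of length [L] in the entries of d x0 vanish, 1 kills the words of length [L.+1],
    and the vector reached at that level is a cycle. Levels start at 1, hence the successor. *)
Lemma unit_generated : (forall p, nilp (c p)) -> Sp S (icomplex iunit).
Proof.
move=> cn; have [a /mapP[p _ ->] //|L HL] := @nilp_killed _ cs.
have [A [phi [w lv]]] : exists A phi w, @level L.+1 A phi w.
  elim: L {HL} => [|k [A [phi [w lv]]]]; [exact: level1 | exact: level_step lv].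
apply: (Sp_unit_retract (lv_gr lv) (lv_d lv) (lv_w0 lv) (lv_w lv) _ thS (lv_Sp lv)).
rewrite -[LHS]scale1r; apply: (lv_kill lv) => -[//|b s] [sz] sub.
rewrite mul1r big_cons (HL s) ?mulr0 // => x xs.
by apply: sub; rewrite inE xs orbT.
Qed.

End Generation.
End UnitComplex.

(** * Complexes over a local factor *)

Section LocalBasis.
Variables (R : comPzRingType) (e : R).
Hypothesis le : local_idem e.
Let ee : e * e = e. Proof. by case: le. Qed.
Variables (M : lmodType R) (fM : fgp M).

(** A dual basis of e M that may be redundant: the matrix [eta i (y j)] is a projector, not yet the
    identity. *)
Definition dual_family k (y : 'I_k -> M) (eta : 'I_k -> {linear M -> R^o}) : Prop :=
  [/\ forall j, e *: y j = y j, forall j m, e * eta j m = eta j m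
    & forall m, e *: m = m -> m = \sum_j (eta j m : R) *: y j].

Lemma dual_family_ex : exists k y eta, @dual_family k y eta.
Proof.
have [I [x [xi H]]] := fM.
have Hl (j : 'I_#|I|) : linear (fun m => e * xi (enum_val j) m : R^o).
  by move=> a u v; rewrite linearP mulrDr [e * _]mulrCA.
exists #|I|, (fun j => e *: x (enum_val j)), (fun j => mklin (Hl j)); split.
- by move=> j; rewrite scalerA ee.
- by move=> j m; rewrite /= mulrA ee.
move=> m em; rewrite -[LHS]em {1}[m]H scaler_sumr.
rewrite (reindex (@enum_val I I)) /=; last by apply: onW_bij; apply: enum_val_bij.
by apply: eq_bigr => j _; rewrite !scalerA mulrAC ee.
Qed.

(** Expanding [y j] in the family gives a linear relation with coefficients [N l]. If [N i] is
    invertible, [y i] is a combination of the others, and the [eta l] are corrected accordingly. *)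
Lemma dual_family_reduce k (y : 'I_k -> M) eta i j v : dual_family y eta ->
    ((if i == j then e else 0) - eta i (y j)) * v = e ->
  exists y' eta', @dual_family k.-1 y' eta'.
Proof.
move=> [ey eeta H]; set N := fun l => (if l == j then e else 0) - eta l (y j) : R.
move=> Nv.
have eN l : e * N l = N l.
  by rewrite /N mulrBr eeta; case: eqP => _; rewrite ?ee ?mulr0.
have N0 : \sum_l N l *: y l = 0.
  transitivity (e *: y j - \sum_l (eta l (y j) : R) *: y l).
    rewrite (eq_bigr (fun l => (if l == j then e *: y l else 0) - (eta l (y j) : R) *: y l)).
      by rewrite sumrB -big_mkcond big_pred1_eq.
    by move=> l _; rewrite scalerBl; case: eqP => // _; rewrite scale0r.
  by rewrite ey -H ?subrr.
have Hl l : linear (fun m => eta (lift i l) m - v * N (lift i l) * eta i m : R^o).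
  move=> a u w; rewrite !linearP mulrDr opprD addrACA; congr (_ + _).
  by rewrite -[a *: eta i u]/(a * eta i u) mulrCA -mulrBr.
exists (fun l => y (lift i l)), (fun l => mklin (Hl l)); split.
- by move=> l; apply: ey.
- move=> l m /=; rewrite mulrBr eeta; congr (_ - _).
  by rewrite mulrCA eeta.
move=> m em; transitivity (\sum_l (eta l m : R) *: y l - (v * eta i m) *: \sum_l N l *: y l).
  by rewrite N0 scaler0 subr0 -H.
rewrite scaler_sumr -sumrB.
rewrite (bigD1_ord i) //= [X in X + _](_ : _ = 0) ?add0r.
  apply: eq_bigr => l _; rewrite scalerA -scalerBl; congr (_ *: _).
  by rewrite mulrAC.
by rewrite scalerA -scalerBl mulrAC [v * _]mulrC Nv eeta subrr scale0r.
Qed.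

(* For a dual family of minimal length, the idempotent matrix
   [e - (eta i (y j))] has only nilpotent entries, hence it vanishes. *)
Lemma local_basis : exists k (x : nat -> M) (xi : nat -> {linear M -> R^o}),
  [/\ forall j, e *: x j = x j, forall j m, e * xi j m = xi j m,
      forall m, e *: m = m -> m = \sum_(j < k) (xi j m : R) *: x j
    & forall i j, (i < k)%N -> (j < k)%N -> xi i (x j) = if i == j then e else 0].
Proof.
have ex : exists k, `[< exists y eta, @dual_family k y eta >].
  by have [k [y [eta H]]] := dual_family_ex; exists k; apply/asboolP; exists y, eta.
case: (ex_minnP ex) => k /asboolP[y [eta H]] mink.
pose N i j : R := (if i == j then e else 0) - eta i (y j).
have nN i j : nilp (N i j).
  have [_ _ /(_ (N i j))] := le.
  have eN : e * N i j = N i j.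
    by case: H => _ eeta _; rewrite /N mulrBr eeta; case: eqP => _; rewrite ?ee ?mulr0.
  rewrite eN => -[//|[v Nv]].
  have [y' [eta' H']] := dual_family_reduce H Nv.
  have : (k <= k.-1)%N by apply: mink; apply/asboolP; exists y', eta'.
  by rewrite leqNgt prednK ?leqnn ?(leq_ltn_trans _ (ltn_ord i)).
have [ey eeta HM] := H.
(* Expanding [y j] shows that the matrix [eta i (y j)] is idempotent, hence so is its complement
   [N]. *)
have NN i j : N i j = \sum_l N i l * N l j.
  have E : eta i (y j) = \sum_l eta i (y l) * eta l (y j).
    rewrite {1}[y j]HM // linear_sum; apply: eq_bigr => l _.
    by rewrite linearZ /= mulrC.
  transitivity (\sum_l ((if i == l then N l j else 0) -
      (eta i (y l) * (if l == j then e else 0) - eta i (y l) * eta l (y j)))).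
    rewrite !sumrB -E -big_mkcond (big_pred1 i) => [|l]; last by rewrite eq_sym.
    rewrite [X in _ - (X - _)](_ : _ = eta i (y j)) ?subrr ?subr0 //.
    rewrite (bigD1 j) //= eqxx big1 ?addr0 => [|l /negPf ->]; last by rewrite mulr0.
    by rewrite mulrC eeta.
  apply: eq_bigr => l _; rewrite -mulrBr -/(N l j) /N [in RHS]mulrBl; congr (_ - _).
  case: eqP => _; last by rewrite mul0r.
  by rewrite mulrBr eeta; case: eqP => _; rewrite ?ee ?mulr0.
pose cs := [seq N p.1 p.2 | p <- enum (@predT ('I_k * 'I_k)%type)].
have inN i j : N i j \in cs by apply/mapP; exists (i, j); rewrite ?mem_enum.
have [a /mapP[p _ ->] //|L HL] := @nilp_killed _ cs.
(* As N = N N, each entry lies in every power of the ideal generated by the entries; whatever kills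
   one such power kills [N]. *)
have kN m : forall t, kills cs m t -> forall i j, t * N i j = 0.
  elim: m => [|m IH] t kt i j.
    by have := kt [::] erefl; rewrite big_nil mulr1 => ->; rewrite ?mul0r.
  rewrite NN mulr_sumr big1 // => l _; rewrite mulrA IH //; exact: killsS kt.
have N0 i j : N i j = 0.
  rewrite -[LHS]mul1r; apply: (kN L) => s sz sub; rewrite mul1r; exact: HL.
(* Families over [nat] extended by zero: their type is independent of the rank, which will vary with
   the degree. *)
exists k, (fun j => if insub j is Some j' then y j' else 0),
  (fun j => if insub j is Some j' then eta j' else \0); split.
- by move=> j; case: insub => *; rewrite ?ey ?scaler0.
- by move=> j m; case: insub => * /=; rewrite ?eeta ?mulr0.
- by move=> m /HM {1}->; apply: eq_bigr => j _; rewrite !valK.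
move=> i j ik jk; rewrite !insubT.
have /eqP := N0 (Ordinal ik) (Ordinal jk); rewrite subr_eq0 => /eqP <-.
by [].
Qed.

End LocalBasis.

Lemma scale_regE (R : pzRingType) (t x : R) : t *: (x : R^o) = t * x.
Proof. by []. Qed.

Lemma zero_fix (R : pzRingType) (e x : R) : e = 0 -> e * x = x -> x = 0.
Proof. by move=> -> <-; rewrite mul0r. Qed.

Lemma add_ffunE (I : finType) (M : zmodType) (f g : {ffun I -> M}) i : (f + g) i = f i + g i.
Proof. exact: ffunE. Qed.

Lemma sub_ffunE (I : finType) (M : zmodType) (f g : {ffun I -> M}) i : (f - g) i = f i - g i.
Proof. by rewrite add_ffunE; congr (_ + _); apply: ffunE. Qed.

(** * Matrix complexes and Gaussian elimination *)

Section MatrixComplex.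
Variables (R : comPzRingType) (e : R).
Hypothesis ee : e * e = e.
Implicit Types Q : mtx e.

Lemma mcx_grP Q n (v : iV (mcx Q)) : igr (mcx Q) n v <->
  forall k, e * v k = v k /\ (v k <> 0 -> k \in qsupp Q /\ qdeg k = n).
Proof.
split=> H k; have := H k.
  case: ifP => kP; last by move=> ->; split=> //; rewrite mulr0.
  rewrite /=; case: eqP => [/eqP|_ ->]; last by split=> //; rewrite mulr0.
  by rewrite subr_eq0 => /eqP->.
move=> [ev vk]; case: ifP => kP.
  rewrite /=; case: eqP => // nk; apply: contrapT => /vk[_ kn].
  by rewrite kn subrr in nk.
by apply: contrapT => /vk; rewrite kP => -[].
Qed.

Lemma mcx_dE Q (v : iV (mcx Q)) k : iD (mcx Q) v k = \sum_j qD (m := Q) k j * v j.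
Proof.
rewrite ffunE; case: ifP => kP; first by rewrite scaler0 add0r.
rewrite big1 // => j _; rewrite (_ : qD k j = 0) ?mul0r //.
by apply: contrapT => /qDsupp[]; rewrite kP.
Qed.

Lemma iunit_out n (r : R) : n <> 0 -> igr (iunit e) n r -> r = 0.
Proof. by move=> n0 /=; case: eqP. Qed.

Lemma iunit_in n (r : R) : igr (iunit e) n r -> (if n == 0 then e *: (r : R^o) else 0) = r.
Proof. by move=> /=; case: eqP. Qed.

Lemma strictly_perfect_unit : strictly_perfect (icomplex (iunit e)).
Proof.
apply/strictly_perfectP; split.
  exists 0, 0 => n H x; apply: sm_inj; apply: iunit_out (subP x).
  by move=> n0; move: H; rewrite n0 ltxx => -[].
move=> n.
have gr (r : R^o) : igr (iunit e) n (if n == 0 then e *: r else 0).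
  by rewrite /=; case: eqP => // _; rewrite scalerA ee.
have Hl : linear (fun r => mksub (gr r)).
  move=> a x y; apply: sm_inj; rewrite /=; case: eqP => _; last by rewrite scaler0 addr0.
  by rewrite scalerDr !scalerA mulrC.
have Hs : linear (@smval _ _ (igr (iunit e) n)) by [].
apply: (@fgp_retract _ R^o _ (mklin Hl) (mklin Hs)).
  by move=> x; apply: sm_inj; apply: iunit_in (subP x).
have H1 : linear (idfun : R^o -> R^o) by [].
exists unit, (fun=> 1), (fun=> mklin H1) => m.
by rewrite big_const card_unit /= addr0 [RHS]mulr1.
Qed.

Lemma Sp_mcx Q (S : Perf R -> Prop) : thick S ->
  Sp S (icomplex (iunit e)) -> Sp S (icomplex (mcx Q)).
Proof. by move=> thS; apply: Sp_itens. Qed.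

Lemma thick_True : thick (fun _ : Perf R => True).
Proof. by split. Qed.

(** Strict perfection is one half of [Sp], so closure under tensor products, used for the whole
    category, yields it. *)
Lemma strictly_perfect_mcx Q : strictly_perfect (icomplex (mcx Q)).
Proof.
have sU := strictly_perfect_unit.
apply: (@Sp_mcx Q _ thick_True _).1; split=> //.
by exists (strictly_perfect_perfect sU).
Qed.

(* Gaussian elimination of the invertible entry [(p, x0)], for [x0] of minimal
   degree (so that row [x0] vanishes). *)
Section Eliminate.
Variables (Q : mtx e) (x0 p : qI Q) (u : R).
Local Notation D := (qD (m := Q)).
Hypothesis x0P : x0 \in qsupp Q.
Hypothesis row0 : forall j, D x0 j = 0.
Hypothesis Du : D p x0 * u = e.

Let c k := D k x0.

(** Schur complement of the entry [(p, x0)] on an unchanged index type. Rows [x0], [p] and column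
    [x0] vanish by computation and column [p] is reset to 0, so the support can drop both
    indices. *)
Let D' k l := if l == p then 0 else D k l - c k * u * D p l.

Let D'p l : D' p l = 0.
Proof. by rewrite /D'; case: eqP => // _; rewrite Du qDe subrr. Qed.

Let D'x l : D' x0 l = 0.
Proof. by rewrite /D' /c !row0 !mul0r subrr; case: eqP. Qed.

Let D'cx k : D' k x0 = 0.
Proof.
rewrite /D'; case: eqP => // _; rewrite -/(c k) -mulrA [u * _]mulrC Du.
by rewrite mulrC qDe subrr.
Qed.

Let D'cp k : D' k p = 0. Proof. by rewrite /D' eqxx. Qed.

Fact elim_De i j : e * D' i j = D' i j.
Proof.
rewrite /D'; case: eqP => _; first by rewrite mulr0.
by rewrite mulrBr qDe !mulrA qDe.
Qed.

Let D'_nz i j : D' i j <> 0 -> D i j <> 0 \/ (c i <> 0 /\ D p j <> 0).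
Proof.
move=> H; apply: contrapT => /not_orP[/contrapT Dij].
move=> /not_andP[]/contrapT E; apply: H; rewrite /D' Dij E ?mul0r ?mulr0 subr0; by case: eqP.
Qed.

Let pdeg : e <> 0 -> p \in qsupp Q /\ qdeg p = qdeg x0 + 1.
Proof.
move=> e0; have nD : D p x0 <> 0 by move=> E; apply: e0; rewrite -Du E mul0r.
by split; [case: (qDsupp nD) | apply: qDdeg].
Qed.

Fact elim_Ddeg i j : D' i j <> 0 -> qdeg i = qdeg j + 1.
Proof.
move=> H; have e0 : e <> 0 by move=> e0; apply/H/(zero_fix e0)/elim_De.
have [/qDdeg//|[/qDdeg-> /qDdeg E]] := D'_nz H.
by rewrite -(pdeg e0).2.
Qed.

Fact elim_Dsupp i j : D' i j <> 0 ->
  i \in qsupp Q :\ p :\ x0 /\ j \in qsupp Q :\ p :\ x0.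
Proof.
move=> H; have [iP jP] : i \in qsupp Q /\ j \in qsupp Q.
  have [/qDsupp//|[/qDsupp[iP _] /qDsupp[_ jP]]] := D'_nz H; by [].
rewrite !inE iP jP !andbT; split; apply/andP; split; apply/eqP => E; apply: H;
  by rewrite E ?D'x ?D'p ?D'cx ?D'cp.
Qed.

Let sumD i j : \sum_k D i k * D k j = 0. Proof. exact: qDD. Qed.

(* Row [p] of [D'] vanishes, so the column [p] that [D'] discards is irrelevant in a product. *)
Fact elim_DD i j : \sum_k D' i k * D' k j = 0.
Proof.
have [->|jp] := eqVneq j p; first by rewrite big1 // => k _; rewrite D'cp mulr0.
transitivity (\sum_k (D i k - c i * u * D p k) * (D k j - c k * u * D p j)).
  apply: eq_bigr => k _; rewrite {2}/D' (negPf jp) {1}/D'; case: eqP => // ->.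
  by rewrite mul0r Du qDe subrr mulr0.
transitivity (\sum_k D i k * D k j - c i * u * (\sum_k D p k * D k j)
    - (\sum_k D i k * D k x0) * (u * D p j)
    + c i * u * (\sum_k D p k * D k x0) * (u * D p j)).
  rewrite !mulr_sumr !mulr_suml -!sumrB -big_split /=; apply: eq_bigr => k _.
  by rewrite /c; ring.
by rewrite !sumD !mulr0 !mul0r !subr0 addr0.
Qed.

Definition mtx_elim : mtx e :=
  @Mtx R e (qI Q) (qsupp Q :\ p :\ x0) (@qdeg _ _ Q) D' elim_De elim_Ddeg elim_Dsupp elim_DD.

Let V := {ffun qI Q -> R^o}.

(** Subtracts the multiple of d x0 that clears the coordinate [p], then forgets [x0]. *)
Fact elim_f_linear : linear (fun v : V =>
  [ffun k => if (k == x0) || (k == p) then 0 else v k - u * v p * c k : R^o] : V).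
Proof.
move=> t v w; apply/ffunP => k; rewrite !ffunE; case: ifP => _.
  by rewrite scaler0 addr0.
rewrite -![t *: _]/(t * _); ring.
Qed.

(** The [x0]-coordinate is chosen so that the [p]-coordinate of the differential vanishes. *)
Fact elim_g_linear : linear (fun v : V =>
  [ffun k => if k == x0 then - (u * \sum_l D p l * v l) else v k : R^o] : V).
Proof.
move=> t v w; apply/ffunP => k; rewrite !ffunE; case: ifP => _ //.
have -> : \sum_l D p l * (t *: v + w) l = t * (\sum_l D p l * v l) + \sum_l D p l * w l.
  rewrite mulr_sumr -big_split; apply: eq_bigr => l _.
  by rewrite !ffunE scale_regE mulrDr mulrCA.
by rewrite [t *: - _]scale_regE; ring.
Qed.

(** The homotopy inverts the eliminated entry: it sends the basis vector [p] to [u] times [x0]. *)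
Fact elim_h_linear : linear (fun v : V =>
  [ffun k => if k == x0 then u * v p : R^o else 0] : V).
Proof.
move=> t v w; apply/ffunP => k; rewrite !ffunE; case: ifP => _.
  by rewrite -![t *: _]/(t * _) mulrDr mulrCA.
by rewrite scaler0 addr0.
Qed.

Let f : {linear iV (mcx Q) -> iV (mcx mtx_elim)} := mklin elim_f_linear.
Let g : {linear iV (mcx mtx_elim) -> iV (mcx Q)} := mklin elim_g_linear.
Let h : {linear iV (mcx Q) -> iV (mcx Q)} := mklin elim_h_linear.

Let ce k : e * c k = c k. Proof. exact: qDe. Qed.

Let c_nz k : c k <> 0 -> k \in qsupp Q /\ qdeg k = qdeg x0 + 1.
Proof. by move=> H; split; [case: (qDsupp H) | apply: qDdeg]. Qed.

Let eu v k : igr (mcx Q) k v -> forall j, e * v j = v j.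
Proof. by move=> /mcx_grP gv j; case: (gv j). Qed.

Let c0 : c x0 = 0. Proof. exact: row0. Qed.

Fact elim_f_gr n v : igr (mcx Q) n v -> igr (mcx mtx_elim) n (f v).
Proof.
move=> /mcx_grP gv; apply/mcx_grP => k; rewrite ffunE.
case: ifP => [|/norP[kx kp]]; first by rewrite mulr0.
have [[ek vk] [ep vp]] := (gv k, gv p); split.
  by rewrite mulrBr ek [e * (_ * c k)]mulrCA ce.
move=> H; rewrite !inE kx kp.
have [vk0|/vk[]//] := pselect (v k = 0).
have [vp0|/vp[_ vpn]] := pselect (v p = 0).
  by rewrite vk0 vp0 mulr0 mul0r subrr in H.
have [ck0|ck] := pselect (c k = 0); first by rewrite vk0 ck0 mulr0 subrr in H.
have [-> ->] := c_nz ck; split=> //.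
have e0 : e <> 0 by move=> e0; apply/ck/(zero_fix e0)/ce.
by rewrite -(pdeg e0).2.
Qed.

Fact elim_g_gr n v : igr (mcx mtx_elim) n v -> igr (mcx Q) n (g v).
Proof.
move=> /mcx_grP gv; apply/mcx_grP => k; rewrite ffunE.
case: eqP => [->|kx]; last first.
  by have [ek vk] := gv k; split=> // /vk[]; rewrite !inE => /andP[_ /andP[_ ->]].
split.
  have E : e * (\sum_l D p l * v l) = \sum_l D p l * v l.
    by rewrite mulr_sumr; apply: eq_bigr => l _; rewrite mulrA qDe.
  by rewrite mulrN mulrCA E.
move=> H; split=> //.
have [l Hl] : exists l, D p l * v l <> 0.
  apply/existsNP => H0; apply: H; rewrite big1 ?mulr0 ?oppr0 // => l _; exact: H0.
have Dl : D p l <> 0 by move=> E; rewrite E mul0r in Hl.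
have vl : v l <> 0 by move=> E; rewrite E mulr0 in Hl.
have e0 : e <> 0 by move=> e0; apply/Dl/(zero_fix e0)/qDe.
have [_ /(_ vl)[_ <-]] := gv l.
by apply: (addIr 1); rewrite -(pdeg e0).2 (qDdeg Dl).
Qed.

Let mE v k : iD (mcx mtx_elim) v k = \sum_j D' k j * v j.
Proof. exact: mcx_dE. Qed.

Fact elim_f_d n v : igr (mcx Q) n v -> f (iD (mcx Q) v) = iD (mcx mtx_elim) (f v).
Proof.
move=> gv; apply/ffunP => k; rewrite mE ffunE !mcx_dE.
case: ifP => [/orP[]/eqP->|/norP[kx kp]].
- by rewrite big1 // => j _; rewrite D'x mul0r.
- by rewrite big1 // => j _; rewrite D'p mul0r.
pose q j := D k j - c k * u * D p j.
have qc : \sum_j q j * c j = 0.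
  transitivity (\sum_j D k j * D j x0 - c k * u * \sum_j D p j * D j x0).
    rewrite mulr_sumr -sumrB; apply: eq_bigr => j _; rewrite /q /c; ring.
  by rewrite !sumD mulr0 subrr.
have qx : q x0 = 0.
  by rewrite /q -mulrA [u * _]mulrC Du mulrC qDe subrr.
transitivity (\sum_j q j * v j).
  transitivity (\sum_j D k j * v j - c k * u * (\sum_j D p j * v j)); first by ring.
  by rewrite mulr_sumr -sumrB; apply: eq_bigr => j _; rewrite /q; ring.
have E : \sum_j D' k j * f v j = \sum_(j | j != p) q j * (v j - u * v p * c j).
  rewrite [LHS](bigD1 p) //= D'cp mul0r add0r; apply: eq_bigr => j jp.
  rewrite ffunE (negPf jp) orbF /D' (negPf jp) -/(q j).
  by case: eqP => [->|//]; rewrite qx !mul0r.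
rewrite E; apply/eqP; rewrite -subr_eq0 (bigD1 p) //= -addrA -sumrB; apply/eqP.
transitivity (q p * v p + u * v p * (\sum_(j | j != p) q j * c j)).
  by rewrite mulr_sumr; congr (_ + _); apply: eq_bigr => j _; ring.
have -> : \sum_(j | j != p) q j * c j = - (q p * c p).
  by move: qc; rewrite (bigD1 p) //= => /eqP; rewrite addrC addr_eq0 => /eqP.
have -> : u * v p * - (q p * c p) = - (q p * (c p * u * v p)) by ring.
by rewrite Du (eu gv) subrr.
Qed.

Fact elim_g_d n v : igr (mcx mtx_elim) n v -> g (iD (mcx mtx_elim) v) = iD (mcx Q) (g v).
Proof.
move=> /mcx_grP gv; apply/ffunP => k; rewrite mcx_dE ffunE.
have vp : v p = 0.
  by apply: contrapT => /((gv p).2)[]; rewrite !inE eqxx andbF.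
have vx : v x0 = 0.
  by apply: contrapT => /((gv x0).2)[]; rewrite !inE eqxx.
have dE i : iD (mcx mtx_elim) v i = \sum_l (D i l - c i * u * D p l) * v l.
  rewrite mE; apply: eq_bigr => l _; rewrite /D'; case: eqP => // ->.
  by rewrite vp !mulr0.
case: eqP => [->|/eqP kx].
  rewrite [RHS]big1 => [|j _]; last by rewrite row0 mul0r.
  rewrite (eq_bigr (fun l => \sum_m (D p l * D l m - D p l * c l * (u * D p m)) * v m)).
    rewrite exchange_big big1 ?mulr0 ?oppr0 // => m _; rewrite -mulr_suml sumrB -mulr_suml.
    by rewrite !sumD mul0r subrr mul0r.
  move=> l _; rewrite dE mulr_sumr; apply: eq_bigr => m _; ring.
rewrite dE.
transitivity (\sum_l D k l * v l - c k * u * \sum_l D p l * v l).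
  by rewrite mulr_sumr -sumrB; apply: eq_bigr => l _; ring.
rewrite (bigD1 x0) //= vx mulr0 add0r [in RHS](bigD1 x0) //= ffunE eqxx.
have -> : \sum_(j | j != x0) D k j * g v j = \sum_(j | j != x0) D k j * v j.
  by apply: eq_bigr => j jx; rewrite ffunE (negPf jx).
by rewrite /c; ring.
Qed.

Fact elim_h_gr n v : igr (mcx Q) (n + 1) v -> igr (mcx Q) n (h v).
Proof.
move=> gv; have ev := eu gv; move/mcx_grP: gv => gv.
apply/mcx_grP => k; rewrite ffunE; case: eqP => [->|_]; last by rewrite mulr0; split.
split; first by rewrite mulrCA ev.
move=> H; split=> //.
have vp : v p <> 0 by move=> E; rewrite E mulr0 in H.
have e0 : e <> 0 by move=> e0; apply/vp/(zero_fix e0)/ev.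
have [_ /(_ vp)[_ E]] := gv p.
by apply: (addIr 1); rewrite -(pdeg e0).2.
Qed.

Fact elim_fg n v : igr (mcx mtx_elim) n v -> f (g v) = v.
Proof.
move=> /mcx_grP gv; apply/ffunP => k; rewrite ffunE.
have vp : v p = 0.
  by apply: contrapT => /((gv p).2)[]; rewrite !inE eqxx andbF.
have vx : v x0 = 0.
  by apply: contrapT => /((gv x0).2)[]; rewrite !inE eqxx.
case: ifP => [/orP[]/eqP->//|/norP[kx kp]]; rewrite !ffunE (negPf kx).
case: eqP => [px|_]; last by rewrite vp mulr0 mul0r subr0.
have -> : c k = 0 by rewrite -ce -Du px row0 !mul0r.
by rewrite mulr0 subr0.
Qed.

Fact elim_gf n v : igr (mcx Q) n v -> v - g (f v) = iD (mcx Q) (h v) + h (iD (mcx Q) v).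
Proof.
move=> gv; have ev := eu gv.
apply/ffunP => k; rewrite [LHS]sub_ffunE [RHS]add_ffunE.
have -> : iD (mcx Q) (h v) k = c k * (u * v p).
  rewrite mcx_dE (bigD1 x0) //= ffunE eqxx big1 ?addr0 // => j /negPf jx.
  by rewrite ffunE jx mulr0.
rewrite [h _ _]ffunE mcx_dE [g _ _]ffunE; case: eqP => [->|kx].
  rewrite c0 mul0r add0r opprK.
  have Dpp : D p p = 0 by apply: qDdeg0; lia.
  have -> : \sum_l D p l * f v l = \sum_l D p l * v l - D p x0 * v x0.
    transitivity (\sum_l (D p l * v l - u * v p * (D p l * D l x0)
        - (if l == x0 then D p x0 * v x0 else 0))).
      apply: eq_bigr => l _; rewrite ffunE.
      case: eqP => [->|_] /=; first by rewrite row0; ring.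
      by case: eqP => [->|_]; rewrite /c ?Dpp; ring.
    rewrite !sumrB -mulr_sumr sumD mulr0 subr0; congr (_ - _).
    by rewrite -big_mkcond big_pred1_eq.
  by rewrite mulrBr mulrA [u * D p x0]mulrC Du ev; ring.
rewrite addr0 [f v k]ffunE; case: ifP => [/orP[/eqP//|/eqP->]|_].
  by rewrite subr0 mulrA Du ev.
by ring.
Qed.

Lemma elim_isomorphic :
  @isomorphic (homotopyCat R) (icomplex (mcx Q)) (icomplex (mcx mtx_elim)).
Proof.
have F1 n x : submap (f := f) (@elim_f_gr (n + 1)) (cdiff (icomplex (mcx Q)) n x) =
    cdiff (icomplex (mcx mtx_elim)) n (submap (@elim_f_gr n) x).
  by apply: sm_inj; apply: elim_f_d (subP x).
have G1 n x : submap (f := g) (@elim_g_gr (n + 1)) (cdiff (icomplex (mcx mtx_elim)) n x) =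
    cdiff (icomplex (mcx Q)) n (submap (@elim_g_gr n) x).
  by apply: sm_inj; apply: elim_g_d (subP x).
pose F := @ChainMap R (icomplex (mcx Q)) (icomplex (mcx mtx_elim))
  (fun n => submap (@elim_f_gr n)) F1.
pose G := @ChainMap R (icomplex (mcx mtx_elim)) (icomplex (mcx Q))
  (fun n => submap (@elim_g_gr n)) G1.
exists F, G; split; last first.
  by apply: homotopic_eq => n x; apply: sm_inj; apply: elim_fg (subP x).
exists (fun n => \- (submap (f := h) (@elim_h_gr n))) => n x.
apply: sm_inj; transitivity (- (smval x - g (f (smval x)))); first by rewrite opprB.
by rewrite (elim_gf (subP x)) opprD -linearN.
Qed.

End Eliminate.
End MatrixComplex.

(** * Dichotomy for finite free complexes over a local factor *)

Section Reduction.
Variables (R : comPzRingType) (e : R).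
Hypothesis le : local_idem e.
Let ee : e * e = e. Proof. by case: le. Qed.
Implicit Types Q : mtx e.

Definition pivot Q (x0 : qI Q) : Prop :=
  [/\ x0 \in qsupp Q, forall j, qD (m := Q) x0 j = 0
    & forall p, nilp (qD (m := Q) p x0)].

(** Locality makes each entry in the column of a lowest [x0] nilpotent or invertible. Eliminating an
    invertible one shrinks the support within the same isomorphism class. *)
Lemma mtx_reduce Q : exists Q',
  @isomorphic (derivedCat R) (icomplex (mcx Q)) (icomplex (mcx Q')) /\
  (qsupp Q' = finset.set0 \/ exists x0 : qI Q', pivot x0).
Proof.
have [k Qk] := ubnP #|qsupp Q|; elim: k => // k IH in Q Qk *.
have refl : @isomorphic (derivedCat R) (icomplex (mcx Q)) (icomplex (mcx Q)).
  by exists (idm (icomplex (mcx Q) : derivedCat R)); apply: lid_iso.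
have [P0|[a aP]] := set_0Vmem (qsupp Q); first by exists Q; split=> //; left.
case: (@arg_minP _ _ _ a (mem (qsupp Q)) (fun b => qdeg b) aP) => x0 x0P minx.
have {}x0P : x0 \in qsupp Q := x0P.
have row0 j : qD (m := Q) x0 j = 0.
  apply: contrapT => H; have := qDdeg H; have [_ jP] := qDsupp H.
  by have := minx j jP; lia.
have [np|/existsNP[p np]] := pselect (forall p, nilp (qD (m := Q) p x0)).
  by exists Q; split=> //; right; exists x0.
have [_ _ /(_ (qD (m := Q) p x0))] := le; rewrite qDe => -[//|[u Du]].
have [Q' [iQ' HQ']] : exists Q', @isomorphic (derivedCat R)
    (icomplex (mcx (mtx_elim row0 Du))) (icomplex (mcx Q')) /\
    (qsupp Q' = finset.set0 \/ exists x0 : qI Q', pivot x0).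
  apply: IH; rewrite /= -ltnS (leq_trans _ Qk) // ltnS.
  rewrite [X in (_ < X)%N](cardsD1 x0) x0P add1n ltnS subset_leq_card //.
  by apply: finset.setSD; apply: subD1set.
exists Q'; split=> //; apply: disomorphic_trans iQ'.
have [f fi] := elim_isomorphic x0P row0 Du.
by exists (lemb _ f); apply: lemb_iso.
Qed.

Lemma mcx_dichotomy Q :
  @null R (icomplex (mcx Q)) \/
  forall S, thick S -> Sp S (icomplex (mcx Q)) <-> Sp S (icomplex (iunit e)).
Proof.
have [Q' [iQ [P0|[x0 [x0P row0 np]]]]] := mtx_reduce Q.
  left; apply: (null_iso (isomorphic_sym iQ)).
  apply: lheq_emb; apply: homotopic_eq => n v; apply: sm_inj; apply/ffunP => i.
  have /mcx_grP/(_ i)[_ Hi] := subP v.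
  by rewrite /= ffunE; apply: contrapT => /Hi[]; rewrite P0 inE.
right=> S thS; split=> [[sQ SQ]|]; last exact: Sp_mcx.
have SQ' : Sp S (icomplex (mcx Q')).
  by split; [apply: strictly_perfect_mcx | apply: inS_diso iQ SQ].
pose d := qdeg x0.
(* Degrees are translated so that [x0] gets degree 0, where [iunit] is concentrated. *)
pose Q0 := @Mtx R e (qI Q') (qsupp Q') (fun i => qdeg i - d) (@qD _ _ Q') (@qDe _ _ Q')
  (fun i j H => etrans (congr1 (fun z => z - d) (qDdeg H)) (addrAC _ _ _))
  (@qDsupp _ _ Q') (@qDD _ _ Q').
have SQ0 : Sp S (icomplex (mcx Q0)).
  have := (Sp_ishift thS d (mcx Q')).2 SQ'.
  apply: (@Sp_transfer _ _ thS (ishift d (mcx Q')) (mcx Q0) idfun idfun) => //.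
  - move=> n v /mcx_grP gv; apply/mcx_grP => i; have [ei Hi] := gv i; split=> // /Hi[iP id].
    by split=> //=; rewrite id addrK.
  - move=> n v /mcx_grP gv; apply/mcx_grP => i; have [ei Hi] := gv i; split=> // /Hi[iP /= <-].
    by split=> //=; rewrite subrK.
  - move=> n v _; apply/ffunP => i; rewrite [RHS](mcx_dE (Q := Q0)).
    exact: (mcx_dE (Q := Q')).
exact: (@unit_generated R e ee Q0 S thS SQ0 x0 x0P (subrr _) row0 np).
Qed.

End Reduction.

(** * Strictly perfect complexes as matrix complexes *)

Section Representation.
Variables (R : comPzRingType) (e : R).
Hypothesis le : local_idem e.
Let ee : e * e = e. Proof. by case: le. Qed.
Variable P : complex R.
Hypothesis sP : strictly_perfect P.

Let inrange (a : int) (w : nat) (n : int) : bool := (a <= n) && (n < a + w%:Z).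

(** The uniform bounds [w] on the degrees and [K] on the ranks allow one finite product type to
    index the basis vectors of all degrees. *)
Lemma graded_basis : exists (a : int) (w K : nat) (k : int -> nat)
    (x : forall n : int, nat -> P n) (xi : forall n : int, nat -> {linear P n -> R^o}),
  [/\ forall n, ~~ inrange a w n -> k n = 0%N, forall n, (k n <= K)%N,
      forall n j, e *: x n j = x n j, forall n j m, e * xi n j m = xi n j m &
      (forall n m, e *: m = m -> m = \sum_(j < k n) (xi n j m : R) *: x n j) /\
      (forall n i j, (i < k n)%N -> (j < k n)%N -> xi n i (x n j) = if i == j then e else 0)].
Proof.
have [[a [b B]] F] := (strictly_perfectP P).1 sP.
have H n : exists t : nat * (nat -> P n) * (nat -> {linear P n -> R^o}),
  [/\ forall j, e *: t.1.2 j = t.1.2 j, forall j m, e * t.2 j m = t.2 j m,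
      forall m, e *: m = m -> m = \sum_(j < t.1.1) (t.2 j m : R) *: t.1.2 j
    & forall i j, (i < t.1.1)%N -> (j < t.1.1)%N -> t.2 i (t.1.2 j) = if i == j then e else 0].
  by have [k [x [xi Hx]]] := local_basis le (F n); exists (k, x, xi).
pose t n := sval (cid (H n)); have Ht n := svalP (cid (H n)).
pose w := `|b - a|.+1%N.
have out n : ~~ inrange a w n -> forall m : P n, m = 0.
  by move=> Hn; apply: B; move: Hn; rewrite /inrange /w; lia.
pose k n := if inrange a w n then (t n).1.1 else 0%N.
exists a, w, (\max_(s < w) k (a + s%:Z)%R), k, (fun n => (t n).1.2), (fun n => (t n).2).
split; last split.
- by move=> n /negPf nr; rewrite /k nr.
- move=> n; have [r|nr] := boolP (inrange a w n); last by rewrite /k (negPf nr).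
  have sw : (`|n - a| < w)%N by move: r; rewrite /inrange /w; lia.
  have -> : n = a + (Ordinal sw)%:Z by move: r; rewrite /inrange /=; lia.
  exact: (leq_bigmax (F := fun s : 'I_w => k (a + s%:Z)%R)).
- by move=> n; case: (Ht n).
- by move=> n; case: (Ht n).
- move=> n m em; rewrite /k; case: ifP => [_|/negbT nr]; first by case: (Ht n) => _ _ /(_ m em).
  by rewrite big_ord0; apply: out nr m.
- by move=> n i j; rewrite /k; case: ifP => // _; case: (Ht n) => _ _ _; apply.
Qed.

Lemma idem_part_matrix : exists (Q : mtx e) f g,
  @chain_iso R (idem_part e P) (icomplex (mcx Q)) f g.
Proof.
have [a [w [K [k [x [xi [k0 kK ex exi [dec ort]]]]]]]] := graded_basis.
pose I : finType := ('I_w * 'I_K)%type.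
pose deg (i : I) : int := a + i.1%:Z.
pose supp : {set I} := finset.finset (fun i : I => (i.2 < k (deg i))%N).
pose F n s t : R := xi (n + 1) s (cdiff P n (x n t)).
pose D i j : R := if [&& i \in supp, j \in supp & deg i == deg j + 1]
  then F (deg j) i.2 j.2 else 0.
(* Passes from the common index type to the rank of a single degree, where [dec] applies. *)
have sumI (V : zmodType) n (G : nat -> V) :
    \sum_(i | (i \in supp) && (deg i == n)) G i.2 = \sum_(t < k n) G t.
  have [r|nr] := boolP (inrange a w n); last first.
    rewrite (k0 n nr) big_ord0 big_pred0 // => -[s t]; apply/negP => /andP[_ /eqP dn].
    by move: nr; rewrite -dn /inrange /deg /=; have := ltn_ord s; lia.
  have sw : (`|n - a| < w)%N by move: r; rewrite /inrange; lia.
  pose T s t := if ((s, t) \in supp) && (deg (s, t) == n) then G t else 0.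
  rewrite big_mkcond (eq_bigr (fun i => T i.1 i.2)); last by case.
  rewrite -(pair_bigA _ T) /= (bigD1 (Ordinal sw)) //= [X in _ + X]big1 ?addr0; last first.
    move=> s; rewrite -val_eqE /= => /eqP sn; rewrite big1 // => t _; rewrite /T /deg /=.
    case: ifP => // /andP[_ /eqP E]; case: sn; move: E; lia.
  rewrite (big_ord_widen K) // [RHS]big_mkcond; apply: eq_bigr => t _.
  rewrite /T inE; have -> : deg (Ordinal sw, t) = n; last by rewrite eqxx andbT.
  by move: r; rewrite /inrange /deg /=; lia.
have De i j : e * D i j = D i j by rewrite /D; case: ifP => _; rewrite ?exi ?mulr0.
have Ddeg i j : D i j <> 0 -> deg i = deg j + 1.
  by rewrite /D; case: ifP => // /and3P[_ _ /eqP].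
have Dsupp i j : D i j <> 0 -> i \in supp /\ j \in supp.
  by rewrite /D; case: ifP => // /and3P[].
have Dsum n (i : I) (G : I -> R) : i \in supp -> deg i = n + 1 ->
    \sum_j D i j * (if (j \in supp) && (deg j == n) then G j else 0) =
    \sum_(j | (j \in supp) && (deg j == n)) F n i.2 j.2 * G j.
  move=> iP dn; rewrite [RHS]big_mkcond; apply: eq_bigr => j _.
  case: ifP => [/andP[jP /eqP jn]|_]; last by rewrite mulr0.
  by rewrite /D iP jP dn jn eqxx.
have FE n s (m : P n) : e *: m = m ->
    xi (n + 1) s (cdiff P n m) = \sum_(t < k n) F n s t * xi n t m.
  move=> em; rewrite {1}[m]dec // !linear_sum; apply: eq_bigr => t _.
  by rewrite !linearZ /= mulrC.
have DD i j : \sum_l D i l * D l j = 0.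
  have [iP|iP] := boolP (i \in supp); last first.
    by rewrite big1 // => l _; rewrite {1}/D (negPf iP) mul0r.
  have [jP|jP] := boolP (j \in supp); last first.
    by rewrite big1 // => l _; rewrite {2}/D (negPf jP) andbF mulr0.
  have [di|/eqP di] := eqVneq (deg i) (deg j + 1 + 1); last first.
    rewrite big1 // => l _; rewrite /D; case: ifP => [/and3P[_ _ /eqP E]|_]; last by rewrite mul0r.
    case: ifP => [/and3P[_ _ /eqP E']|_]; last by rewrite mulr0.
    by case: di; rewrite E E'.
  transitivity (\sum_l D i l * (if (l \in supp) && (deg l == deg j + 1)
      then F (deg j) l.2 j.2 else 0)).
    by apply: eq_bigr => l _; rewrite {2}/D jP.
  rewrite (Dsum (deg j + 1)) //.
  (* The product of two consecutive matrices computes the coordinates of d d applied to a basis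
     vector. *)
  rewrite (sumI _ _ (fun t => F (deg j + 1) i.2 t * F (deg j) t j.2)).
  by rewrite -FE ?cdiffK ?linear0 // -linearZ ex.
pose Q := Mtx De Ddeg Dsupp DD.
have thgr n (p : P n) : igr (mcx Q) n
    [ffun i : I => if (i \in supp) && (deg i == n) then xi n i.2 p else 0].
  apply/mcx_grP => i; rewrite ffunE; case: ifP => [/andP[iP /eqP di]|_]; last first.
    by rewrite mulr0; split.
  by rewrite exi; split.
have psgr n (v : {ffun I -> R^o}) : fixm e (P n)
    (\sum_(i | (i \in supp) && (deg i == n)) (v i : R) *: x n i.2).
  by apply: sm_sum => i _; rewrite /= scalerA mulrC -scalerA ex.
have thl n : linear (fun p : idem_part e P n => mksub (thgr n (smval p)) : icomplex (mcx Q) n).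
  move=> t p q; apply: sm_inj; apply/ffunP => i; rewrite /= !ffunE.
  by case: ifP => _; rewrite ?linearP // scaler0 addr0.
have psl n : linear (fun v : icomplex (mcx Q) n => mksub (psgr n (smval v)) : idem_part e P n).
  move=> t u v; apply: sm_inj; rewrite /= scaler_sumr -big_split; apply: eq_bigr => i _.
  by rewrite /= !ffunE scalerDl scalerA.
exists Q, (fun n => mklin (@thl n)), (fun n => mklin (@psl n)); split=> n.
- move=> p; apply: sm_inj; apply/ffunP => i; rewrite [RHS](mcx_dE (Q := Q)) /= ffunE.
  have -> : \sum_j D i j * [ffun i : I => if (i \in supp) && (deg i == n)
      then xi n i.2 (smval p) else 0] j =
      \sum_j D i j * (if (j \in supp) && (deg j == n) then xi n j.2 (smval p) else 0).
    by apply: eq_bigr => j _; rewrite ffunE.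
  case: ifP => [/andP[iP /eqP di]|ni].
    rewrite (Dsum n) // (sumI _ _ (fun t => F n i.2 t * xi n t (smval p))) -FE //.
    exact: (subP p).
  rewrite big1 // => j _; case: ifP => [/andP[jP /eqP jn]|_]; last by rewrite mulr0.
  rewrite /D; case: ifP => [/and3P[iP _ /eqP di]|_]; last by rewrite mul0r.
  by rewrite iP di jn eqxx in ni.
- move=> p; apply: sm_inj; rewrite /= [RHS]dec; last exact: (subP p).
  rewrite -(sumI _ _ (fun t => (xi n t (smval p) : R) *: x n t)).
  by apply: eq_bigr => i iP; rewrite ffunE iP.
- move=> v; apply: sm_inj; apply/ffunP => i; rewrite /= ffunE.
  have /mcx_grP/(_ i)[ei vi] := subP v.
  case: ifP => [/andP[iP /eqP di]|ni]; last first.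
    by apply/esym; apply: contrapT => /vi[iP di]; move/negP: ni; apply; apply/andP; split=> //; apply/eqP.
  rewrite linear_sum (bigD1 i) /=; last by rewrite iP di eqxx.
  move: iP; rewrite inE di => iP.
  rewrite linearZ /= ort // eqxx [_ *: _]mulrC ei big1 ?addr0 // => j.
  rewrite inE => /andP[/andP[jP /eqP dj] ji].
  rewrite dj in jP; rewrite linearZ /= ort //; case: eqP => [E|_]; last by rewrite scaler0.
  case/eqP: ji; move: di dj E; rewrite /deg; case: (i) => [i1 i2]; case: (j) => [j1 j2] /=.
  by move=> d1 d2 E; congr pair; apply: val_inj => //=; lia.
Qed.

End Representation.

Lemma idem_dichotomy (R : comPzRingType) (e : R) (P : complex R) :
  local_idem e -> strictly_perfect P ->
  @null R (idem_part e P) \/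
  forall S, thick S -> Sp S (idem_part e P) <-> Sp S (icomplex (iunit e)).
Proof.
move=> le sP; have [Q [f [g fg]]] := idem_part_matrix le sP.
have gf : @chain_iso R (icomplex (mcx Q)) (idem_part e P) g f.
  have [fd fK gK] := fg; split=> // i x.
  by rewrite -(fK (i + 1) (cdiff _ i _)) fd gK.
have [Q0|HQ] := mcx_dichotomy le Q; [left|right=> S thS].
  exact: null_iso (chain_iso_diso gf) Q0.
apply: iff_trans (HQ S thS).
by split; [apply: Sp_iso thS _ _ _ _ fg | apply: Sp_iso thS _ _ _ _ gf].
Qed.

(** * Composition series *)

(** The zero endomorphism of [P] has a cone in [N], so it becomes invertible; an invertible zero map
    forces the identity to vanish. *)
Lemma verdier_zero (T : triCat) (N : T -> Prop) (X P Z : T) g h :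
  isomorphic X P -> @dist T P P Z (zerom P P) g h -> N Z ->
  @is_zero (verdier T N) X.
Proof.
move=> [f [f' [ff' _]]] d NZ; apply: lid_zero.
apply: (@localization_null_retract _ (@cone_in T N) X P (lemb _ f) (lemb _ f')).
  by apply: lheq_trans (lheq_sym (lemb_comp _ _ _)) (lheq_emb _ ff').
have W0 : cone_in N (zerom P P) by exists Z, g, h.
by apply: lheq_trans (lheq_sym (lcompVl W0)) (lcomp_zero P (linv W0)).
Qed.

(* Thick subcategories of [T] correspond to subsets of ['I_n]: the support [U]
   of [X] decides membership of [X], and the [H j] detect the generators [E i]. *)
Section Classified.
Variables (T : triCat) (n : nat) (E : 'I_n -> T) (H : 'I_n -> cohfun T).
Hypothesis HE : forall i j, cker (H j) (E i) <-> i <> j.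
Hypothesis support : forall X : T, exists U : 'I_n -> Prop,
  (forall S, thick S -> (S X <-> forall i, U i -> S (E i))) /\
  ((forall i, ~ U i) -> is_zero X).
(** [triCat] records data without axioms; this hypothesis and the next stand for the instances
    required. [P] is a model of [X] whose cones are explicit. *)
Hypothesis zero_cone : forall X : T, exists P Z g h,
  isomorphic X P /\ @dist T P P Z (zerom P P) g h.
Hypothesis addm_swap : forall (X Y : T) (f g h : hom X Y), addm f g ≈ h -> addm g f ≈ h.

Lemma is_zero_cker (C : shiftCat) (c : shfun C) (X : C) : is_zero X -> cker c X.
Proof. by move=> /(_ X)[+ _] => /(_ (idm X)); apply: cker_is_zero. Qed.

Arguments is_zero_cker {C} c {X} _.

(** [cker (H j)] is itself thick, and testing it against the support shows that [H j] kills [X]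
    exactly when [j] is outside the support. So [S] is the intersection of the kernels attached to
    the generators it misses. *)
Lemma thick_ckerE (S : T -> Prop) : thick S ->
  forall X, S X <-> forall j, ~ S (E j) -> cker (H j) X.
Proof.
move=> thS X; have [U [HU _]] := support X.
have cU j : cker (H j) X <-> ~ U j.
  apply: iff_trans (HU _ (cker_thick (H j))) _; split.
    by move=> Hj Uj; have /HE := Hj j Uj; apply.
  by move=> nU i Ui; apply/HE => ij; apply: nU; rewrite -ij.
apply: iff_trans (HU S thS) _; split=> [HS j nS|HS i Ui].
  by apply/cU => /HS.
by apply: contrapT => /HS/cU.
Qed.

Section Quotient.
Variables S1 S2 : thickSub T.
Hypothesis S12 : forall X, S1 X -> S2 X.

Let V := verdier (thickCat S2) (fun X => S1 (sval X)).

Section CkerQuotient.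
Variable j : 'I_n.
Hypothesis S1j : ~ S1 (E j).

Let c2 := full_cohfun (H j) (fun X => (thick_shift (tsetP S2) X).2).

Fact S1_cker (X : thickCat S2) : S1 (sval X) -> cker c2 X.
Proof. by move/(thick_ckerE (tsetP S1)) => /(_ j S1j). Qed.

(** As [S1] misses [E j], it lies in the kernel of [H j], which therefore descends. *)
Definition quotient_cohfun : cohfun V := verdier_cohfun S1_cker.

End CkerQuotient.

(** On the quotient, the kernel of [H j] omits [E j]. For i different from j it would contain [E i],
    which is nonzero since [H i] descends too; simplicity forbids this. *)
Lemma simple_quotient_uniq i j : simple V ->
  S2 (E i) -> ~ S1 (E i) -> S2 (E j) -> ~ S1 (E j) -> i = j.
Proof.
move=> [_ sV] S2i S1i S2j S1j; apply: contrapT => ij.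
have [Z|A] := sV _ (cker_thick (quotient_cohfun S1j)).
  have /Z/(is_zero_cker (quotient_cohfun S1i)) :
      cker (quotient_cohfun S1j) (exist _ (E i) S2i : V) by apply/HE.
  by move=> /HE.
by have := A (exist _ (E j) S2j); move=> /HE.
Qed.

Lemma is_zero_quotient (X : V) : S1 (sval X) -> is_zero X.
Proof.
case: X => X S2X /= S1X; have [P [Z [g [h [XP d]]]]] := zero_cone X.
have S1P : S1 P := thick_iso (tsetP S1) XP S1X.
have S1Z : S1 Z := thick_cone (tsetP S1) d S1P S1P.
exact: (@verdier_zero (thickCat S2) _ (exist _ X S2X) (exist _ P (S12 S1P))
  (exist _ Z (S12 S1Z)) g h XP d S1Z).
Qed.

Section Pullback.
Variables (U : V -> Prop) (thU : thick U).

(** Preimage in [T] of a thick subcategory of the quotient, so that [thick_ckerE] applies to it. *)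
Definition pullback (X : T) : Prop := exists p : S2 X, U (exist _ X p).

Lemma pullbackE X (p : S2 X) : pullback X <-> U (exist _ X p).
Proof. by split=> [[q]|Up]; [rewrite (Prop_irrelevance p q) | exists p]. Qed.

Lemma pullback_thick : thick pullback.
Proof.
pose tS2 := tsetP S2; split.
- move=> X X0; have p := thick_zero tS2 X0; exists p; apply: (thick_zero thU).
  by apply: lid_zero; apply: lheq_emb; apply: (X0 X).1.
- move=> X Y XY [p Up]; have q := thick_iso tS2 XY p; exists q.
  apply: (thick_iso thU _ Up); case: XY => f fi.
  exists (lemb (@cone_in (thickCat S2) _) (f : @hom (thickCat S2) (exist _ X p) (exist _ Y q))).
  exact: (@lemb_iso (thickCat S2) _ (exist _ X p) (exist _ Y q)).
- move=> X; split=> [[p Up]|[p Up]].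
    have q := (thick_shift tS2 X).1 p; exists q.
    apply/(thick_shift thU (exist _ X q)).
    exact: (pullbackE ((thick_shift tS2 X).2 (svalP (exist _ X q)))).1 (ex_intro _ p Up).
  exists ((thick_shift tS2 X).2 (svalP (exist _ X p))).
  exact: (thick_shift thU (exist _ X p)).2 Up.
- move=> X Y Z f g h d [p Up] [q Uq]; have r := thick_cone tS2 d p q; exists r.
  apply: (thick_cone thU _ Up Uq).
  exact: (@verdier_dist (thickCat S2) _ (exist _ X p) (exist _ Y q) (exist _ Z r) f g h d).
- move=> X Y Z dXYZ [p Up]; have q := thick_summand tS2 dXYZ p.
  (* The complementary summand must also lie in [S2] for the direct sum to make sense in the
     quotient. *)
  have dYXZ : is_direct_sum Y X Z.
    case: dXYZ => [i [j [s [t [H1 H2 H3 H4 H5]]]]].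
    by exists j, i, t, s; split=> //; apply: addm_swap.
  have r := thick_summand tS2 dYXZ p.
  exists q; apply: (thick_summand thU _ Up).
  exact: (@lemb_direct_sum (thickCat S2) _ (exist _ X q) (exist _ Y r) (exist _ Z p)).
Qed.
End Pullback.

(** A thick [U] pulls back to a thick subcategory between [S1] and [S2], whose generators differ by
    [E j] alone; whether it contains [E j] decides which of the two it is. *)
Lemma simple_quotient j : S2 (E j) -> ~ S1 (E j) ->
  (forall i, S2 (E i) -> i <> j -> S1 (E i)) -> simple V.
Proof.
move=> S2j S1j uniq; split.
  exists (exist _ (E j) S2j) => /(is_zero_cker (quotient_cohfun S1j)) /HE; exact.
move=> U thU; have tP := pullback_thick thU.
have PE X : pullback U X <-> _ := thick_ckerE tP X.
have sub X : S1 X -> pullback U X.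
  by move=> S1X; exists (S12 S1X); apply/(thick_zero thU)/is_zero_quotient.
have [Uj|nUj] := pselect (pullback U (E j)); [right=> -[X p]|left=> -[X p]].
  apply/(pullbackE U p)/PE => i nUi.
  apply: ((thick_ckerE (tsetP S2) X).1 p) => S2i; apply: nUi.
  by have [->//|ij] := pselect (i = j); apply/sub/uniq.
split=> [UX|]; last exact: thick_zero thU _.
apply: is_zero_quotient => /=; apply/(thick_ckerE (tsetP S1)) => i S1i.
have /PE : pullback U X by exists p.
apply=> -[S2i Ui]; have [ij|ij] := pselect (i = j).
  by apply: nUj; rewrite -ij; exists S2i.
by apply: S1i; apply: uniq.
Qed.

End Quotient.

Lemma composition_series_length m (S : nat -> thickSub T) :
  composition_series m S -> m = n.
Proof.
move=> [S0 Sm Sstep Ssimple].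
pose A k : {set 'I_n} := finset.finset (fun i => `[< S k (E i) >]).
have AP k i : reflect (S k (E i)) (i \in A k) by rewrite inE; apply: asboolP.
(* Strict inclusion provides a new generator and simplicity excludes a second one. *)
have cA k : (k <= m)%N -> #|A k| = k.
  elim: k => [_|k IH km].
    apply: eq_card0 => i; apply/AP => /S0/(is_zero_cker (H i))/HE; exact.
  have [sub [X [SX nSX]]] := Sstep k km.
  have [j [Sj nSj]] : exists j, S k.+1 (E j) /\ ~ S k (E j).
    apply: contrapT => nj; apply: nSX; apply/(thick_ckerE (tsetP _)) => j nSj.
    apply: ((thick_ckerE (tsetP _) X).1 SX) => Sj; apply: nj; by exists j.
  have -> : A k.+1 = j |: A k.
    apply/setP => i; rewrite !inE; apply/asboolP/orP => [Si|[/eqP->//|/asboolP/sub//]].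
    have [Ski|nSki] := pselect (S k (E i)); first by right; apply/asboolP.
    by left; apply/eqP; apply: (simple_quotient_uniq (Ssimple k km)).
  by rewrite cardsU1 IH ?(ltnW km) // (introF (AP k j) nSj).
rewrite -(cA m) // -[RHS]card_ord; by apply: eq_card => i; apply/AP/Sm.
Qed.

(** Cut out by kernels rather than generated, so that thickness is inherited from [cker_thick]. *)
Definition filtration (k : nat) : thickSub T.
Proof.
exists (fun X => forall j : 'I_n, (k <= j)%N -> cker (H j) X).
split.
- by move=> X X0 j _; apply: is_zero_cker.
- by move=> X Y XY HX j kj; exact: (thick_iso (cker_thick (H j)) XY (HX j kj)).
- by move=> X; split=> HX j kj; apply/(thick_shift (cker_thick (H j)))/HX.
- move=> X Y Z f g h d HX HY j kj.
  exact: (thick_cone (cker_thick (H j)) d (HX j kj) (HY j kj)).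
- by move=> X Y Z d HZ j kj; exact: (thick_summand (cker_thick (H j)) d (HZ j kj)).
Defined.

Lemma filtrationE k i : filtration k (E i) <-> (i < k)%N.
Proof.
split=> [HE'|ik j kj]; last by apply/HE => ij; rewrite -ij leqNgt ik in kj.
by rewrite ltnNge; apply/negP => /HE'/HE; apply.
Qed.

Lemma filtration_series : composition_series n filtration.
Proof.
split.
- move=> X; split=> [HX|X0 j _]; last exact: is_zero_cker.
  have [U [HU]] := support X; apply=> i Ui.
  have := (HU _ (cker_thick (H i))).1 (HX i (leq0n i)) i Ui.
  by move=> /HE.
- by move=> X j nj; have := ltn_ord j; rewrite ltnNge nj.
- move=> k kn; split=> [X HX j kj|]; first by apply: HX; apply: ltnW.
  exists (E (Ordinal kn)); split; first exact/filtrationE.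
  by move/filtrationE; rewrite ltnn.
- move=> k kn; apply: (@simple_quotient _ _ _ (Ordinal kn)).
  + by move=> X HX j kj; apply: HX; apply: ltnW.
  + exact/filtrationE.
  + by move/filtrationE; rewrite ltnn.
  move=> i /filtrationE; rewrite ltnS leq_eqVlt => /orP[/eqP ik|ik] ne; last exact/filtrationE.
  by case: ne; apply: val_inj.
Qed.

Lemma classified_ell : ell T = Some n.
Proof.
rewrite /ell; case: pselect => [ex|nex]; last first.
  by case: nex; exists n; apply/asboolP; exists filtration; apply: filtration_series.
by case: ex_minnP => m /asboolP[S /composition_series_length ->].
Qed.

Lemma classified_JD : JD T.
Proof.
split; first by rewrite classified_ell.
by move=> m m' S S' /composition_series_length-> /composition_series_length->.
Qed.

End Classified.

(** * Perfect complexes over an artinian ring *)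

Section PerfSupport.
Variables (R : comPzRingType) (n : nat) (e : 'I_n -> R).
Hypothesis le : forall i, local_idem (e i).
Hypothesis oe : forall i j, i != j -> e i * e j = 0.
Hypothesis se : \sum_i e i = 1.

Let ee i : e i * e i = e i. Proof. by case: (le i). Qed.

Definition unit_perf i : Perf R :=
  exist _ (icomplex (iunit (e i)))
    (strictly_perfect_perfect (strictly_perfect_unit (ee i))).

Lemma cker_unit_perf i j : cker (perf_cohfun (ee j)) (unit_perf i) <-> i <> j.
Proof.
apply: (iff_trans (cker_coh (e j) (icomplex (iunit (e i))))); split.
  move=> C ij; rewrite -ij in C.
  (* [coh] at index -1 is the cohomology in degree 0, where e R sits with zero differential. *)
  have gr : igr (iunit (e i)) (-1 + 1) (e i : R^o) by apply: ee.
  have [|y dy] := C (-1) (mksub gr).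
    split; apply: sm_inj => //; exact: ee.
  case: (le i) => _ + _; apply; exact: (esym (congr1 (@smval _ _ _) dy)).
move=> /eqP ij k x [_ ex]; exists 0; rewrite linear0; apply: sm_inj.
have ejx : e j * smval x = smval x := congr1 (@smval _ _ _) ex.
by rewrite -ejx -(iunit_fix (subP x)) mulrA [e j * _]mulrC oe ?mul0r.
Qed.

Section Parts.
Variables (P : complex R) (sP : strictly_perfect P).

Let s (k : nat) : R := \sum_(i < n | (i < k)%N) e i.

Let sS (k : 'I_n) : s k.+1 = s k + e k.
Proof.
rewrite /s (bigD1 k) //= addrC; congr (_ + _); apply: eq_bigl => i.
by rewrite -val_eqE /= ltnS ltn_neqAle andbC.
Qed.

Let s_orth (k : 'I_n) : s k * e k = 0.
Proof.
rewrite /s mulr_suml big1 // => i ik; apply: oe.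
by rewrite -val_eqE /= (ltn_eqF ik).
Qed.

Let ss k : (k <= n)%N -> s k * s k = s k.
Proof.
elim: k => [_|k IH kn]; first by rewrite /s big_pred0 ?mulr0 // => i.
rewrite (sS (Ordinal kn)); apply: idemD => //; exact/IH/ltnW.
Qed.

(** Climbs from 0 to 1 along the partial sums of the [e i], each new idempotent being orthogonal to
    the sum so far. It serves both membership in a thick subcategory and nullity. *)
Lemma parts_ind (C : complex R -> Prop) :
  C (idem_part 0 P) ->
  (forall a b, a * a = a -> b * b = b -> a * b = 0 ->
     C (idem_part a P) -> C (idem_part b P) -> C (idem_part (a + b) P)) ->
  (forall i, C (idem_part (e i) P)) -> C (idem_part 1 P).
Proof.
move=> C0 CD Ce; have sn : s n = 1.
  by rewrite -se; apply: eq_bigl => i; rewrite ltn_ord.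
rewrite -sn; have : (n <= n)%N by []; elim: {-2}n => [_|k IH kn].
  by rewrite /s big_pred0 // => i.
rewrite (sS (Ordinal kn)); apply: CD => //; first exact/ss/ltnW.
exact/IH/ltnW.
Qed.

Lemma Sp_parts (S : Perf R -> Prop) : thick S ->
  Sp S P <-> forall i, Sp S (idem_part (e i) P).
Proof.
move=> thS; have [f [g fg]] := idem_part1 P.
have gf : @chain_iso R P (idem_part 1 P) g f.
  have [fd fK gK] := fg; split=> // i x.
  by rewrite -(fK (i + 1) (cdiff _ i _)) fd gK.
split=> [SP i|Se].
  have := Sp_iso thS gf SP.
  have -> : (1 : R) = e i + (1 - e i) by rewrite addrC subrK.
  apply: (Sp_idem_summand (ee i) _ _ thS sP).
    by rewrite mulrBr mulr1 mulrBl mul1r ee subrr subr0.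
  by rewrite mulrBr mulr1 ee subrr.
apply: (Sp_iso thS fg); apply: parts_ind => //.
  apply: (null_Sp thS _ (idem_part0 P)).
  exact: (strictly_perfect_idem (mulr0 0) sP).
by move=> a b aa bb ab; apply: Sp_idem_sum.
Qed.

Lemma null_parts : (forall i, @null R (idem_part (e i) P)) -> @null R P.
Proof.
move=> Ne; have [f [g fg]] := idem_part1 P; apply: (null_iso (chain_iso_diso fg)).
apply: (parts_ind (C := @null R)) => // [|a b aa bb ab]; first exact: idem_part0.
by apply: null_direct_sum; apply/lemb_direct_sum/idem_part_direct_sum.
Qed.

End Parts.

(** The support collects the i for which e_i P is not null. Such a part lies in a thick subcategory
    exactly when e_i R does, by [idem_dichotomy]; null parts lie in all of them. *)
Lemma perf_support (X : Perf R) : exists U : 'I_n -> Prop,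
  (forall S, thick S -> (S X <-> forall i, U i -> S (unit_perf i))) /\
  ((forall i, ~ U i) -> is_zero X).
Proof.
case: X => X pX; have [P [sP XP]] := pX.
exists (fun i => ~ @null R (idem_part (e i) P)); split; last first.
  move=> N; apply/null_is_zero/(null_iso (isomorphic_sym XP))/null_parts => i.
  exact: contrapT (N i).
move=> S thS.
have -> : S (exist _ X pX) <-> Sp S P.
  apply: iff_trans (iff_sym (inSE S pX)) _; split=> [SX|[_ SP]].
    by split=> //; apply: inS_diso XP SX.
  exact: inS_diso (isomorphic_sym XP) SP.
have UE i : S (unit_perf i) <-> Sp S (icomplex (iunit (e i))).
  have pU := strictly_perfect_unit (ee i).
  have HU := inSE S (strictly_perfect_perfect (strictly_perfect_unit (ee i))).
  by split=> [/HU|[_ /HU]].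
apply: iff_trans (Sp_parts sP thS) _; split=> [Se i Ui|Se i].
  by have [//|HS] := idem_dichotomy (le i) sP; apply/UE/HS.
have [Ni|HS] := idem_dichotomy (le i) sP.
  by apply: null_Sp => //; apply: strictly_perfect_idem.
have [Ni|Ni] := pselect (@null R (idem_part (e i) P)); last exact/HS/UE/Se.
by apply: null_Sp => //; apply: strictly_perfect_idem.
Qed.

Lemma perf_zero_cone (X : Perf R) : exists P Z g h,
  isomorphic X P /\ @dist (Perf R) P P Z (zerom P P) g h.
Proof.
case: X => X pX; have [P [sP XP]] := pX.
have pP := strictly_perfect_perfect sP.
have sC := strictly_perfect_cone (chain_zero P P) sP sP.
have pC := strictly_perfect_perfect sC.
have d := @verdier_dist (homotopyCat R) (@acyclic R) _ _ _ _ _ _ (cone_dist (chain_zero P P)).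
exists (exist _ P pP), (exist _ (cone (chain_zero P P)) pC).
do 2!eexists; split; last exact: d.
by case: XP => f fi; exists f.
Qed.

Lemma perf_addm_swap (X Y : Perf R) (f g h : hom X Y) : addm f g ≈ h -> addm g f ≈ h.
Proof. exact: lheq_trans (laddC _ _). Qed.

Lemma perf_ell : ell (Perf R) = Some n.
Proof.
exact: (classified_ell cker_unit_perf perf_support perf_zero_cone perf_addm_swap).
Qed.

Lemma perf_JD : JD (Perf R).
Proof.
exact: (classified_JD cker_unit_perf perf_support perf_zero_cone perf_addm_swap).
Qed.

End PerfSupport.

Unset Implicit Arguments.

Theorem proposition3p18 (R : comPzRingType) (hR : artinian R) :
  exists n : nat,
    [/\ [set m : set R | maximal_ideal m] #= `I_n,
        ell (Perf R) = Some n
      & JD (Perf R)].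
Proof.
have [n [e [le oe se]]] := artinian_idempotents hR; exists n.
have le' (i : 'I_n) : local_idem (e i) by apply: le.
have oe' (i j : 'I_n) : i != j -> e i * e j = 0.
  by move=> ij; apply: oe.
split; first exact: card_maximal_ideals le oe se.
  exact: (perf_ell le' oe' se).
exact: (perf_JD le' oe' se).
Qed.
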